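(* The elements $Z^{(2)},Z^{(4)},Z^{(6)},\dots$ are free generators of the centre of $\mathrm Y(\mathfrak q_N)$; that is, they are algebraically independent and generate the centre of the $\mathbb Z_2$-graded algebra $\mathrm Y(\mathfrak q_N)$.
   Context: Work over $\mathbb C$; fix $N\ge1$. Indices $i,j,k,l$ run over $\pm1,\dots,\pm N$; $\bar\imath=0$ if $i>0$ and $\bar\imath=1$ if $i<0$. Square brackets denote the supercommutator. Tensor products of $\mathbb Z_2$-graded algebras have multiplication $(X\otimes Y)(X'\otimes Y')=XX'\otimes YY'\cdot(-1)^{\deg X'\deg Y}$. $\mathbb C^{N|N}$ has basis $e_i$ with $\deg e_i=\bar\imath$; $E_{ij}$ are the matrix units, $\deg E_{ij}=\bar\imath+\bar\jmath$. Yangian: $\mathrm Y(\mathfrak q_N)$ is the complex associative unital $\mathbb Z_2$-graded algebra with generators $T_{ij}^{(s)}$ ($s\ge1$), $\deg T^{(s)}_{ij}=\bar\imath+\bar\jmath$, and relations, where $T_{ij}(u)=\delta_{ij}+T^{(1)}_{ij}u^{-1}+T^{(2)}_{ij}u^{-2}+\cdots$, $$(u^2-v^2)[T_{ij}(u),T_{kl}(v)](-1)^{\bar\imath\bar k+\bar\imath\bar l+\bar k\bar l}=(u+v)\bigl(T_{kj}(u)T_{il}(v)-T_{kj}(v)T_{il}(u)\bigr)-(u-v)\bigl(T_{-k,j}(u)T_{-i,l}(v)-T_{k,-j}(v)T_{i,-l}(u)\bigr)(-1)^{\bar k+\bar l},$$ $$T_{ij}(-u)=T_{-i,-j}(u).$$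 The centre of a $\mathbb Z_2$-graded algebra is the set of elements that supercommute with every element. Let $T(u)=\sum_{ij}E_{ij}\otimes T_{ij}(u)\in\mathrm{End}(\mathbb C^{N|N})\otimes\mathrm Y(\mathfrak q_N)[[u^{-1}]]$; this element is invertible, and we write $T(u)^{-1}=\sum_{ij}E_{ij}\otimes\widetilde T_{ij}(u)$. There is a series $Z(u)\in\mathrm Y(\mathfrak q_N)[[u^{-1}]]$ such that $\sum_i T_{ij}(u)\widetilde T_{ki}(u)=\delta_{jk}Z(u)$ for all $j,k$; its coefficients have $\mathbb Z_2$-degree zero and are central, and $Z(-u)=Z(u)$, so that $Z(u)=1+Z^{(2)}u^{-2}+Z^{(4)}u^{-4}+\cdots$, which defines $Z^{(2)},Z^{(4)},\dots$. *)

(* Defs.v *)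
From HB Require Import structures.
From mathcomp Require Import all_boot all_order all_algebra.
From mathcomp Require Import generic_quotient ring_quotient.
From mathcomp Require Import boolp reals complex.
From mathcomp Require Import finmap monalg.

Set Implicit Arguments.
Unset Strict Implicit.
Unset Printing Implicit Defensive.

Import GRing.Theory.
Local Open Scope ring_scope.
Local Open Scope quotient_scope.

(* Indices +-1, ..., +-N: the pair (a, b) is a.+1 if b = false and -(a.+1) if
   b = true, so that the second component is the parity of the index. *)
Notation idx N := ('I_N * bool)%type.

Definition bar N (i : idx N) : bool := i.2.
(* The index -i. *)
Definition negi N (i : idx N) : idx N := (i.1, ~~ i.2).

(* The supercommutator on an algebra whose degree d homogeneous components are
   given by p d, extended bilinearly to inhomogeneous elements. *)
Definition supercomm (A : nzRingType) (p : bool -> A -> A) (x y : A) : A :=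
  \sum_(a : bool) \sum_(b : bool)
    (p a x * p b y - (-1) ^+ (a * b)%N * (p b y * p a x)).

Lemma supercommE (A : nzRingType) (p : bool -> A -> A) x y :
  supercomm p x y =
    (p true x * p true y + p true y * p true x)
  + (p true x * p false y - p false y * p true x)
  + ((p false x * p true y - p true y * p false x)
  + (p false x * p false y - p false y * p false x)).
Proof.
rewrite /supercomm; do ![rewrite big_bool /=].
by rewrite !(expr0, expr1, mul1r, mulN1r, opprK).
Qed.

Inductive ideal_gen (A : nzRingType) (S : A -> Prop) : A -> Prop :=
| IdealIn x of S x : ideal_gen S x
| Ideal0 : ideal_gen S 0
| IdealB x y of ideal_gen S x & ideal_gen S y : ideal_gen S (x - y)
| IdealMl a x of ideal_gen S x : ideal_gen S (a * x)
| IdealMr a x of ideal_gen S x : ideal_gen S (x * a).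

Definition subalg_gen (K : comNzRingType) (A : algType K) (S : A -> Prop)
    (x : A) : Prop :=
  forall B : {pred A}, GRing.subalg_closed B ->
    (forall y, S y -> y \in B) -> x \in B.

(* The letter (i, j, s) stands for the generator T_ij^(s+1). *)
Notation letter N := (idx N * idx N * nat)%type.
Notation word N := {fmonom letter N}.
Notation freealg K N := {malg K[word N]}.

Section FreeAlgebra.
Variables (K : fieldType) (N : nat).
Local Notation letter := (letter N).
Local Notation word := (word N).
Local Notation freealg := (freealg K N).

Definition ldeg (g : letter) : bool := bar g.1.1 (+) bar g.1.2.
Definition wdeg (w : word) : bool :=
  \big[addb/false]_(g <- (w : seq letter)) ldeg g.

(* The homogeneous component of degree d. *)
Definition fpart (d : bool) (x : freealg) : freealg :=
  [malg w in msupp x => x@_w *+ (wdeg w == d)].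

Definition fT (i j : idx N) (s : nat) : freealg :=
  if s is s'.+1 then << fmu ((i, j, s') : letter) >> else (i == j)%:R.

(* The coefficient of u^m in T_ij(u). *)
Definition fTc (i j : idx N) (m : int) : freealg :=
  if (m <= 0)%R then fT i j `|m|%N else 0.

(* A formal series in u, v is given by its coefficients at u^m v^n. *)
Definition mulu (X : int -> int -> freealg) : int -> int -> freealg :=
  fun m n => X (m - 1) n.
Definition mulv (X : int -> int -> freealg) : int -> int -> freealg :=
  fun m n => X m (n - 1).

(* The coefficient at u^m v^n of the difference of the two sides of the
   quadratic relation; TuTv, TvTu are the series T_ab(u) T_cd(v) and
   T_ab(v) T_cd(u). *)
Definition yangian_relator (i j k l : idx N) (m n : int) : freealg :=
  let TuTv a b c d : int -> int -> freealg :=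
    fun m n => fTc a b m * fTc c d n in
  let TvTu a b c d : int -> int -> freealg :=
    fun m n => fTc a b n * fTc c d m in
  let A : int -> int -> freealg := fun m n =>
    (-1) ^+ (bar i * bar k + bar i * bar l + bar k * bar l)%N
      * supercomm fpart (fTc i j m) (fTc k l n) in
  let P : int -> int -> freealg := fun m n =>
    TuTv k j i l m n - TvTu k j i l m n in
  let Q : int -> int -> freealg := fun m n =>
    (-1) ^+ (bar k + bar l)%N
      * (TuTv (negi k) j (negi i) l m n - TvTu k (negi j) i (negi l) m n) in
  (mulu (mulu A) m n - mulv (mulv A) m n)
  - ((mulu P m n + mulv P m n) - (mulu Q m n - mulv Q m n)).

(* The coefficient at u^(-s) of T_ij(-u) - T_(-i,-j)(u). *)
Definition symmetry_relator (i j : idx N) (s : nat) : freealg :=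
  (-1) ^+ s * fT i j s - fT (negi i) (negi j) s.

Inductive relator : freealg -> Prop :=
| RelYangian i j k l m n : relator (yangian_relator i j k l m n)
| RelSymmetry i j s : relator (symmetry_relator i j s).

Definition yideal : {pred freealg} := fun x => `[< ideal_gen relator x >].

Lemma yidealP x : reflect (ideal_gen relator x) (x \in yideal).
Proof. exact: asboolP. Qed.

Fact yideal_zmod_closed : zmod_closed yideal.
Proof.
split; first by apply/yidealP; exact: Ideal0.
by move=> x y /yidealP hx /yidealP hy; apply/yidealP; exact: IdealB.
Qed.
HB.instance Definition _ :=
  GRing.isZmodClosed.Build freealg yideal yideal_zmod_closed.

Lemma yidealMl a x : x \in yideal -> a * x \in yideal.
Proof. by move=> /yidealP hx; apply/yidealP; exact: IdealMl. Qed.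

Lemma yidealMr a x : x \in yideal -> x * a \in yideal.
Proof. by move=> /yidealP hx; apply/yidealP; exact: IdealMr. Qed.

(* The counit sends every T_ij^(s), s >= 1, to 0. *)
Definition is_counit (e : freealg -> K) : Prop :=
  forall i j s, e (fT i j s) = ((s == 0%N) && (i == j))%:R.

Lemma counitP : {e : {rmorphism freealg -> K} | is_counit e}.
Proof.
exists (@mcoeff word K mone : {rmorphism freealg -> K}).
move=> i j [|s] /=; first by rewrite rmorph_nat.
by rewrite mcoeffU1 fm1_eq1.
Qed.

Lemma fpartE d x w : (fpart d x)@_w = x@_w *+ (wdeg w == d).
Proof. by rewrite mcoeffE; case: msuppP => // _; rewrite mul0rn. Qed.

Fact fpart_is_linear d : linear (fpart d).
Proof.
move=> c x y; apply/malgP => w.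
by rewrite !(mcoeffD, mcoeffZ, fpartE) mulrnDl mulrnAr.
Qed.
HB.instance Definition _ d :=
  GRing.isLinear.Build K freealg freealg *:%R (fpart d) (fpart_is_linear d).

Lemma fpartU d c (w : word) :
  fpart d << c *g w >> = << c *g w >> *+ (wdeg w == d).
Proof.
apply/malgP => v; rewrite fpartE mcoeffMn mcoeffU.
by case: (w =P v) => [->//|_]; rewrite mulr0n !mul0rn.
Qed.

Lemma wdegM (v w : word) : wdeg (mmul v w) = wdeg v (+) wdeg w.
Proof. by rewrite /wdeg fmM big_cat. Qed.

Lemma fpart_sum x : x = fpart false x + fpart true x.
Proof.
apply/malgP => w; rewrite mcoeffD !fpartE.
by case: (wdeg w); rewrite ?addr0 ?add0r.
Qed.

Lemma fpart_fpart d e x : fpart d (fpart e x) = fpart d x *+ (d == e).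
Proof.
apply/malgP => w; rewrite mcoeffMn !fpartE.
by case: (wdeg w); case: d; case: e; rewrite ?mulr1n ?mulr0n ?mul0rn.
Qed.

Lemma fpartM d x y :
  fpart d (x * y) = \sum_(a : bool) fpart a x * fpart (a (+) d) y.
Proof.
rewrite [x]monalgE [y]monalgE.
rewrite big_distrl /= raddf_sum /=.
under [RHS]eq_bigr do rewrite raddf_sum big_distrl /=.
rewrite exchange_big; apply: eq_bigr => v _.
rewrite big_distrr /= raddf_sum /=.
under [RHS]eq_bigr do rewrite raddf_sum big_distrr /=.
rewrite exchange_big; apply: eq_bigr => w _.
rewrite malgM_def fgmulUU fpartU wdegM big_bool /= !fpartU.
rewrite !(mulrnAl, mulrnAr) !malgM_def !fgmulUU.
by case: (wdeg v); case: (wdeg w); case: d;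
  rewrite !(mulr0n, mulr1n) ?addr0 ?add0r.
Qed.

Lemma fscaleAr c (x y : freealg) : c *: (x * y) = x * (c *: y).
Proof.
apply/malgP => w; rewrite mcoeffZ [in LHS]mcoeffMl.
rewrite [RHS](mcoeffMlw _ (fsubset_refl _) (msuppZ_le c y)).
rewrite mulr_sumr; apply: eq_bigr => v _.
rewrite mulr_sumr; apply: eq_bigr => z _.
by rewrite mcoeffZ mulrCA mulrnAr.
Qed.

Definition homog (d : bool) (x : freealg) : Prop := fpart d x = x.

Lemma homog_part d e x : homog e x -> fpart d x = x *+ (d == e).
Proof.
by move=> <-; rewrite fpart_fpart; case: (d =P e) => [->|]; rewrite // !mulr0n.
Qed.

Lemma homogM d e x y : homog d x -> homog e y -> homog (d (+) e) (x * y).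
Proof.
move=> hx hy; rewrite /homog fpartM big_bool /=.
rewrite !(homog_part _ hx) !(homog_part _ hy).
by case: d {hx}; case: e {hy};
  rewrite /= !(mulr0n, mulr1n, mulr0, mul0r, addr0, add0r).
Qed.

Lemma homogB d x y : homog d x -> homog d y -> homog d (x - y).
Proof. by rewrite /homog raddfB /= => -> ->. Qed.

Lemma homogD d x y : homog d x -> homog d y -> homog d (x + y).
Proof. by rewrite /homog raddfD /= => -> ->. Qed.

Lemma homog_sign d n x : homog d x -> homog d ((-1) ^+ n * x).
Proof.
by move=> hx; rewrite -signr_odd mulr_sign; case: ifP => // _;
  rewrite /homog raddfN /= hx.
Qed.

Lemma homog0 d : homog d 0. Proof. exact: raddf0. Qed.

Lemma homog_fT i j s : homog (bar i (+) bar j) (fT i j s).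
Proof.
case: s => [|s] /=; last first.
  by rewrite /homog fpartU /wdeg fmU big_seq1 eqxx mulr1n.
case: eqP => [->|_]; last exact: homog0.
by rewrite addbb /homog fpartU /wdeg fm1 big_nil eqxx mulr1n.
Qed.

Lemma homog_fTc i j m : homog (bar i (+) bar j) (fTc i j m).
Proof. by rewrite /fTc; case: ifP => _; [exact: homog_fT|exact: homog0]. Qed.

Lemma supercomm_homog a b x y : homog a x -> homog b y ->
  supercomm fpart x y = x * y - (-1) ^+ (a * b)%N * (y * x).
Proof.
move=> hx hy; rewrite supercommE mulnb mulr_sign.
rewrite !(homog_part _ hx) !(homog_part _ hy).
by case: a {hx}; case: b {hy}; rewrite /= !(mulr0n, mulr1n, mulr0, mul0r, oppr0,
  subr0, addr0, add0r, opprK).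
Qed.

Lemma homog_comm a b x y : homog a x -> homog b y ->
  homog (a (+) b) (supercomm fpart x y).
Proof.
move=> hx hy; rewrite (supercomm_homog hx hy); apply: homogB.
  exact: homogM.
by apply: homog_sign; rewrite addbC; exact: homogM.
Qed.

Lemma relator_homog x : relator x -> exists d, homog d x.
Proof.
case=> [i j k l m n|i j s].
- exists ((bar i (+) bar j) (+) (bar k (+) bar l)).
  rewrite /yangian_relator /mulu /mulv.
  have h1 a b c d m1 m2 :
      bar a (+) bar b (+) (bar c (+) bar d)
      = bar i (+) bar j (+) (bar k (+) bar l) ->
      homog (bar i (+) bar j (+) (bar k (+) bar l)) (fTc a b m1 * fTc c d m2).
    by move=> <-; apply: homogM; exact: homog_fTc.
  have h2 m1 m2 : homog (bar i (+) bar j (+) (bar k (+) bar l))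
      (supercomm fpart (fTc i j m1) (fTc k l m2)).
    by apply: homog_comm; exact: homog_fTc.
  repeat first [apply: homogB | apply: homogD | apply: homog_sign
               | exact: h2 | apply: h1];
  by rewrite /bar /=; case: i.2; case: j.2; case: k.2; case: l.2.
- exists (bar i (+) bar j); apply: homogB.
    by apply: homog_sign; exact: homog_fT.
  have -> : bar i (+) bar j = bar (negi i) (+) bar (negi j).
    by rewrite /bar /=; case: i.2; case: j.2.
  exact: homog_fT.
Qed.

Lemma rmorph_subM (A B : nzRingType) (e : {rmorphism A -> B}) x y z t :
  e (x * y - z * t) = e x * e y - e z * e t.
Proof. by rewrite rmorphB !rmorphM. Qed.

Lemma rmorph_sub_eq0 (A B : nzRingType) (e : {rmorphism A -> B})
    c a1 a2 p1 p2 d q1 q2 :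
  e a1 = 0 -> e a2 = 0 -> e p1 = 0 -> e p2 = 0 -> e q1 = 0 -> e q2 = 0 ->
  e (c * a1 - c * a2 - ((p1 + p2) - (d * q1 - d * q2))) = 0.
Proof.
move=> h1 h2 h3 h4 h5 h6.
rewrite !(rmorphB, rmorphD, rmorphM) /= h1 h2 h3 h4 h5 h6.
by rewrite !(mulr0, subr0, addr0).
Qed.

Lemma subMM (A : nzRingType) (x y x' y' : A) :
  x * y - x' * y' = (x - x') * y + x' * (y - y').
Proof. by rewrite mulrBl mulrBr addrA subrK. Qed.

Lemma negiK : involutive (@negi N).
Proof. by case=> a b; rewrite /negi /= negbK. Qed.

Lemma counit_fTc (e : {rmorphism freealg -> K}) i j m : is_counit e ->
  e (fTc i j m) = ((m == 0) && (i == j))%:R.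
Proof.
move=> he; rewrite /fTc; case: ifP => m0; first by rewrite he absz_eq0.
rewrite (rmorph0 e); suff -> : (m == 0) = false by [].
by apply/eqP => mE; rewrite mE in m0.
Qed.

Lemma counit_supercomm (e : {rmorphism freealg -> K}) i j k l m n :
  is_counit e -> e (supercomm fpart (fTc i j m) (fTc k l n)) = 0.
Proof.
move=> he; rewrite (supercomm_homog (homog_fTc i j m) (homog_fTc k l n)).
rewrite mulnb mulr_sign; case: ifP => [/andP[ij _]|_].
  have E : e (fTc i j m) = 0.
    rewrite counit_fTc //; case: (i =P j) ij => [->|]; first by rewrite addbb.
    by rewrite andbF.
  by rewrite -[- (_ * _)]mulNr (rmorph_subM e) E mul0r mulr0 subr0.
by rewrite (rmorph_subM e) [X in _ - X]mulrC subrr.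
Qed.

Lemma counit_relator (e : {rmorphism freealg -> K}) x :
  is_counit e -> relator x -> e x = 0.
Proof.
move=> he; case=> [i j k l m n|i j s].
- have hN (a b : idx N) : (negi a == b) = (a == negi b).
    by rewrite -{1}(negiK b) (inj_eq (can_inj negiK)).
  have hP m1 n1 : e (fTc k j m1 * fTc i l n1 - fTc k j n1 * fTc i l m1) = 0.
    rewrite (rmorph_subM e) !(counit_fTc _ _ _ he) -!natrM !mulnb.
    by apply/eqP; rewrite subr_eq0 andbACA [(m1 == 0) && _]andbC andbACA.
  have hQ m1 n1 : e (fTc (negi k) j m1 * fTc (negi i) l n1
                     - fTc k (negi j) n1 * fTc i (negi l) m1) = 0.
    rewrite (rmorph_subM e) !(counit_fTc _ _ _ he) -!natrM !mulnb !hN.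
    by apply/eqP; rewrite subr_eq0 andbACA [(m1 == 0) && _]andbC andbACA.
  rewrite /yangian_relator /mulu /mulv; apply: rmorph_sub_eq0 => //;
    exact: counit_supercomm.
- rewrite /symmetry_relator (rmorphB e) (rmorphM e) !he.
  rewrite (inj_eq (can_inj negiK)).
  by case: s => [|s] /=; rewrite ?expr0 ?(rmorph1 e) ?mul1r ?mulr0 subrr.
Qed.

Lemma yideal1 : 1 \notin yideal.
Proof.
have [e he] := counitP; apply/negP => /yidealP H.
suff: e 1 = 0 by rewrite (rmorph1 e) => /eqP; rewrite oner_eq0.
elim: H => [y|//|y z _ hy _ hz|a y _ hy|a y _ hy].
- exact: counit_relator.
- exact: (rmorph0 e).
- by rewrite (rmorphB e) hy hz subrr.
- by rewrite (rmorphM e) hy mulr0.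
- by rewrite (rmorphM e) hy mul0r.
Qed.

Lemma yideal_part d x : x \in yideal -> fpart d x \in yideal.
Proof.
move=> /yidealP H; move: d; elim: H => [y hy|//|y z _ hy _ hz|a y _ hy|a y _ hy] e.
- have [b hb] := relator_homog hy; rewrite (homog_part _ hb) rpredMn //.
  by apply/yidealP; exact: IdealIn.
- by rewrite (raddf0 (fpart e)) rpred0.
- by rewrite (raddfB (fpart e)) rpredB // ?hy ?hz.
- by rewrite fpartM rpred_sum // => b _; rewrite yidealMl ?hy.
- by rewrite fpartM rpred_sum // => b _; rewrite yidealMr ?hy.
Qed.

Definition yangian : Type := {ideal_quot yideal}.
HB.instance Definition _ := GRing.Zmodule.on yangian.
HB.instance Definition _ := EqQuotient.on yangian.

Local Notation pi := (\pi_yangian : freealg -> yangian).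

Lemma eq_pi x y : (pi x = pi y) <-> (x - y \in yideal).
Proof. by rewrite Quotient.idealrBE; split=> [->//|/eqP]. Qed.

Lemma pi_surj (y : yangian) : exists x, y = pi x.
Proof. by exists (repr y); rewrite reprK. Qed.

Lemma pi_repr x : x - repr (pi x) \in yideal.
Proof. by apply/eq_pi; rewrite reprK. Qed.

Lemma piD x y : pi (x + y) = pi x + pi y.
Proof. exact: (raddfD pi). Qed.

Definition ymul (x y : yangian) : yangian := pi (repr x * repr y).
Definition yscale (c : K) (x : yangian) : yangian := pi (c *: repr x).
(* The homogeneous component of degree d; by pi_part below, this is the map
   induced by fpart d. *)
Definition ypart (d : bool) (x : yangian) : yangian := pi (fpart d (repr x)).

Lemma pi_mul x y : pi (x * y) = ymul (pi x) (pi y).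
Proof.
apply/eq_pi; rewrite subMM rpredD //.
  exact: yidealMr (pi_repr _).
exact: yidealMl (pi_repr _).
Qed.

Lemma pi_scale c x : pi (c *: x) = yscale c (pi x).
Proof.
apply/eq_pi; rewrite -scalerBr -mul_malgC.
exact: yidealMl (pi_repr _).
Qed.

Lemma pi_part d x : pi (fpart d x) = ypart d (pi x).
Proof.
apply/eq_pi; rewrite -(raddfB (fpart d)).
exact: yideal_part (pi_repr _).
Qed.

Lemma ypart_sum x : x = ypart false x + ypart true x.
Proof.
by have [y ->] := pi_surj x; rewrite -!pi_part -piD -fpart_sum.
Qed.

Lemma ypart_fT i j s :
  ypart (bar i (+) bar j) (pi (fT i j s)) = pi (fT i j s).
Proof. by rewrite -pi_part homog_fT. Qed.

Fact ymulA : associative ymul.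
Proof.
move=> x y z.
have [[[a ->] [b ->]] [c ->]] := (pi_surj x, pi_surj y, pi_surj z).
by rewrite -!pi_mul mulrA.
Qed.

Fact ymul1 : left_id (pi 1) ymul.
Proof. by move=> x; have [a ->] := pi_surj x; rewrite -pi_mul mul1r. Qed.

Fact ymulr1 : right_id (pi 1) ymul.
Proof. by move=> x; have [a ->] := pi_surj x; rewrite -pi_mul mulr1. Qed.

Fact ymulDl : left_distributive ymul +%R.
Proof.
move=> x y z.
have [[[a ->] [b ->]] [c ->]] := (pi_surj x, pi_surj y, pi_surj z).
by rewrite -piD -!pi_mul -piD mulrDl.
Qed.

Fact ymulDr : right_distributive ymul +%R.
Proof.
move=> x y z.
have [[[a ->] [b ->]] [c ->]] := (pi_surj x, pi_surj y, pi_surj z).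
by rewrite -piD -!pi_mul -piD mulrDr.
Qed.

Fact yone_neq0 : pi 1 != 0.
Proof.
apply/eqP => h; move: yideal1; suff -> : 1 \in yideal by [].
by rewrite -[1]subr0; apply/eq_pi; rewrite h (raddf0 pi).
Qed.

HB.instance Definition _ := GRing.Zmodule_isNzRing.Build yangian
  ymulA ymul1 ymulr1 ymulDl ymulDr yone_neq0.

Fact yscaleA a b x : yscale a (yscale b x) = yscale (a * b) x.
Proof. by have [y ->] := pi_surj x; rewrite -!pi_scale scalerA. Qed.

Fact yscale1 : left_id 1 yscale.
Proof. by move=> x; have [y ->] := pi_surj x; rewrite -pi_scale scale1r. Qed.

Fact yscaleDr : right_distributive yscale +%R.
Proof.
move=> c x y; have [[a ->] [b ->]] := (pi_surj x, pi_surj y).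
by rewrite -piD -!pi_scale -piD scalerDr.
Qed.

Fact yscaleDl x : {morph yscale^~ x : a b / a + b}.
Proof.
move=> a b /=; have [y ->] := pi_surj x.
by rewrite -!pi_scale -piD scalerDl.
Qed.

HB.instance Definition _ := GRing.Zmodule_isLmodule.Build K yangian
  yscaleA yscale1 yscaleDr yscaleDl.

Fact yscaleAl c (x y : yangian) : c *: (x * y) = c *: x * y.
Proof.
have [[a ->] [b ->]] := (pi_surj x, pi_surj y).
by rewrite -[LHS]/(yscale c (ymul _ _)) -[RHS]/(ymul (yscale c _) _)
  -!(pi_scale, pi_mul) scalerAl.
Qed.

HB.instance Definition _ := GRing.Lmodule_isLalgebra.Build K yangian yscaleAl.

Fact yscaleAr c (x y : yangian) : c *: (x * y) = x * (c *: y).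
Proof.
have [[a ->] [b ->]] := (pi_surj x, pi_surj y).
rewrite -[LHS]/(yscale c (ymul _ _)) -[RHS]/(ymul _ (yscale c _)).
by rewrite -!(pi_scale, pi_mul) fscaleAr.
Qed.

HB.instance Definition _ := GRing.Lalgebra_isAlgebra.Build K yangian yscaleAr.

(* The coefficient T_ij^(s) of u^(-s) in T_ij(u). *)
Definition yT (i j : idx N) (s : nat) : yangian := pi (fT i j s).

(* A formal series in u^(-1) is given by its coefficients at u^(-n), and an
   element sum_ij E_ij (x) A_ij(u) of the tensor product of End(C^(N|N)) with
   the algebra of such series by the family A. The sign in endmul comes from
   (E_ij (x) a)(E_jl (x) b) = (-1)^(deg a * deg E_jl) E_il (x) ab. *)
Definition yseries : Type := nat -> yangian.

Definition smul (f g : yseries) : yseries :=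
  fun n => \sum_(k < n.+1) f k * g (n - k)%N.

Definition endmul (A B : idx N -> idx N -> yseries) : idx N -> idx N -> yseries :=
  fun i l n => \sum_(j : idx N) \sum_(d : bool)
    (-1) ^+ (d * (bar j + bar l))%N
      * smul (fun k => ypart d (A i j k)) (B j l) n.

Definition endone : idx N -> idx N -> yseries :=
  fun i j n => ((i == j) && (n == 0%N))%:R.

Definition is_inverse (A B : idx N -> idx N -> yseries) : Prop :=
  (forall i j n, endmul A B i j n = endone i j n) /\
  (forall i j n, endmul B A i j n = endone i j n).

Definition supercentral (x : yangian) : Prop :=
  forall y : yangian, supercomm ypart x y = 0.

End FreeAlgebra.

(* Main.v *)
(* The Yangian is filtered by giving T_ij^(s+1) degree s and, within a given degree, by the
   number of generators in a product. Let rho be the representation of the Yangian on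
   C^(N|N)[z] given by
     T_ij(u) |-> delta_ij - (-1)^i (E_ji / (u - z) + E_(-j,-i) / (u + z)).
   The coaction T(u) |-> T(u) (x) rho(T(u)) is multiplicative; subtracting x |-> x (x) 1 from
   it leaves a map which is a derivation up to lower terms and which sends T_ij^(s+1) to a
   constant matrix times z^s up to lower terms. Its matrix coordinates strip one generator
   off an ordered monomial, whence by induction on the length the ordered monomials in the
   generators T_ij^(s+1) with i > 0 are linearly independent.
   The series Z(u) commutes with every T_ij(v) by a direct computation from the quadratic
   relation, and Z^(2k+2) equals -2(2k+1) sum_(i > 0) T_ii^(2k+1) up to lower terms, so that
   Z^(2k+2) may replace T_11^(2k+1) in the ordered monomials. If x is supercentral then its
   image commutes with those of T_ij^(s) for all large s, which forces the leading part of
   the image to be a scalar matrix; hence the leading part of x is a polynomial in the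
   elements Z^(2k+2), and one concludes by descending induction. *)
From HB Require Import structures.
From mathcomp Require Import all_boot all_order all_algebra.
From mathcomp Require Import generic_quotient ring_quotient.
From mathcomp Require Import boolp functions reals complex.
From mathcomp Require finmap monalg.
From mathcomp Require Import zify ring.
Require Import Defs.

Set Implicit Arguments.
Unset Strict Implicit.
Unset Printing Implicit Defensive.

Import Order.TTheory GRing.Theory Num.Theory.
Local Open Scope ring_scope.

(* The notations of monalg clash with those of mpoly, hence the module. *)
Module CenterOfYangian.
Import finmap monalg.

(** * Formal power series *)

(** No faithful representation of the whole algebra is needed: a single factor rho suffices, since
    modulo lower terms [redD] removes one letter and the induction only has to read off which one.
    rho is the action by an R-matrix behind the quadratic relation, with its poles at u = z and u =
    -z. Giving z degree one makes the coaction compatible with the filtration, so no associated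
    graded algebra is built: leading terms are handled as congruences modulo the spans [gr]. The
    Z_2-grading is the main obstacle. Matrices over the Yangian are kept ungraded, and the signs of
    the graded tensor product are absorbed into the embedding of x (x) 1, which applies the parity
    automorphism at odd diagonal positions. The coordinates [mu] play two roles: they are dual to
    the PBW generators, and for every generator other than the Z^(2k+2) they vanish on the matrices
    of x (x) 1. The first gives independence, the second shows that the leading part of a
    supercentral element involves no other generator. *)

Definition ser (A : Type) : Type := nat -> A.

Section SeriesRing.
Variable A : nzRingType.

HB.instance Definition _ := GRing.Zmodule.copy (ser A) (nat -> A).

Definition sermul (f g : ser A) : ser A :=
  fun n => \sum_(k < n.+1) f k * g (n - k)%N.

Definition serone : ser A := fun n => (n == 0%N)%:R.

Definition sertrunc (n : nat) (f : ser A) : {poly A} := \poly_(k < n.+1) f k.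

(** Low coefficients of a product see only truncations, so associativity can be inherited from
    polynomials. *)
Lemma sermul_trunc n k f g : (k <= n)%N ->
  sermul f g k = (sertrunc n f * sertrunc n g)`_k.
Proof.
move=> kn; rewrite coefM; apply: eq_bigr => i _.
rewrite !coef_poly !ltnS (leq_trans (leq_subr _ _) kn).
by rewrite (leq_trans _ kn) // -ltnS.
Qed.

Fact sermulA : associative sermul.
Proof.
move=> f g h; apply/funext => n.
transitivity ((sertrunc n f * (sertrunc n g * sertrunc n h))`_n).
  rewrite coefM; apply: eq_bigr => k _.
  rewrite coef_poly ltn_ord; congr (_ * _).
  by apply: sermul_trunc; rewrite leq_subr.
rewrite mulrA coefM; apply: eq_bigr => k _.
rewrite coef_poly ltnS leq_subr; congr (_ * _).
by apply/esym/sermul_trunc; rewrite -ltnS.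
Qed.

Fact sermul1 : left_id serone sermul.
Proof.
move=> f; apply/funext => n; rewrite /sermul big_ord_recl mul1r subn0.
by rewrite big1 ?addr0 // => i _; rewrite mul0r.
Qed.

Fact sermulr1 : right_id serone sermul.
Proof.
move=> f; apply/funext => n; rewrite /sermul big_ord_recr /= /serone subnn mulr1.
rewrite big1 ?add0r // => i _.
by rewrite subn_eq0 leqNgt ltn_ord mulr0.
Qed.

Fact sermulDl : left_distributive sermul +%R.
Proof.
move=> f g h; apply/funext => n; rewrite /sermul [RHS]/GRing.add/= -big_split /=.
by apply: eq_bigr => k _; rewrite mulrDl.
Qed.

Fact sermulDr : right_distributive sermul +%R.
Proof.
move=> f g h; apply/funext => n; rewrite /sermul [RHS]/GRing.add/= -big_split /=.
by apply: eq_bigr => k _; rewrite mulrDr.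
Qed.

Fact serone_neq0 : serone != 0.
Proof.
apply/eqP => /(congr1 (fun f : ser A => f 0%N)) /eqP.
by rewrite /serone eqxx oner_eq0.
Qed.

HB.instance Definition _ := GRing.Zmodule_isNzRing.Build (ser A)
  sermulA sermul1 sermulr1 sermulDl sermulDr serone_neq0.

Lemma serM (f g : ser A) n : (f * g) n = \sum_(k < n.+1) f k * g (n - k)%N.
Proof. by []. Qed.
Lemma ser1 n : (1 : ser A) n = (n == 0%N)%:R. Proof. by []. Qed.
Lemma serD (f g : ser A) n : (f + g) n = f n + g n. Proof. by []. Qed.
Lemma serN (f : ser A) n : (- f) n = - f n. Proof. by []. Qed.
Lemma serB (f g : ser A) n : (f - g) n = f n - g n. Proof. by []. Qed.

Lemma ser_sum I (r : seq I) (P : pred I) (F : I -> ser A) n :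
  (\sum_(i <- r | P i) F i) n = \sum_(i <- r | P i) F i n.
Proof. by elim/big_rec2: _ => // i x y _ <-. Qed.

Definition serC (a : A) : ser A := fun n => if n is 0%N then a else 0.
Definition serX : ser A := fun n => (n == 1%N)%:R.

Lemma serCM a f n : (serC a * f) n = a * f n.
Proof.
rewrite serM big_ord_recl subn0 big1 ?addr0 // => i _; exact: mul0r.
Qed.

Lemma serMC a f n : (f * serC a) n = f n * a.
Proof.
rewrite serM big_ord_recr /= subnn big1 ?add0r // => i _.
case E: (n - i)%N (subn_gt0 i n) => [|k]; rewrite ?ltn_ord // => _.
exact: mulr0.
Qed.

Fact serC_additive : additive serC.
Proof. by move=> a b; apply/funext => -[|n] //=; rewrite serB subr0. Qed.
Fact serC_multiplicative : multiplicative serC.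
Proof.
split=> [a b|]; apply/funext => -[|n] //; first by rewrite serCM.
by rewrite serCM /= mulr0.
Qed.
HB.instance Definition _ := GRing.isAdditive.Build A (ser A) serC serC_additive.
HB.instance Definition _ :=
  GRing.isMultiplicative.Build A (ser A) serC serC_multiplicative.

Lemma serXM f n : (serX * f) n = if n is m.+1 then f m else 0.
Proof.
rewrite serM big_ord_recl mul0r add0r; case: n => [|n]; first by rewrite big_ord0.
rewrite big_ord_recl /= mul1r subSS subn0 big1 ?addr0 // => i _.
by rewrite /serX /= mul0r.
Qed.

Lemma serMX f n : (f * serX) n = if n is m.+1 then f m else 0.
Proof.
rewrite serM; case: n => [|n]; first by rewrite big_ord1 mulr0.
rewrite 2!big_ord_recr /= subnn mulr0 addr0 subSnn mulr1 big1 ?add0r // => i _.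
rewrite /serX; case: eqP => [E|_]; last by rewrite mulr0.
by have := ltn_ord i; lia.
Qed.

Lemma serX_comm f : serX * f = f * serX.
Proof. by apply/funext => n; rewrite serXM serMX. Qed.

End SeriesRing.

Section CommutativeSeries.
Variable A : comNzRingType.

Fact sermulC : commutative (@sermul A).
Proof.
move=> f g; apply/funext => n; rewrite /sermul (reindex_inj rev_ord_inj).
by apply: eq_bigr => k _; rewrite mulrC /= !subSS subKn // -ltnS.
Qed.
HB.instance Definition _ := GRing.PzRing_hasCommutativeMul.Build (ser A) sermulC.
End CommutativeSeries.

Definition sermap (A B : nzRingType) (e : A -> B) (f : ser A) : ser B := e \o f.

Section SeriesMap.
Variables (A B : nzRingType) (e : {rmorphism A -> B}).

Fact sermap_additive : additive (sermap e).
Proof. by move=> f g; apply/funext => n; rewrite /sermap /= !serB /= rmorphB. Qed.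
Fact sermap_multiplicative : multiplicative (sermap e).
Proof.
split=> [f g|]; apply/funext => n; last by rewrite /sermap /= !ser1 rmorph_nat.
rewrite /sermap /= !serM rmorph_sum; apply: eq_bigr => k _.
by rewrite rmorphM.
Qed.
HB.instance Definition _ :=
  GRing.isAdditive.Build (ser A) (ser B) (sermap e) sermap_additive.
HB.instance Definition _ :=
  GRing.isMultiplicative.Build (ser A) (ser B) (sermap e) sermap_multiplicative.

End SeriesMap.

(* In ser (ser A) the outer variable is u^-1 and the inner one is v^-1. *)
Notation seru := (sermap (@serC _)).
Notation serv := (@serC (ser _)).

Section TwoVariables.
Variable A : nzRingType.
Implicit Types F : ser (ser A).

Definition varx : ser (ser A) := serX (ser A).
Definition vary : ser (ser A) := serC (serX A).

Lemma varx_comm F : varx * F = F * varx. Proof. exact: serX_comm. Qed.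
Lemma vary_comm F : vary * F = F * vary.
Proof. by apply/funext => m; rewrite serCM serMC serX_comm. Qed.

Lemma coef_varx F m n : (varx * F) m n = if m is m'.+1 then F m' n else 0.
Proof. by rewrite serXM; case: m. Qed.
Lemma coef_vary F m n : (vary * F) m n = if n is n'.+1 then F m n' else 0.
Proof. by rewrite serCM serXM. Qed.

Lemma varxE m n : varx m n = ((m == 1%N) && (n == 0%N))%:R.
Proof. by rewrite /varx /serX; case: (m == 1%N). Qed.
Lemma varyE m n : vary m n = ((m == 0%N) && (n == 1%N))%:R.
Proof. by rewrite /vary /serC; case: m. Qed.

Lemma coef_uv (f g : ser A) m n : (seru f * serv g) m n = f m * g n.
Proof. by rewrite serMC serCM. Qed.
Lemma coef_vu (f g : ser A) m n : (serv g * seru f) m n = g n * f m.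
Proof. by rewrite serCM serMC. Qed.

(** Comparing coefficients at v^-(n+2) gives F m n = F (m-2) (n+2), or 0 when m < 2, whence
    induction on m with step 2. This stands in for division by u^2 - v^2. *)
Lemma regular_yx F : (vary * vary - varx * varx) * F = 0 -> F = 0.
Proof.
move=> h; have h' m n : (vary * (vary * F)) m n = (varx * (varx * F)) m n.
  have /(congr1 (fun G : ser (ser A) => G m n)) := h.
  by rewrite mulrBl -!mulrA serB => /subr0_eq.
apply/funext => m; apply/funext; elim/ltn_ind: m => -[|[|m]] IH n.
- by have := h' 0%N n.+2; rewrite !coef_vary coef_varx.
- by have := h' 1%N n.+2; rewrite !coef_vary !coef_varx.
- by have := h' m.+2 n.+2; rewrite !coef_vary !coef_varx => ->; rewrite IH // ltnW.
Qed.

End TwoVariables.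

(** * The quadratic relation *)

Definition sg (A : nzRingType) (b : bool) : A := (-1) ^+ b.

Section Signs.
Variable A : nzRingType.
Lemma sgT : sg A true = -1. Proof. by []. Qed.
Lemma sgF : sg A false = 1. Proof. by []. Qed.
Lemma sgD b c : sg A (b (+) c) = sg A b * sg A c.
Proof. by case: b; case: c; rewrite /sg /= ?expr1 ?expr0 ?mulrNN ?mulr1 ?mul1r. Qed.
Lemma sgK b (a : A) : sg A b * (sg A b * a) = a.
Proof. by case: b; rewrite ?sgT ?sgF ?mulN1r ?mul1r ?mulN1r ?opprK. Qed.
Lemma sgC b (a : A) : a * sg A b = sg A b * a.
Proof. by case: b; rewrite ?sgT ?sgF ?mulN1r ?mulrN1 ?mul1r ?mulr1. Qed.
Lemma sgCA b (a c : A) : a * (sg A b * c) = sg A b * (a * c).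
Proof. by rewrite mulrA sgC mulrA. Qed.
Lemma sgN b : sg A (~~ b) = - sg A b.
Proof. by case: b; rewrite /= ?sgT ?sgF ?opprK. Qed.
Lemma sgnat n : (-1) ^+ n = sg A (odd n). Proof. by rewrite /sg signr_odd. Qed.
Lemma sgsg b c (a : A) : sg A b * (sg A c * a) = sg A (b (+) c) * a.
Proof. by rewrite sgD mulrA. Qed.
Lemma sgMl b (a c : A) : (sg A b * a) * c = sg A b * (a * c).
Proof. by rewrite mulrA. Qed.
Lemma sgMM b b' (a c : A) : (sg A b * a) * (sg A b' * c) = sg A (b (+) b') * (a * c).
Proof. by rewrite sgMl sgCA sgsg. Qed.
End Signs.
Lemma sgm (A B : nzRingType) (e : {rmorphism A -> B}) b : e (sg A b) = sg B b.
Proof. by case: b; rewrite ?sgT ?sgF ?rmorphN1 ?rmorph1. Qed.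

Lemma ser_sg (A : nzRingType) b (f : ser A) m : (sg _ b * f) m = sg A b * f m.
Proof. by case: b; rewrite ?sgT ?sgF ?mulN1r ?mul1r. Qed.

Definition sgn3 N (i k l : idx N) : bool :=
  (bar i && bar k) (+) (bar i && bar l) (+) (bar k && bar l).
Definition par N (i j : idx N) : bool := bar i (+) bar j.

Section RTT.
Variables (N : nat) (B : nzRingType) (x y : B).
Implicit Types t s : idx N -> idx N -> B.

(** The quadratic relation multiplied by u^-2 v^-2, with x = u^-1 and y = v^-1, so that no positive
    powers remain: u^2 - v^2 becomes y^2 - x^2, and u + v and u - v become x y^2 + x^2 y and x y^2 -
    x^2 y. The variables act one at a time so that coefficients can be read off by rewriting. *)
Definition rttexp t s (i j k l : idx N) : B :=
  let C := sg B (sgn3 i k l)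
    * (t i j * s k l - sg B (par i j && par k l) * (s k l * t i j)) in
  let P := t k j * s i l - s k j * t i l in
  let Q := sg B (par k l)
    * (t (negi k) j * s (negi i) l - s k (negi j) * t i (negi l)) in
  (y * (y * C) - x * (x * C))
  - ((x * (y * (y * P)) + x * (x * (y * P)))
     - (x * (y * (y * Q)) - x * (x * (y * Q)))).

Definition rtt t s : Prop := forall i j k l, rttexp t s i j k l = 0.
End RTT.

Section Coefficients.
Variable A : nzRingType.

Definition serz (f : ser A) (m : int) : A := if (m <= 0)%R then f `|m|%N else 0.
Definition coefz (F : ser (ser A)) (m n : int) : A :=
  if (m <= 0)%R && (n <= 0)%R then F `|m|%N `|n|%N else 0.

Lemma coefzB F G m n : coefz (F - G) m n = coefz F m n - coefz G m n.
Proof. by rewrite /coefz; case: ifP => _; rewrite ?subr0 // !serB. Qed.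
Lemma coefzD F G m n : coefz (F + G) m n = coefz F m n + coefz G m n.
Proof. by rewrite /coefz; case: ifP => _; rewrite ?addr0 // !serD. Qed.
Lemma coefz_sg F b m n : coefz (sg _ b * F) m n = sg A b * coefz F m n.
Proof.
case: b; rewrite ?sgT ?sgF ?mulN1r ?mul1r //.
by rewrite /coefz; case: ifP => _; rewrite ?oppr0 // !serN.
Qed.
Lemma coefz_varx F m n : coefz (varx A * F) m n = coefz F (m + 1) n.
Proof.
rewrite /coefz coef_varx; case: (ltgtP m 0) => m0 //=.
- have -> : (m + 1 <= 0)%R by lia.
  by have -> : absz m = (absz (m + 1)).+1 by lia.
- by have -> : (m + 1 <= 0)%R = false by lia.
- by rewrite m0 /=; case: ifP.
Qed.
Lemma coefz_vary F m n : coefz (vary A * F) m n = coefz F m (n + 1).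
Proof.
rewrite /coefz coef_vary; case: (ltgtP n 0) => m0 //=; rewrite ?andbF ?andbT //.
- have -> : (n + 1 <= 0)%R by lia.
  by rewrite andbT; have -> : absz n = (absz (n + 1)).+1 by lia.
- have -> : (n + 1 <= 0)%R = false by lia.
  by rewrite andbF.
- by rewrite m0 /= andbF; case: ifP.
Qed.
Lemma coefz_uv f g m n : coefz (seru f * serv g) m n = serz f m * serz g n.
Proof.
rewrite /coefz /serz coef_uv.
by case: (m <= 0)%R; case: (n <= 0)%R; rewrite /= ?mul0r ?mulr0.
Qed.
Lemma coefz_vu f g m n : coefz (serv g * seru f) m n = serz g n * serz f m.
Proof.
rewrite /coefz /serz coef_vu.
by case: (m <= 0)%R; case: (n <= 0)%R; rewrite /= ?mul0r ?mulr0.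
Qed.
Lemma coefz_eq0 F : F = 0 <-> forall m n, coefz F m n = 0.
Proof.
split=> [-> m n|h]; first by rewrite /coefz; case: ifP.
apply/funext => m; apply/funext => n; have := h (- m%:Z) (- n%:Z).
by rewrite /coefz !oppr_le0 !lez_nat !leq0n /= !abszN.
Qed.
End Coefficients.

Section QuadraticExpression.
Variables (N : nat) (A : nzRingType).
Variable f : idx N -> idx N -> int -> A.

Definition quadrel (i j k l : idx N) (m n : int) : A :=
  let C m n := sg A (sgn3 i k l)
    * (f i j m * f k l n - sg A (par i j && par k l) * (f k l n * f i j m)) in
  let P m n := f k j m * f i l n - f k j n * f i l m in
  let Q m n := sg A (par k l)
    * (f (negi k) j m * f (negi i) l n - f k (negi j) n * f i (negi l) m) in
  (C (m - 1 - 1) n - C m (n - 1 - 1))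
  - ((P (m - 1) n + P m (n - 1)) - (Q (m - 1) n - Q m (n - 1))).
End QuadraticExpression.

Lemma quadrelm N (A B : nzRingType) (e : {rmorphism A -> B}) f
    (i j k l : idx N) m n :
  e (quadrel f i j k l m n) = quadrel (fun i j m => e (f i j m)) i j k l m n.
Proof. by rewrite /quadrel !(rmorphB, rmorphD, rmorphM) !sgm. Qed.

(** The shift by 2 in both exponents undoes the factor u^-2 v^-2 of [rttexp]. *)
Lemma quadrel_rttexp N (A : nzRingType) (t : idx N -> idx N -> ser A) i j k l m n :
  quadrel (fun i j => serz (t i j)) i j k l m n =
    coefz (rttexp (varx A) (vary A) (fun i j => seru (t i j))
             (fun i j => serv (t i j)) i j k l) (m - 2) (n - 2).
Proof.
rewrite /rttexp.
rewrite !(coefzB, coefzD, coefz_varx, coefz_vary, coefz_sg, coefz_uv, coefz_vu).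
have h1 (c : int) : c - 2 + 1 = c - 1 by lia.
have h2 (c : int) : c - 1 + 1 = c by lia.
have h3 (c : int) : c - 2 = c - 1 - 1 by lia.
by rewrite !h1 !h2 !h3.
Qed.

Lemma quadrel_eq0 N (A : nzRingType) (t : idx N -> idx N -> ser A) :
  (forall i j k l m n, quadrel (fun i j => serz (t i j)) i j k l m n = 0) <->
  rtt (varx A) (vary A) (fun i j => seru (t i j)) (fun i j => serv (t i j)).
Proof.
split=> h i j k l; last by move=> m n; rewrite quadrel_rttexp h /coefz; case: ifP.
apply/coefz_eq0 => m n; have := h i j k l (m + 2) (n + 2).
by rewrite quadrel_rttexp !addrK.
Qed.

Section RelatorImage.
Variables (K : fieldType) (N : nat).

Lemma yangian_relatorE i j k l m n :
  yangian_relator K i j k l m n = quadrel (@fTc K N) i j k l m n :> freealg K N.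
Proof.
rewrite /yangian_relator /mulu /mulv /quadrel.
rewrite (supercomm_homog (homog_fTc K i j (m - 1 - 1)) (homog_fTc K k l n)).
rewrite (supercomm_homog (homog_fTc K i j m) (homog_fTc K k l (n - 1 - 1))).
have -> : (-1) ^+ (bar i * bar k + bar i * bar l + bar k * bar l)
          = sg (freealg K N) (sgn3 i k l).
  by rewrite sgnat /sgn3 !oddD !oddM !oddb.
have -> : (-1) ^+ (bar k + bar l) = sg (freealg K N) (par k l).
  by rewrite sgnat /par oddD !oddb.
by rewrite mulnb.
Qed.

Variables (A : nzRingType) (e : {rmorphism freealg K N -> A}).

Definition imT (i j : idx N) : ser A := fun s => e (fT K i j s).

Lemma morph_fTc i j m : e (fTc K i j m) = serz (imT i j) m.
Proof. by rewrite /fTc /serz; case: ifP; rewrite ?rmorph0. Qed.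

Lemma morph_relators :
  (forall i j k l m n, e (yangian_relator K i j k l m n) = 0) <->
  rtt (varx A) (vary A) (fun i j => seru (imT i j)) (fun i j => serv (imT i j)).
Proof.
have E i j k l m n : e (yangian_relator K i j k l m n) =
    quadrel (fun i j => serz (imT i j)) i j k l m n.
  rewrite yangian_relatorE quadrelm; congr (quadrel _ i j k l m n).
  by apply/funext => a; apply/funext => b; apply/funext => c; exact: morph_fTc.
rewrite -quadrel_eq0; split=> h i j k l m n; first by rewrite -E.
by rewrite E.
Qed.
End RelatorImage.

(** * Products of solutions of the quadratic relation *)

Section RowColumn.
Variables (N : nat) (B : nzRingType) (d p q : B).
Implicit Types M : idx N -> idx N -> idx N -> idx N -> B.

(** [rowop] and [colop] are the two sides of R T_1(u) T_2(v) = T_2(v) T_1(u) R in coordinates: R on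
    the left permutes and negates the row indices i, k, and R on the right does the same to the
    column indices j, l. *)
Definition rowop M i j k l : B :=
  d * (sg B (sgn3 i k l) * M i j k l) - p * M k j i l
  + q * (sg B (par k l) * M (negi k) j (negi i) l).

Definition colop M i j k l : B :=
  d * (sg B (sgn3 i k l) * (sg B (par i j && par k l) * M i j k l))
  - p * M i l k j + q * (sg B (par k l) * M i (negi l) k (negi j)).

Definition tens (t s : idx N -> idx N -> B) i j k l : B := t i j * s k l.
Definition tensr (t s : idx N -> idx N -> B) i j k l : B := s k l * t i j.

Definition cop (t1 t2 : idx N -> idx N -> B) i j : B :=
  \sum_(a : idx N) sg B (par i a && par a j) * (t1 i a * t2 a j).

Definition supercommuting (t s : idx N -> idx N -> B) : Prop :=
  forall i j k l, t i j * s k l = sg B (par i j && par k l) * (s k l * t i j).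

Lemma tens_cop t1 t2 s1 s2 i j k l : supercommuting t2 s1 ->
  tens (cop t1 t2) (cop s1 s2) i j k l =
  \sum_(a : idx N) \sum_(b : idx N)
    sg B ((par i a && par a j) (+) (par k b && par b l)
          (+) (par a j && par k b))
    * (tens t1 s1 i a k b * tens t2 s2 a j b l).
Proof.
move=> h; rewrite /tens /cop mulr_suml.
apply: eq_bigr => a _; rewrite mulr_sumr; apply: eq_bigr => b _.
rewrite sgMM -(mulrA (t1 i a)) (mulrA (t2 a j)) h sgMl sgCA sgsg.
by rewrite -!mulrA.
Qed.

Lemma tensr_cop t1 t2 s1 s2 i j k l : supercommuting s2 t1 ->
  tensr (cop t1 t2) (cop s1 s2) i j k l =
  \sum_(a : idx N) \sum_(b : idx N)
    sg B ((par i a && par a j) (+) (par k b && par b l)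
          (+) (par b l && par i a))
    * (tensr t1 s1 i a k b * tensr t2 s2 a j b l).
Proof.
move=> h; rewrite /tensr /cop mulr_sumr.
apply: eq_bigr => a _; rewrite mulr_suml; apply: eq_bigr => b _.
rewrite sgMM -(mulrA (s1 k b)) (mulrA (s2 b l)) h sgMl sgCA sgsg.
by rewrite -!mulrA (addbC (par k b && _)).
Qed.

Hypotheses (dC : forall a, a * d = d * a) (pC : forall a, a * p = p * a)
  (qC : forall a, a * q = q * a).

Lemma cCA c : (forall a : B, a * c = c * a) -> forall a b, a * (c * b) = c * (a * b).
Proof. by move=> h a b; rewrite mulrA h mulrA. Qed.

(** The usual argument for products: since entries of different factors supercommute, R can be
    carried through the first factor and then through the second. All the work lies in the signs,
    which are compared by running over the parities of the indices. *)
Lemma cop_rowcol t1 t2 s1 s2 :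
  supercommuting t2 s1 -> supercommuting s2 t1 ->
  (forall i j k l, rowop (tens t1 s1) i j k l = colop (tensr t1 s1) i j k l) ->
  (forall i j k l, rowop (tens t2 s2) i j k l = colop (tensr t2 s2) i j k l) ->
  forall i j k l, rowop (tens (cop t1 t2) (cop s1 s2)) i j k l
                  = colop (tensr (cop t1 t2) (cop s1 s2)) i j k l.
Proof.
move=> h21 h12 r1 r2 i j k l.
pose S0 a b := ((par k a && par a j) (+)
  (par i b && par b l) (+) (par a j && par i b)).
have signs : forall a b : idx N,
   [/\ sgn3 i k l (+) (par i a && par a j (+) par k b && par b l (+) par a j && par k b) = S0 a b (+) sgn3 i k b
     & par k l (+) (par (negi k) a && par a j (+) par (negi i) b && par b l (+) par a j && par (negi i) b) = S0 a b (+) par k b].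
  move=> a b; rewrite /S0 /sgn3 /par /bar /=.
  by case: i.2; case: k.2; case: j.2; case: l.2; case: a.2; case: b.2.
transitivity (\sum_(a : idx N) \sum_(b : idx N) sg B (S0 a b) *
   (rowop (tens t1 s1) i a k b * tens t2 s2 a j b l)).
  rewrite /rowop !tens_cop // !mulr_sumr -sumrB -big_split /=.
  apply: eq_bigr => a _; rewrite !mulr_sumr -sumrB -big_split /=.
  apply: eq_bigr => b _; have [e1 e2] := signs a b.
  move: (tens t1 s1 i a k b) (tens t1 s1 k a i b)
    (tens t1 s1 (negi k) a (negi i) b) (tens t2 s2 a j b l) => A1 A2 A3 A4.
  rewrite !sgsg e1 e2 mulrDl mulrBl mulrDr mulrBr -!mulrA.
  rewrite !(mulrA (sg B (S0 a b)) d) !(mulrA (sg B (S0 a b)) p) !(mulrA (sg B (S0 a b)) q).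
  by rewrite dC pC qC -!mulrA !sgsg.
pose S1 a b := S0 b a.
have signs1 : forall a b : idx N,
   [/\ S0 a b (+) (sgn3 i k b (+) par i a && par k b) = S1 a b (+) sgn3 a b l
     & S0 (negi b) (negi a) (+) par k (negi a) = S1 a b (+) par b l].
  move=> a b; rewrite /S1 /S0 /sgn3 /par /bar /=.
  by case: i.2; case: k.2; case: j.2; case: l.2; case: a.2; case: b.2.
transitivity (\sum_(a : idx N) \sum_(b : idx N) sg B (S1 a b) *
   (tensr t1 s1 i a k b * rowop (tens t2 s2) a j b l)).
  (* Here R passes from the columns of the first factor to the rows of the second: the intermediate
     pair (a, b) is replaced by (b, a) in the second sum and by (-b, -a) in the third. *)
  pose A := tensr t1 s1; pose M := tens t2 s2.
  pose F1 a b := d * (sg B (S0 a b (+) (sgn3 i k b (+) par i a && par k b)) * (A i a k b * M a j b l)).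
  pose F2 a b := p * (sg B (S0 a b) * (A i b k a * M a j b l)).
  pose F3 a b := q * (sg B (S0 a b (+) par k b) * (A i (negi b) k (negi a) * M a j b l)).
  transitivity (\sum_a \sum_b (F1 a b - F2 b a + F3 (negi b) (negi a))).
    transitivity (\sum_a \sum_b F1 a b - \sum_a \sum_b F2 a b + \sum_a \sum_b F3 a b).
      rewrite -sumrB -big_split /=; apply: eq_bigr => a _.
      rewrite -sumrB -big_split /=; apply: eq_bigr => b _.
      rewrite r1 /colop -/A -/M /F1 /F2 /F3.
      move: (A i a k b) (A i b k a) (A i (negi b) k (negi a)) (M a j b l) => A1 A2 A3 A4.
      rewrite mulrDl mulrBl mulrDr mulrBr -!mulrA.
      rewrite !(mulrA (sg B (S0 a b)) d) !(mulrA (sg B (S0 a b)) p) !(mulrA (sg B (S0 a b)) q).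
      by rewrite dC pC qC -!mulrA !sgsg !addbA.
    have -> : \sum_a \sum_b F2 a b = \sum_a \sum_b F2 b a by exact: exchange_big.
    have -> : \sum_a \sum_b F3 a b = \sum_a \sum_b F3 (negi b) (negi a).
      rewrite exchange_big (reindex_inj (can_inj (@negiK N))); apply: eq_bigr => a _.
      exact: (reindex_inj (can_inj (@negiK N))).
    rewrite -sumrB -big_split /=; apply: eq_bigr => a _.
    by rewrite -sumrB -big_split /=.
  apply: eq_bigr => a _; apply: eq_bigr => b _; have [e1 e2] := signs1 a b.
  rewrite /rowop -/A -/M /F1 /F2 /F3 e1 e2 !negiK -/(S1 a b).
  move: (A i a k b) (M a j b l) (M b j a l) (M (negi b) j (negi a) l) => A1 A2 A3 A4.
  rewrite mulrDr mulrBr mulrDr mulrBr !(cCA dC) !(cCA pC) !(cCA qC).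
  by rewrite !(sgCA _ A1) !sgsg.
rewrite /colop !tensr_cop // !mulr_sumr -sumrB -big_split /=.
apply: eq_bigr => a _; rewrite !mulr_sumr -sumrB -big_split /=.
apply: eq_bigr => b _; rewrite r2 /colop.
have [e1 e2 e3] : [/\ S1 a b (+) (sgn3 a b l (+) par a j && par b l) =
   sgn3 i k l (+) (par i j && par k l (+) (par i a && par a j (+) par k b && par b l (+) par b l && par i a)),
   S1 a b = par i a && par a l (+) par k b && par b j (+) par b j && par i a &
   S1 a b (+) par b l = par k l (+) (par i a && par a (negi l) (+) par k b && par b (negi j) (+) par b (negi j) && par i a)].
  rewrite /S1 /S0 /sgn3 /par /bar /=.
  by case: i.2; case: k.2; case: j.2; case: l.2; case: a.2; case: b.2.
move: (tensr t1 s1 i a k b) (tensr t2 s2 a j b l) (tensr t2 s2 a l b j)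
  (tensr t2 s2 a (negi l) b (negi j)) => A1 A2 A3 A4.
rewrite mulrDr mulrBr mulrDr mulrBr !(cCA dC) !(cCA pC) !(cCA qC).
rewrite !(sgCA _ A1) !sgsg -e2; move: e1 e3; rewrite -!addbA => -> ->.
by [].
Qed.
End RowColumn.

Section RTTCoproduct.
Variables (N : nat) (B : nzRingType) (x y : B).
Hypotheses (xC : forall a, x * a = a * x) (yC : forall a, y * a = a * y).

Let d := y * y - x * x.
Let p := x * (y * y) + x * (x * y).
Let q := x * (y * y) - x * (x * y).

Lemma rttexp_rowcol (t s : idx N -> idx N -> B) i j k l :
  rttexp x y t s i j k l = rowop d p q (tens t s) i j k l - colop d p q (tensr t s) i j k l.
Proof.
have hd z : y * (y * z) - x * (x * z) = d * z by rewrite /d mulrBl -!mulrA.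
have hp z : x * (y * (y * z)) + x * (x * (y * z)) = p * z.
  by rewrite /p mulrDl -!mulrA.
have hq z : x * (y * (y * z)) - x * (x * (y * z)) = q * z.
  by rewrite /q mulrBl -!mulrA.
rewrite /rttexp hd hp hq /rowop /colop /tens /tensr !mulrBr.
by rewrite !(opprB, opprD) !addrA [LHS](ACl (1*6*3*5*2*4)).
Qed.

Lemma rtt_rowcol (t s : idx N -> idx N -> B) : rtt x y t s <->
  (forall i j k l, rowop d p q (tens t s) i j k l = colop d p q (tensr t s) i j k l).
Proof.
split=> h i j k l; first by apply: subr0_eq; rewrite -rttexp_rowcol h.
by rewrite rttexp_rowcol h subrr.
Qed.

Lemma centralM a b : (forall c : B, c * a = a * c) -> (forall c : B, c * b = b * c) ->
  forall c, c * (a * b) = a * b * c.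
Proof. by move=> ha hb c; rewrite mulrA ha -!mulrA hb. Qed.
Lemma centralD a b : (forall c : B, c * a = a * c) -> (forall c : B, c * b = b * c) ->
  forall c, c * (a + b) = (a + b) * c.
Proof. by move=> ha hb c; rewrite mulrDr mulrDl ha hb. Qed.
Lemma centralN a : (forall c : B, c * a = a * c) ->
  forall c, c * (- a) = - a * c.
Proof. by move=> ha c; rewrite mulrN mulNr ha. Qed.

Lemma rtt_cop t1 t2 s1 s2 : supercommuting t2 s1 -> supercommuting s2 t1 ->
  rtt x y t1 s1 -> rtt x y t2 s2 -> rtt x y (@cop N B t1 t2) (@cop N B s1 s2).
Proof.
move=> h1 h2 /rtt_rowcol r1 /rtt_rowcol r2; apply/rtt_rowcol.
by apply: cop_rowcol => //; do ?[apply: centralD|apply: centralN|apply: centralM] => // a.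
Qed.
End RTTCoproduct.

(** * Matrices *)

(** Ordinary matrices over a possibly noncommutative ring; the signs of the grading are carried by
    [cop] and [iota_mx]. The successor ensures 1 != 0. *)
Definition smx (n : nat) (A : Type) : Type := idx n.+1 -> idx n.+1 -> A.

Section MatrixRing.
Variables (n : nat) (A : nzRingType).
Local Notation idx := (idx n.+1).
Local Notation M := (smx n A).

HB.instance Definition _ := GRing.Zmodule.copy M (idx -> idx -> A).

Definition smxmul (a b : M) : M := fun p q => \sum_(r : idx) a p r * b r q.
Definition smxC (c : A) : M := fun p q => if p == q then c else 0.

Lemma smxP (a b : M) : (forall p q, a p q = b p q) -> a = b.
Proof. by move=> h; apply/funext => p; apply/funext => q. Qed.

Fact smxmulA : associative smxmul.
Proof.
move=> a b c; apply/smxP => p q; rewrite /smxmul.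
under eq_bigr do rewrite mulr_sumr.
rewrite exchange_big; apply: eq_bigr => r _ /=.
by rewrite mulr_suml; apply: eq_bigr => s _; rewrite mulrA.
Qed.

Lemma smxCmul c a p q : smxmul (smxC c) a p q = c * a p q.
Proof.
rewrite /smxmul (bigD1 p) //= /smxC eqxx big1 ?addr0 // => r /negPf h.
by rewrite eq_sym h mul0r.
Qed.
Lemma smxmulC a c p q : smxmul a (smxC c) p q = a p q * c.
Proof.
rewrite /smxmul (bigD1 q) //= /smxC eqxx big1 ?addr0 // => r /negPf h.
by rewrite h mulr0.
Qed.

Fact smxmul1 : left_id (smxC 1) smxmul.
Proof. by move=> a; apply/smxP => p q; rewrite smxCmul mul1r. Qed.
Fact smxmulr1 : right_id (smxC 1) smxmul.
Proof. by move=> a; apply/smxP => p q; rewrite smxmulC mulr1. Qed.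
Fact smxmulDl : left_distributive smxmul +%R.
Proof.
move=> a b c; apply/smxP => p q.
rewrite -[RHS]/(smxmul a c p q + smxmul b c p q) /smxmul -big_split /=.
by apply: eq_bigr => r _; rewrite mulrDl.
Qed.
Fact smxmulDr : right_distributive smxmul +%R.
Proof.
move=> a b c; apply/smxP => p q.
rewrite -[RHS]/(smxmul a b p q + smxmul a c p q) /smxmul -big_split /=.
by apply: eq_bigr => r _; rewrite mulrDr.
Qed.
Fact smxone_neq0 : smxC 1 != 0.
Proof.
apply/eqP => /(congr1 (fun f : M => f (ord0, false) (ord0, false))) /eqP.
by rewrite /smxC eqxx oner_eq0.
Qed.

HB.instance Definition _ := GRing.Zmodule_isNzRing.Build M
  smxmulA smxmul1 smxmulr1 smxmulDl smxmulDr smxone_neq0.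

Lemma smxM (a b : M) p q : (a * b) p q = \sum_(r : idx) a p r * b r q.
Proof. by []. Qed.
Lemma smxCM c (a : M) p q : (smxC c * a) p q = c * a p q. Proof. exact: smxCmul. Qed.
Lemma smxMC c (a : M) p q : (a * smxC c) p q = a p q * c. Proof. exact: smxmulC. Qed.
Lemma smx1 p q : (1 : M) p q = (p == q)%:R.
Proof. by rewrite -[1]/(smxC 1) /smxC; case: (p == q). Qed.
Lemma smx0 p q : (0 : M) p q = 0. Proof. by []. Qed.
Lemma smxD (a b : M) p q : (a + b) p q = a p q + b p q. Proof. by []. Qed.
Lemma smxN (a : M) p q : (- a) p q = - a p q. Proof. by []. Qed.
Lemma smxB (a b : M) p q : (a - b) p q = a p q - b p q. Proof. by []. Qed.
Lemma smx_sg b (a : M) p q : (sg M b * a) p q = sg A b * a p q.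
Proof. by case: b; rewrite ?sgT ?sgF ?mulN1r ?mul1r. Qed.
Lemma smx_sum I (r : seq I) (P : pred I) (F : I -> M) p q :
  (\sum_(i <- r | P i) F i) p q = \sum_(i <- r | P i) F i p q.
Proof. by elim/big_rec2: _ => // i x y _ <-. Qed.

Fact smxC_additive : additive smxC.
Proof.
move=> a b; apply/smxP => p q; rewrite smxB /smxC.
by case: eqP => // _; rewrite subr0.
Qed.
Fact smxC_multiplicative : multiplicative smxC.
Proof.
split=> // a b; apply/smxP => p q; rewrite smxCM /smxC.
by case: eqP => // _; rewrite mulr0.
Qed.
HB.instance Definition _ := GRing.isAdditive.Build A M smxC smxC_additive.
HB.instance Definition _ := GRing.isMultiplicative.Build A M smxC smxC_multiplicative.

Definition smxE (i j : idx) : M := fun p q => ((p == i) && (q == j))%:R.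

Lemma smxEE i j k l : smxE i j * smxE k l = smxC (j == k)%:R * smxE i l.
Proof.
apply/smxP => p q; rewrite smxCM smxM (bigD1 j) //= big1 ?addr0.
  rewrite /smxE eqxx andbT.
  by case: (p == i); case: (j == k); rewrite /= ?(mul0r, mul1r, mulr0).
by move=> r /negPf h; rewrite /smxE h andbF mul0r.
Qed.

End MatrixRing.

Definition smxmap n (A B : nzRingType) (e : A -> B) (a : smx n A) : smx n B :=
  fun p q => e (a p q).

Definition smxswap n (A : nzRingType) (a : smx n (ser A)) : ser (smx n A) :=
  fun m p q => a p q m.

Section MatrixMaps.
Variables (n : nat) (A B : nzRingType) (e : {rmorphism A -> B}).

Fact smxmap_additive : additive (@smxmap n A B e).
Proof. by move=> a b; apply/smxP => p q; rewrite /smxmap !smxB rmorphB. Qed.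
Fact smxmap_multiplicative : multiplicative (@smxmap n A B e).
Proof.
split=> [a b|]; apply/smxP => p q; rewrite /smxmap; last by rewrite !smx1 rmorph_nat.
by rewrite !smxM rmorph_sum; apply: eq_bigr => r _; rewrite rmorphM.
Qed.
HB.instance Definition _ :=
  GRing.isAdditive.Build (smx n A) (smx n B) (smxmap e) smxmap_additive.
HB.instance Definition _ :=
  GRing.isMultiplicative.Build (smx n A) (smx n B) (smxmap e) smxmap_multiplicative.

Fact smxswap_additive : additive (@smxswap n A).
Proof. by []. Qed.
Fact smxswap_multiplicative : multiplicative (@smxswap n A).
Proof.
split=> [a b|]; apply/funext => m; apply/smxP => p q.
  rewrite serM smx_sum /smxswap smxM ser_sum.
  under eq_bigr do rewrite serM.
  by rewrite exchange_big; apply: eq_bigr => k _.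
rewrite /smxswap smx1 ser1; case: m => [|m]; last by case: (p == q).
by rewrite -[RHS]/((1 : smx n A) p q) smx1; case: (p == q).
Qed.
HB.instance Definition _ :=
  GRing.isAdditive.Build (smx n (ser A)) (ser (smx n A)) (@smxswap n A) smxswap_additive.
HB.instance Definition _ :=
  GRing.isMultiplicative.Build (smx n (ser A)) (ser (smx n A)) (@smxswap n A)
    smxswap_multiplicative.
End MatrixMaps.

Lemma rtt_morph N (A B : nzRingType) (e : {rmorphism A -> B}) x y
    (t s : idx N -> idx N -> A) :
  rtt x y t s -> rtt (e x) (e y) (fun i j => e (t i j)) (fun i j => e (s i j)).
Proof.
move=> h i j k l; have := congr1 e (h i j k l).
by rewrite /rttexp !(rmorphB, rmorphD, rmorphM, rmorph0) !sgm.
Qed.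

(** * The base representation *)

Section BaseRepresentation.
Variables (n : nat) (S : comNzRingType).
Local Notation idx := (idx n.+1).
Local Notation E := (@smxE n S).
Local Notation C := (@smxC n S).

Lemma smx_central (c : S) (a : smx n S) : a * C c = C c * a.
Proof. by apply/smxP => r s; rewrite smxMC smxCM mulrC. Qed.

Lemma smxCMC (b b' : S) (U V : smx n S) p q :
  ((C b * U) * (C b' * V)) p q = b * b' * (U * V) p q.
Proof. by rewrite mulrA -[C b * U * _]mulrA smx_central !mulrA -!rmorphM -mulrA smxCM. Qed.

Lemma smx_affM (a b c a' b' c' : S) (U V U' V' : smx n S) p q :
  ((C a + C b * U + C c * V) * (C a' + C b' * U' + C c' * V')) p q =
  a * a' * (p == q)%:R + a * b' * U' p q + a * c' * V' p q
  + (b * a' * U p q + b * b' * (U * U') p q + b * c' * (U * V') p q)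
  + (c * a' * V p q + c * b' * (V * U') p q + c * c' * (V * V') p q).
Proof.
have E1 : C a = C a * 1 by rewrite mulr1.
have E2 : C a' = C a' * 1 by rewrite mulr1.
rewrite E1 E2 2!mulrDl 6!mulrDr !smxD !smxCMC !mulr1 !mul1r.
by rewrite smx1.
Qed.

(* T_ij(u) acts by delta_ij - (-1)^i (E_ji / (u - z) + E_(-j,-i) / (u + z)), with
   x = u^-1 and w the inverse of 1 - z^2 x^2. *)
Definition baseT (z x w : S) (i j : idx) : smx n S :=
  C (w * ((i == j)%:R * (1 - z * x * (z * x))))
  + C (w * - (sg S (bar i) * (x * (1 + z * x)))) * E j i
  + C (w * - (sg S (bar i) * (x * (1 - z * x)))) * E (negi j) (negi i).

(** Every term is bilinear in the two families, so w and w' factor out and may be arbitrary: the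
    denominators never matter. Once the parities of i, j, k, l are fixed, an identity of polynomials
    in x, y, z remains, with index comparisons and entries of matrix units as further atoms. *)
Lemma baseT_rtt z x w y w' :
  rtt (C x) (C y) (baseT z x w) (baseT z y w').
Proof.
move=> i j k l; rewrite /rttexp /baseT; apply/smxP => p q.
rewrite !(smxB, smxD, smxN, smxCM, smx_sg) !smx_affM !smxEE !smxCM smx0.
case: i => i bi; case: j => j bj; case: k => k bk; case: l => l bl.
rewrite /sgn3 /par /bar /negi /=.
have P (a b : 'I_n.+1) (c d : bool) : ((a, c) == (b, d) :> idx) = (a == b) && (c == d) by [].
rewrite !P; have F0 : (nat_of_bool false)%:R = 0 :> S by [].
(case: bi; case: bj; case: bk; case: bl;
  rewrite /= ?andbT ?andbF ?sgT ?sgF ?F0; ring).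
Qed.

End BaseRepresentation.

Lemma baseT_morph n (S S' : comNzRingType) (e : {rmorphism S -> S'}) z x w (i j : idx n.+1) :
  smxmap e (baseT z x w i j) = baseT (e z) (e x) (e w) i j.
Proof.
have eC c : smxmap e (@smxC n S c) = @smxC n S' (e c).
  by apply/smxP => p q; rewrite /smxmap /smxC; case: (p == q); rewrite ?rmorph0.
have eE a b : smxmap e (smxE S a b) = smxE S' a b :> smx n S'.
  by apply/smxP => p q; rewrite /smxmap rmorph_nat.
rewrite /baseT !(rmorphD, rmorphM) /= !eC !eE.
by rewrite !(rmorphD, rmorphM, rmorphN, rmorphB, rmorph1, rmorph_nat) !sgm.
Qed.

Lemma eq_rtt N (A : nzRingType) (x y : A) (t s t' s' : idx N -> idx N -> A) :
  (forall i j, t i j = t' i j) -> (forall i j, s i j = s' i j) ->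
  rtt x y t s -> rtt x y t' s'.
Proof. by move=> ht hs h i j k l; rewrite /rttexp -!ht -!hs; exact: h. Qed.

Lemma seru_serv_rtt (A B : nzRingType) N (e : {rmorphism A -> B})
    (t : idx N -> idx N -> ser A) :
  rtt (varx A) (vary A) (fun i j => seru (t i j)) (fun i j => serv (t i j)) ->
  rtt (varx B) (vary B) (fun i j => seru (sermap e (t i j)))
    (fun i j => serv (sermap e (t i j))).
Proof.
move/quadrel_eq0 => h; apply/quadrel_eq0 => i j k l m k'.
have := congr1 e (h i j k l m k'); rewrite quadrelm rmorph0 => <-.
congr (quadrel _ i j k l m k').
apply/funext => a; apply/funext => b; apply/funext => c.
by rewrite /serz; case: ifP; rewrite ?rmorph0.
Qed.

Section Base.
Variable n : nat.
Local Notation idx := (idx n.+1).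

(* 1/(1 - zx) and 1/(1 + zx), with x the outer and z the inner variable. *)
Definition geom : ser (ser int) := fun m r => (m == r)%:R.
Definition geomN : ser (ser int) := fun m r => sg int (odd r) * (m == r)%:R.
Local Notation x := (varx int).
Local Notation z := (vary int).

Lemma geomE : (1 - z * x) * geom = 1.
Proof.
rewrite mulrBl mul1r -mulrA; apply/funext => m; apply/funext => r.
rewrite !serB coef_vary; case: r => [|r]; first by rewrite subr0; case: m.
rewrite coef_varx; case: m => [|m]; first by rewrite subr0.
by rewrite /geom eqSS subrr.
Qed.

Lemma geomNE : (1 + z * x) * geomN = 1.
Proof.
rewrite mulrDl mul1r -mulrA; apply/funext => m; apply/funext => r.
rewrite !serD coef_vary; case: r => [|r].
  by rewrite addr0 /geomN /= sgF mul1r; case: m.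
rewrite coef_varx; case: m => [|m]; first by rewrite addr0 /geomN mulr0.
by rewrite /geomN eqSS /= sgN mulNr addNr.
Qed.

Definition baseZ i j : smx n (ser (ser int)) := baseT z x (geom * geomN) i j.

(** Partial fractions: over the common denominator 1 - z^2 x^2, the factors 1 + zx and 1 - zx of the
    numerators cancel against [geomN] and [geom]. *)
Lemma baseZE i j p q : baseZ i j p q =
  (i == j)%:R * (p == q)%:R
  - sg _ (bar i) * (x * geom * ((p == j) && (q == i))%:R
     + x * geomN * ((p == negi j) && (q == negi i))%:R).
Proof.
rewrite /baseZ /baseT !smxD !smxCM /smxE.
have -> : @smxC n _ (geom * geomN * ((i == j)%:R * (1 - z * x * (z * x)))) p q
  = (i == j)%:R * (p == q)%:R.
  have -> : geom * geomN * ((i == j)%:R * (1 - z * x * (z * x)))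
    = (i == j)%:R * (((1 - z * x) * geom) * ((1 + z * x) * geomN)) by ring.
  by rewrite geomE geomNE mulr1 mulr1 /smxC; case: (p == q); rewrite ?mulr1 ?mulr0.
have -> : geom * geomN * - (sg _ (bar i) * (x * (1 + z * x))) =
  - (sg _ (bar i) * (x * geom)) * ((1 + z * x) * geomN) by ring.
have -> : geom * geomN * - (sg _ (bar i) * (x * (1 - z * x))) =
  - (sg _ (bar i) * (x * geomN)) * ((1 - z * x) * geom) by ring.
rewrite geomE geomNE; ring.
Qed.

Variable R : nzRingType.

(** rho with coefficients in any ring, read at u^-m z^r. Expanding 1 / (u - z) and 1 / (u + z), the
    coefficient at u^-(m+1) involves z^m only, with the sign (-1)^m from the second fraction. *)
Definition baseR (i j : idx) : ser (ser (smx n R)) := fun m r =>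
  if m is m'.+1 then
    if r == m' then - (sg _ (bar i)
      * (smxE R j i + sg _ (odd r) * smxE R (negi j) (negi i))) else 0
  else ((r == 0%N) && (i == j))%:R.

Lemma baseR_baseZ i j m r p q : baseR i j m r p q = (baseZ i j p q m r)%:~R.
Proof.
have hb (f : ser (ser int)) (b : bool) : (f * b%:R) m r = f m r * b%:R.
  by case: b; rewrite ?mulr1 ?mulr0.
have hs (f : ser (ser int)) (b : bool) : (sg _ b * f) m r = sg int b * f m r.
  by case: b; rewrite ?sgT ?sgF ?mulN1r ?mul1r ?serN.
rewrite baseZE !serB hb hs !serD !hb !coef_varx.
have -> : ((i == j)%:R : ser (ser int)) m r = ((m == 0%N) && (r == 0%N) && (i == j))%:R.
  by case: (i == j); rewrite ?andbF // andbT; clear; case: m; case: r.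
rewrite /baseR; clear hb hs; case: m => [|m] /=.
  rewrite !mul0r addr0 mulr0 subr0 -natrM mulnb rmorph_nat.
  case: (r == 0%N); case: (i == j) => //=.
  by rewrite -[LHS]/((1 : smx n R) p q) smx1.
rewrite !mul0r sub0r rmorphN rmorphM sgm rmorphD /= !rmorphM /= sgm !rmorph_nat.
rewrite eq_sym; case: (m == r); last by rewrite mulr0 !mul0r addr0 mulr0 oppr0.
by rewrite mulr1 mul1r !smxN !smx_sg smxD smx_sg.
Qed.

(** [baseT_rtt] needs commuting scalars, while R will be the Yangian. Since rho has integer
    coefficients, the relation is proved over the integers and then mapped to R. *)
Lemma baseR_rtt : rtt (varx _) (vary _) (fun i j => seru (baseR i j))
  (fun i j => serv (baseR i j)).
Proof.
pose Az := ser int.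
pose T i j : ser (smx n Az) := smxswap (baseZ i j).
have h : rtt (varx _) (vary _) (fun i j => seru (T i j)) (fun i j => serv (T i j)).
  (* [om] turns matrices of series in u^-1, v^-1 into series of matrices; z stays inside the scalars
     [Az]. *)
  pose om : smx n (ser (ser Az)) -> _ := sermap (@smxswap n Az) \o @smxswap n (ser Az).
  have H : rtt (om (smxC (varx Az))) (om (smxC (vary Az)))
      (fun i j => om (baseT (serC (serC (serX int))) (varx Az) (seru (geom * geomN)) i j))
      (fun i j => om (baseT (serC (serC (serX int))) (vary Az) (serv (geom * geomN)) i j)).
    apply: rtt_morph; apply: baseT_rtt.
  have E1 i j : baseT (serC (serC (serX int))) (varx Az) (seru (geom * geomN)) i j
      = smxmap seru (baseZ i j).
    have z1 : seru (vary int) = serC (serC (serX int)) :> ser (ser Az).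
      by apply/funext => -[|m] //; exact: (rmorph0 (@serC Az)).
    have x1 : seru (varx int) = varx Az.
      apply/funext => m; rewrite /sermap /varx /serX /=.
      by case: (m == 1%N); rewrite ?rmorph1 ?rmorph0.
    by rewrite -z1 -x1 /baseZ (baseT_morph (sermap (@serC Az))).
  have E2 i j : baseT (serC (serC (serX int))) (vary Az) (serv (geom * geomN)) i j
      = smxmap serv (baseZ i j).
    by rewrite /baseZ (baseT_morph (@serC (ser Az))).
  have F1 : om (smxC (varx Az)) = varx _.
    apply/funext => m; apply/funext => k; apply/smxP => p q.
    rewrite varxE -[LHS]/(smxC (varx Az) p q m k) /smxC.
    case: (p =P q) => pq; last first.
      case: (_ && _) => //; rewrite -[RHS]/((1 : smx n Az) p q) smx1.
      by move/eqP/negPf: pq => ->.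
    rewrite pq varxE; case: (_ && _) => //.
    by rewrite -[RHS]/((1 : smx n Az) q q) smx1 eqxx.
  have F2 : om (smxC (vary Az)) = vary _.
    apply/funext => m; apply/funext => k; apply/smxP => p q.
    rewrite varyE -[LHS]/(smxC (vary Az) p q m k) /smxC.
    case: (p =P q) => pq; last first.
      case: (_ && _) => //; rewrite -[RHS]/((1 : smx n Az) p q) smx1.
      by move/eqP/negPf: pq => ->.
    rewrite pq varyE; case: (_ && _) => //.
    by rewrite -[RHS]/((1 : smx n Az) q q) smx1 eqxx.
  have G1 a : om (smxmap seru a) = seru (smxswap a).
    apply/funext => m; apply/funext => k; apply/smxP => p q.
    by rewrite /om /= /sermap /smxswap /smxmap /=; case: k.
  have G2 a : om (smxmap serv a) = serv (smxswap a).
    apply/funext => m; apply/funext => k; apply/smxP => p q.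
    by rewrite /om /= /sermap /smxswap /smxmap /=; case: m.
  rewrite F1 F2 in H; apply: eq_rtt H => i j; first by rewrite E1 G1.
  by rewrite E2 G2.
pose eta : smx n Az -> ser (smx n R) :=
  sermap (smxmap (intmul (1 : R))) \o @smxswap n int.
have E a b : sermap eta (T a b) = baseR a b.
  apply/funext => m; apply/funext => r; apply/smxP => p q.
  by rewrite baseR_baseZ.
by apply: eq_rtt (seru_serv_rtt eta h) => i j; rewrite E.
Qed.
End Base.

(** * Presentation of the Yangian *)

Lemma malgU_scale (R : nzRingType) (I : choiceType) (c : R) (v : I) :
  << c *g v >> = c *: << v >> :> {malg R[I]}.
Proof. by apply/malgP => w; rewrite mcoeffZ !mcoeffU mulrnAr mulr1. Qed.

(** * Parity on the quotient algebra *)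

Section YangianParity.
Variables (K : fieldType) (N : nat).
Local Notation Y := (yangian K N).
Local Notation F := (freealg K N).

Definition ypi (f : F) : Y := (\pi_(yangian K N) f)%qT.

Fact ypi_additive : additive ypi. Proof. exact: (raddfB (\pi_(yangian K N))%qT). Qed.
Fact ypi_multiplicative : multiplicative ypi.
Proof. split; first exact: pi_mul. exact: erefl. Qed.
HB.instance Definition _ := GRing.isAdditive.Build F Y ypi ypi_additive.
HB.instance Definition _ := GRing.isMultiplicative.Build F Y ypi ypi_multiplicative.

Lemma ypi_surj (y : Y) : exists f, y = ypi f. Proof. exact: pi_surj. Qed.
Lemma ypi_scale c f : ypi (c *: f) = c *: ypi f. Proof. exact: pi_scale. Qed.
Lemma ypi_part d f : ypi (fpart d f) = ypart d (ypi f). Proof. exact: pi_part. Qed.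
Lemma ypi_eq0 f : f \in @yideal K N -> ypi f = 0.
Proof. by move=> h; rewrite -(rmorph0 ypi); apply/eq_pi; rewrite subr0. Qed.
Lemma ypi_relator f : relator f -> ypi f = 0.
Proof. by move=> h; apply/ypi_eq0/yidealP/IdealIn. Qed.
Lemma ypi_fT i j s : ypi (fT K i j s) = yT K i j s. Proof. by []. Qed.

Fact ypart_additive d : additive (@ypart K N d).
Proof.
move=> x y; have [[f ->] [g ->]] := (ypi_surj x, ypi_surj y).
by rewrite -rmorphB -!ypi_part !raddfB.
Qed.
HB.instance Definition _ d := GRing.isAdditive.Build Y Y (ypart d) (ypart_additive d).

Lemma ypartM d (x y : Y) :
  ypart d (x * y) = \sum_(a : bool) ypart a x * ypart (a (+) d) y.
Proof.
have [[f ->] [g ->]] := (ypi_surj x, ypi_surj y).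
rewrite -rmorphM -ypi_part fpartM rmorph_sum; apply: eq_bigr => a _.
by rewrite rmorphM -!ypi_part.
Qed.

Lemma ypart1 d : ypart d (1 : Y) = (~~ d)%:R.
Proof.
have h : homog false (1 : F).
  by rewrite /homog -[1]/(<< mone >>) fpartU /wdeg fm1 big_nil eqxx mulr1n.
rewrite -(rmorph1 ypi) -ypi_part (homog_part _ h) eqbF_neg.
by case: d; rewrite ?mulr0n ?mulr1n ?rmorph0 ?rmorph1.
Qed.

Lemma ypartZ d c (x : Y) : ypart d (c *: x) = c *: ypart d x.
Proof.
have [f ->] := ypi_surj x.
rewrite -ypi_scale -!ypi_part -ypi_scale; congr (ypi _); exact: (linearZZ (fpart d)).
Qed.

Lemma ypart_ypart d e (x : Y) : ypart d (ypart e x) = ypart d x *+ (d == e).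
Proof.
have [f ->] := ypi_surj x.
by rewrite -!ypi_part fpart_fpart rmorphMn.
Qed.
End YangianParity.

(** * Homomorphisms out of the Yangian *)

Section UniversalProperty.
Variables (K : fieldType) (N : nat) (A : nzRingType).
Variables (k : {rmorphism K -> A}) (t : idx N -> idx N -> ser A).
Local Notation F := (freealg K N).
Local Notation Y := (yangian K N).
Hypothesis kC : forall c a, k c * a = a * k c.
Hypothesis t0 : forall i j, t i j 0%N = (i == j)%:R.
Hypothesis tN : forall i j s, sg A (odd s) * t i j s = t (negi i) (negi j) s.
Hypothesis trtt : rtt (varx A) (vary A) (fun i j => seru (t i j)) (fun i j => serv (t i j)).

Definition evalword (w : word N) : A := \prod_(g <- (w : seq (letter N))) t g.1.1 g.1.2 g.2.+1.

Fact evalword_mmorphism : mmorphism evalword.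
Proof. by split=> [v w|]; rewrite /evalword ?fm1 ?big_nil // fmM big_cat. Qed.
HB.instance Definition _ := isMultiplicative.Build (word N) A evalword evalword_mmorphism.

Definition evalfree (f : F) : A := mmap k evalword f.

Fact evalfree_additive : additive evalfree. Proof. exact: mmap_is_additive. Qed.
Fact evalfree_multiplicative : multiplicative evalfree.
Proof. by apply: commr_mmap_is_multiplicative => f v w; apply: kC. Qed.
HB.instance Definition _ := GRing.isAdditive.Build F A evalfree evalfree_additive.
HB.instance Definition _ := GRing.isMultiplicative.Build F A evalfree evalfree_multiplicative.

Lemma evalfree_fT i j s : evalfree (fT K i j s) = t i j s.
Proof.
case: s => [|s]; first by rewrite /= rmorph_nat t0.
rewrite /evalfree mmapU.
transitivity (1 * evalword (fmu ((i, j, s) : letter N))).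
  congr (_ * _); exact: (rmorph1 k).
by rewrite mul1r /evalword fmU big_seq1.
Qed.

Lemma evalfree_relator f : relator f -> evalfree f = 0.
Proof.
have E : imT evalfree = t.
  apply/funext => i; apply/funext => j; apply/funext => s; exact: evalfree_fT.
case=> [i j l m p q|i j s]; last first.
  by rewrite /symmetry_relator rmorphB rmorphM rmorph_sign /= !evalfree_fT sgnat tN subrr.
by move: i j l m p q; apply/morph_relators; rewrite E.
Qed.

Lemma evalfree_ideal f : f \in @yideal K N -> evalfree f = 0.
Proof.
move/yidealP; elim=> [g /evalfree_relator //||g h _ eg _ eh|a g _ eg|a g _ eg].
- exact: rmorph0.
- by rewrite rmorphB /= eg eh subrr.
- by rewrite rmorphM /= eg mulr0.
- by rewrite rmorphM /= eg mul0r.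
Qed.

(** Scalars enter through a central morphism k because the target is only a ring; for the coaction
    it consists of series of matrices over the Yangian. *)
Lemma yangian_universal : exists e : {rmorphism Y -> A},
  (forall i j s, e (yT K i j s) = t i j s) /\ (forall c x, e (c *: x) = k c * e x).
Proof.
pose e (y : Y) : A := evalfree (repr y).
have eP f : e (ypi f) = evalfree f.
  apply/subr0_eq; rewrite /e -rmorphB; apply: evalfree_ideal.
  by rewrite -opprB rpredN; exact: pi_repr.
have ea : additive e.
  move=> x y; have [[f ->] [g ->]] := (ypi_surj x, ypi_surj y).
  by rewrite -rmorphB !eP rmorphB.
have em : multiplicative e.
  split=> [x y|]; last by rewrite -(rmorph1 (@ypi K N)) eP rmorph1.
  have [[f ->] [g ->]] := (ypi_surj x, ypi_surj y).
  by rewrite -rmorphM !eP rmorphM.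
pose ia := GRing.isAdditive.Build Y A e ea.
pose im := GRing.isMultiplicative.Build Y A e em.
pose er : {rmorphism Y -> A} := HB.pack e ia im.
exists er; split=> [i j s|c x] /=; first by rewrite -ypi_fT eP evalfree_fT.
have [f ->] := ypi_surj x; rewrite -ypi_scale !eP -mul_malgC rmorphM /=.
congr (_ * _); exact: mmapC.
Qed.
End UniversalProperty.

(* An interface hiding the quotient construction; by [yg_universal] it determines the
   Yangian Y(q_(n+1)) up to isomorphism. *)
Record yalg (K : fieldType) (n : nat) := YAlg {
  ycar :> algType K;
  ypr : bool -> ycar -> ycar;
  yg : idx n.+1 -> idx n.+1 -> ser ycar;
  ypr_additive : forall d, additive (ypr d);
  yprZ : forall d c x, ypr d (c *: x) = c *: ypr d x;
  yprM : forall d x y, ypr d (x * y) = \sum_(a : bool) ypr a x * ypr (a (+) d) y;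
  ypr1 : forall d, ypr d 1 = (~~ d)%:R;
  yprK : forall d e x, ypr d (ypr e x) = ypr d x *+ (d == e);
  ypr_sum : forall x, x = ypr false x + ypr true x;
  ypr_yg : forall i j s, ypr (par i j) (yg i j s) = yg i j s;
  yg0 : forall i j, yg i j 0%N = (i == j)%:R;
  ygN : forall i j s, sg _ (odd s) * yg i j s = yg (negi i) (negi j) s;
  yg_rtt : rtt (varx ycar) (vary ycar) (fun i j => seru (yg i j)) (fun i j => serv (yg i j));
  yg_span : forall P : ycar -> Prop, P 0 ->
    (forall (c : K) (w : seq (letter n.+1)) x, P x ->
       P (c *: \prod_(g <- w) yg g.1.1 g.1.2 g.2.+1 + x)) ->
    forall x, P x;
  yg_universal : forall (A : nzRingType) (k : {rmorphism K -> A})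
      (t : idx n.+1 -> idx n.+1 -> ser A),
    (forall c a, k c * a = a * k c) ->
    (forall i j, t i j 0%N = (i == j)%:R) ->
    (forall i j s, sg A (odd s) * t i j s = t (negi i) (negi j) s) ->
    rtt (varx A) (vary A) (fun i j => seru (t i j)) (fun i j => serv (t i j)) ->
    exists e : {rmorphism ycar -> A},
      (forall i j s, e (yg i j s) = t i j s) /\ (forall c x, e (c *: x) = k c * e x)
}.

Section YangianInterface.
Variables (K : fieldType) (n : nat).
Local Notation Y := (yangian K n.+1).

Lemma yT0 i j : yT K i j 0 = (i == j)%:R :> Y.
Proof. by rewrite -ypi_fT /= rmorph_nat. Qed.

Lemma yTN i j s : sg Y (odd s) * yT K i j s = yT K (negi i) (negi j) s.
Proof.
apply/subr0_eq; rewrite -!ypi_fT -sgnat -(rmorph_sign (@ypi K n.+1)).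
by rewrite -rmorphM -rmorphB; exact: (ypi_relator (RelSymmetry K i j s)).
Qed.

Lemma yT_rtt : rtt (varx Y) (vary Y) (fun i j => seru (yT K i j : ser Y))
  (fun i j => serv (yT K i j : ser Y)).
Proof.
have /morph_relators : forall i j k l m p, ypi (yangian_relator K i j k l m p) = 0 :> Y.
  by move=> i j k l m p; apply: ypi_relator; constructor.
by [].
Qed.

Lemma ypi_word (w : seq (letter n.+1)) :
  ypi << FMonom w >> = \prod_(g <- w) yT K g.1.1 g.1.2 g.2.+1 :> Y.
Proof.
elim: w => [|[[i j] s] w IH]; first by rewrite big_nil -fmoneE; exact: (rmorph1 (@ypi K n.+1)).
rewrite big_cons -IH -[yT _ _ _ _]/(ypi << fmu ((i, j, s) : letter n.+1) >>) -rmorphM.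
congr (ypi _); rewrite malgM_def fgmulUU mulr1; congr (<< _ >>).
by rewrite -[RHS]/(fmmul _ _) fmmulE fmuE.
Qed.

Lemma yT_span (P : Y -> Prop) : P 0 ->
    (forall (c : K) (w : seq (letter n.+1)) x, P x ->
       P (c *: \prod_(g <- w) yT K g.1.1 g.1.2 g.2.+1 + x)) ->
    forall x, P x.
Proof.
move=> P0 PD x; have [f ->] := ypi_surj x; rewrite [f]monalgE rmorph_sum.
elim: (enum_fset (msupp f)) => [|w s IH]; first by rewrite big_nil.
rewrite big_cons /=; suff -> : ypi << f@_w *g w >>
  = f@_w *: \prod_(g <- (w : seq (letter n.+1))) yT K g.1.1 g.1.2 g.2.+1 by exact: PD.
rewrite -ypi_word fmK -ypi_scale; congr (ypi _); exact: malgU_scale.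
Qed.

(** Kept transparent, so that statements about the interface apply to the Yangian itself by
    conversion. *)
Definition yangian_yalg : yalg K n.
Proof.
refine (@YAlg K n Y (@ypart K n.+1) (@yT K n.+1) (@ypart_additive K n.+1)
  (@ypartZ K n.+1) (@ypartM K n.+1) (@ypart1 K n.+1) (@ypart_ypart K n.+1)
  (@ypart_sum K n.+1) (@ypart_fT K n.+1) yT0 yTN yT_rtt yT_span _).
move=> A k t kC t0 tN trtt; exact: (yangian_universal kC t0 tN trtt).
Defined.
End YangianInterface.

(** * The coaction *)

Section Coaction.
Variables (K : fieldType) (n : nat) (D : yalg K n).
Local Notation Y := (ycar D).
Local Notation idx := (idx n.+1).
Local Notation T := (@yg K n D).
Local Notation M := (smx n Y).
Local Notation C := (ser M).

HB.instance Definition _ d := GRing.isAdditive.Build Y Y (@ypr K n D d) (@ypr_additive K n D d).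

Definition yhomog d (x : Y) : Prop := ypr d x = x.

Lemma yhomog_part d e (x : Y) : yhomog e x -> ypr d x = x *+ (d == e).
Proof. by move=> <-; rewrite yprK; case: (d =P e) => [->|]; rewrite // !mulr0n. Qed.
Lemma yhomogM d e (x y : Y) : yhomog d x -> yhomog e y -> yhomog (d (+) e) (x * y).
Proof.
move=> hx hy; rewrite /yhomog yprM big_bool /=.
rewrite !(yhomog_part _ hx) !(yhomog_part _ hy).
by case: d {hx}; case: e {hy};
  rewrite /= !(mulr0n, mulr1n, mulr0, mul0r, addr0, add0r).
Qed.
Lemma yhomogD d (x y : Y) : yhomog d x -> yhomog d y -> yhomog d (x + y).
Proof. by rewrite /yhomog raddfD /= => -> ->. Qed.
Lemma yhomogN d (x : Y) : yhomog d x -> yhomog d (- x).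
Proof. by rewrite /yhomog raddfN /= => ->. Qed.
Lemma yhomog0 d : yhomog d 0. Proof. exact: raddf0. Qed.
Lemma yhomog1 : yhomog false 1. Proof. exact: ypr1. Qed.
Lemma yhomog_sg d b (x : Y) : yhomog d x -> yhomog d (sg Y b * x).
Proof.
by move=> hx; case: b; rewrite ?sgT ?sgF ?mulN1r ?mul1r //; exact: yhomogN.
Qed.
Lemma yhomog_sum d I (r : seq I) (P : pred I) (f : I -> Y) :
  (forall i, P i -> yhomog d (f i)) -> yhomog d (\sum_(i <- r | P i) f i).
Proof. by move=> h; elim/big_ind: _ => //; [exact: yhomog0|exact: yhomogD]. Qed.
Lemma yhomogT i j s : yhomog (par i j) (T i j s). Proof. exact: ypr_yg. Qed.

(* The identity for b = false, the parity automorphism for b = true. *)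
Definition theta (b : bool) (x : Y) : Y := ypr false x + sg Y b * ypr true x.

Fact theta_additive b : additive (theta b).
Proof. by move=> x y; rewrite /theta !raddfB mulrBr addrACA opprD. Qed.
Fact theta_multiplicative b : multiplicative (theta b).
Proof.
split=> [x y|]; last by rewrite /theta !ypr1 mulr0 addr0.
rewrite /theta !yprM !big_bool /= !mulrDl !mulrDr !sgMl !sgCA sgsg addbb sgF mul1r.
by rewrite !addrA [LHS](ACl (2*4*3*1)).
Qed.
HB.instance Definition _ b := GRing.isAdditive.Build Y Y (theta b) (theta_additive b).
HB.instance Definition _ b := GRing.isMultiplicative.Build Y Y (theta b) (theta_multiplicative b).

Lemma theta_homog b d x : yhomog d x -> theta b x = sg Y (b && d) * x.
Proof.
move=> hx; rewrite /theta !(yhomog_part _ hx); case: d {hx} => /=.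
  by rewrite mulr0n mulr1n add0r andbT.
by rewrite mulr0n mulr1n mulr0 addr0 andbF sgF mul1r.
Qed.
Lemma thetaZ b c x : theta b (c *: x) = c *: theta b x.
Proof. by rewrite /theta !yprZ scalerDr scalerAr. Qed.
Lemma thetaF x : theta false x = x.
Proof. by rewrite /theta sgF mul1r -ypr_sum. Qed.
Lemma thetaK b x : theta b (theta b x) = x.
Proof.
rewrite {1}/theta [theta b x]/theta !raddfD /= -!/(ypr _ _).
have hs d (y : Y) : ypr d (sg Y b * y) = sg Y b * ypr d y.
  by case: b; rewrite ?sgT ?sgF ?mulN1r ?mul1r ?raddfN.
rewrite !hs !yprK /= !(mulr0n, mulr1n) mulr0 addr0 add0r sgsg addbb sgF mul1r.
by rewrite -ypr_sum.
Qed.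

(** This is x (x) 1 in an ungraded model of the graded tensor product: the sign from moving x past a
    matrix unit of parity p + q becomes the difference between the twists at the diagonal positions
    p and q. *)
Definition iota_mx (x : Y) : M := fun p q => if p == q then theta (bar p) x else 0.

Fact iota_additive : additive iota_mx.
Proof.
move=> x y; apply/smxP => p q; rewrite smxB /iota_mx.
by case: eqP => _; rewrite ?subr0 // raddfB.
Qed.
Lemma iotaM x (a : M) p q : (iota_mx x * a) p q = theta (bar p) x * a p q.
Proof.
rewrite smxM (bigD1 p) //= /iota_mx eqxx big1 ?addr0 // => r /negPf h.
by rewrite eq_sym h mul0r.
Qed.
Lemma iotaMr (a : M) x p q : (a * iota_mx x) p q = a p q * theta (bar q) x.
Proof.
rewrite smxM (bigD1 q) //= /iota_mx eqxx big1 ?addr0 // => r /negPf h.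
by rewrite h mulr0.
Qed.
Fact iota_multiplicative : multiplicative iota_mx.
Proof.
split=> [x y|]; apply/smxP => p q.
  by rewrite iotaM /iota_mx; case: eqP => _; rewrite ?mulr0 // rmorphM.
by rewrite smx1 /iota_mx rmorph1; case: (p == q).
Qed.
HB.instance Definition _ := GRing.isAdditive.Build Y M iota_mx iota_additive.
HB.instance Definition _ := GRing.isMultiplicative.Build Y M iota_mx iota_multiplicative.

Definition iota (x : Y) : C := serC (iota_mx x).
HB.instance Definition _ := GRing.RMorphism.copy iota (@serC M \o iota_mx).

Definition iotaT (i j : idx) : ser C := fun s => iota (T i j s).
Definition deltaT (i j : idx) : ser C := cop iotaT (@baseR n Y) i j.

Lemma iotaT_rtt : rtt (varx _) (vary _) (fun i j => seru (iotaT i j))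
  (fun i j => serv (iotaT i j)).
Proof. exact: (seru_serv_rtt iota (@yg_rtt K n D)). Qed.

Lemma theta_theta b c x : theta b (theta c x) = theta (b (+) c) x.
Proof. by case: b; case: c; rewrite ?thetaK ?thetaF. Qed.

(* The entries of baseR i j are integers, and vanish at the positions whose parity is
   not that of (i, j). *)
Lemma baseR_theta i j m r x :
  baseR Y i j m r * iota_mx x = iota_mx (theta (par i j) x) * baseR Y i j m r.
Proof.
apply/smxP => p q; rewrite iotaM iotaMr theta_theta.
pose P (a : Y) := a * theta (bar q) x = theta (bar p (+) par i j) x * a.
have PD a b : P a -> P b -> P (a + b).
  by move=> ha hb; rewrite /P mulrDl ha hb -mulrDr.
have PN a : P a -> P (- a) by rewrite /P mulNr mulrN => ->.
have Ps b a : P a -> P (sg Y b * a).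
  by case: b; rewrite ?sgT ?sgF ?mulN1r ?mul1r // => /PN.
have PE (b : bool) : (b -> bar q = bar p (+) par i j) -> P b%:R.
  case: b => [/(_ isT) h|_]; first by rewrite /P mul1r mulr1 h.
  by rewrite /P mul0r mulr0.
rewrite -/(P _); case: m => [|m] /=.
  case: ((r == 0%N) && (i == j)) / andP => [[_ /eqP ij]|_]; last exact: (PE false).
  rewrite -[(true%:R : M) p q]/((1 : M) p q) smx1; apply: PE => /eqP ->.
  by rewrite ij /par addbb addbF.
case: ifP => _; last exact: (PE false).
rewrite smxN smx_sg smxD smx_sg; apply/PN/Ps/PD; last apply/Ps; apply: PE.
  by case/andP => /eqP -> /eqP ->; rewrite /par addbCA addbb addbF.
case/andP => /eqP -> /eqP ->; rewrite /par /bar /=.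
by case: (i.2); case: (j.2).
Qed.

Lemma iota_sg b x : iota_mx (sg Y b * x) = sg M b * iota_mx x.
Proof. by rewrite rmorphM sgm. Qed.

Lemma baseR_iota i j m r k l s :
  baseR Y i j m r * iota_mx (T k l s)
  = sg M (par i j && par k l) * (iota_mx (T k l s) * baseR Y i j m r).
Proof. by rewrite baseR_theta (theta_homog _ (yhomogT k l s)) iota_sg -mulrA. Qed.

Lemma serC_comm (a : M) (f : C) (b : bool) :
  (forall r, f r * a = sg M b * (a * f r)) -> f * serC a = sg C b * (serC a * f).
Proof.
move=> h; apply/funext => r; rewrite serMC h.
by case: b {h}; rewrite ?sgT ?sgF ?mulN1r ?mul1r ?serN serCM.
Qed.

Lemma baseR_supercomm :
  supercommuting (fun i j => seru (@baseR n Y i j)) (fun i j => serv (iotaT i j)) /\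
  supercommuting (fun i j => serv (@baseR n Y i j)) (fun i j => seru (iotaT i j)).
Proof.
have h i j m k l s : @baseR n Y i j m * iotaT k l s
    = sg C (par i j && par k l) * (iotaT k l s * @baseR n Y i j m).
  by apply: serC_comm => r; exact: baseR_iota.
have hs b (F : ser (ser C)) m s : (sg _ b * F) m s = sg C b * F m s.
  by case: b; rewrite ?sgT ?sgF ?mulN1r ?mul1r.
split=> i j k l; apply/funext => m; apply/funext => s; rewrite hs.
  by rewrite coef_uv coef_vu h.
by rewrite coef_uv coef_vu h.
Qed.

Lemma deltaT_rtt : rtt (varx _) (vary _) (fun i j => seru (deltaT i j))
  (fun i j => serv (deltaT i j)).
Proof.
have [h1 h2] := baseR_supercomm.
apply: eq_rtt (rtt_cop (@varx_comm C) (@vary_comm C) h1 h2 iotaT_rtt (@baseR_rtt n Y)) => i j.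
  rewrite /deltaT /cop [RHS]rmorph_sum; apply: eq_bigr => a _.
  by rewrite !rmorphM sgm.
rewrite /deltaT /cop [RHS]rmorph_sum; apply: eq_bigr => a _.
by rewrite !rmorphM sgm.
Qed.

Lemma deltaT0 i j : deltaT i j 0%N = (i == j)%:R.
Proof.
rewrite /deltaT /cop ser_sum (bigD1 i) //= big1 ?addr0 => [|a /negPf ia].
  rewrite {1}/par addbb sgF mul1r serM big_ord1 subn0 /iotaT yg0 eqxx rmorph1 mul1r.
  by apply/funext => -[|r] //=; case: (i == j).
by rewrite ser_sg serM big_ord1 subn0 /iotaT yg0 eq_sym ia rmorph0 mul0r mulr0.
Qed.

Lemma baseRN i j m : sg C (odd m) * baseR Y i j m = baseR Y (negi i) (negi j) m.
Proof.
case: m => [|m].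
  by rewrite mul1r /baseR (inj_eq (can_inj (@negiK _))).
apply/funext => r; rewrite ser_sg /baseR; case: eqP => [->|_]; last by rewrite mulr0.
have hb : bar (negi i) = ~~ bar i by [].
rewrite hb !negiK /= !sgN !mulNr mulrN opprK sgsg addbC -sgsg.
by rewrite opprK; congr (_ * _); rewrite mulrDr sgK addrC.
Qed.

Lemma deltaTN i j s : sg C (odd s) * deltaT i j s = deltaT (negi i) (negi j) s.
Proof.
rewrite /deltaT /cop !ser_sum [RHS](reindex_inj (can_inj (@negiK n.+1))) /= mulr_sumr.
apply: eq_bigr => a _; rewrite !ser_sg sgCA.
have -> : par (negi i) (negi a) && par (negi a) (negi j) = par i a && par a j.
  by rewrite /par /bar /=; case: (i.2); case: (j.2); case: (a.2).
congr (_ * _); rewrite !serM mulr_sumr; apply: eq_bigr => k _.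
rewrite -baseRN /iotaT -ygN rmorphM sgm sgMM; congr (sg _ _ * _).
by rewrite -oddD subnKC // -ltnS.
Qed.

Definition kappa (c : K) : C := serC (smxC (c%:A : Y)).
HB.instance Definition _ :=
  GRing.RMorphism.copy kappa (@serC M \o (@smxC n Y \o in_alg Y)).

Lemma kappaE c (f : C) m p q : (kappa c * f) m p q = c *: f m p q.
Proof. by rewrite serCM smxCM mulr_algl. Qed.
Lemma kappaC c (f : C) : kappa c * f = f * kappa c.
Proof.
apply/funext => m; apply/smxP => p q.
by rewrite kappaE serMC smxMC mulr_algr.
Qed.

Lemma delta_exists : {e : {rmorphism Y -> C} |
  (forall i j s, e (T i j s) = deltaT i j s) /\ (forall c x, e (c *: x) = kappa c * e x)}.
Proof.
apply: cid; have [|e [e1 e2]] := @yg_universal K n D C kappa deltaT kappaC deltaT0 deltaTN.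
  exact: deltaT_rtt.
by exists e.
Qed.

(* The coaction determined by T(u) |-> T(u) (x) rho(T(u)). *)
Definition Delta : {rmorphism Y -> C} := projT1 delta_exists.
Lemma DeltaT i j s : Delta (T i j s) = deltaT i j s.
Proof. exact: (projT2 delta_exists).1. Qed.
Lemma DeltaZ c x : Delta (c *: x) = kappa c * Delta x.
Proof. exact: (projT2 delta_exists).2. Qed.
Lemma iotaZ c x : iota (c *: x) = kappa c * iota x.
Proof.
apply/funext => m; apply/smxP => p q; rewrite kappaE /iota.
case: m => [|m]; last by rewrite scaler0.
by rewrite /= /iota_mx; case: eqP => _; rewrite ?scaler0 // thetaZ.
Qed.

Definition redD (x : Y) : C := Delta x - iota x.
Fact redD_additive : additive redD.
Proof. by move=> x y; rewrite /redD !rmorphB !opprB !addrA [LHS](ACl (1*4*3*2)). Qed.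
HB.instance Definition _ := GRing.isAdditive.Build Y C redD redD_additive.
Lemma redDZ c x : redD (c *: x) = kappa c * redD x.
Proof. by rewrite /redD DeltaZ iotaZ mulrBr. Qed.
Lemma redDM x y : redD (x * y) = iota x * redD y + redD x * iota y + redD x * redD y.
Proof.
have E z : Delta z = iota z + redD z by rewrite addrC subrK.
rewrite {1}/redD !rmorphM !E mulrDl !mulrDr.
by rewrite !addrA [_ - _]addrC !addrA addNr add0r.
Qed.
End Coaction.

(** * The filtration *)

Section Filtration.
Variables (K : fieldType) (n : nat) (D : yalg K n).
Local Notation Y := (ycar D).
Local Notation idx := (idx n.+1).
Local Notation letter := (letter n.+1).
Local Notation T := (@yg K n D).
Local Notation M := (smx n Y).
Local Notation C := (ser M).

Definition tletter (g : letter) : Y := T g.1.1 g.1.2 g.2.+1.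
Definition tword (w : seq letter) : Y := \prod_(g <- w) tletter g.
Definition deg (w : seq letter) : nat := \sum_(g <- w) g.2.

(* The words below (d, l) for the lexicographic order of (degree + k, length). *)
Definition lower (k d l : nat) (w : seq letter) : bool :=
  (deg w + k < d)%N || ((deg w + k == d) && (size w < l))%N.

(** The bounds are strict: [gr 0 d l.+1] admits words of degree d with at most l letters, and
    [gr 0 d 0] only words of degree less than d, of any length. *)
Inductive gr (k d l : nat) : Y -> Prop :=
| Gr0 : gr k d l 0
| GrD c w x of lower k d l w & gr k d l x : gr k d l (c *: tword w + x).

Lemma grD k d l x y : gr k d l x -> gr k d l y -> gr k d l (x + y).
Proof.
by move=> hx hy; elim: hx => [|c w z lw _ IH]; rewrite ?add0r // -addrA; apply: GrD.
Qed.
Lemma grZ k d l c x : gr k d l x -> gr k d l (c *: x).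
Proof.
elim=> [|e w z lw _ IH]; first by rewrite scaler0; exact: Gr0.
by rewrite scalerDr scalerA; exact: GrD.
Qed.
Lemma grN k d l x : gr k d l x -> gr k d l (- x).
Proof. by rewrite -scaleN1r; exact: grZ. Qed.
Lemma grB k d l x y : gr k d l x -> gr k d l y -> gr k d l (x - y).
Proof. by move=> hx /grN; exact: grD. Qed.
Lemma gr_sg k d l b x : gr k d l x -> gr k d l (sg Y b * x).
Proof. by case: b; rewrite ?sgT ?sgF ?mulN1r ?mul1r //; exact: grN. Qed.
Lemma gr_sum k d l I (r : seq I) (P : pred I) (f : I -> Y) :
  (forall i, P i -> gr k d l (f i)) -> gr k d l (\sum_(i <- r | P i) f i).
Proof. by move=> h; elim/big_ind: _ => //; [exact: Gr0|exact: grD]. Qed.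
Lemma gr_word k d l w : lower k d l w -> gr k d l (tword w).
Proof. by move=> h; rewrite -[tword w]addr0 -[tword w]scale1r; apply: GrD h (Gr0 _ _ _). Qed.
Lemma grS k d l k' d' l' x : (forall w, lower k d l w -> lower k' d' l' w) ->
  gr k d l x -> gr k' d' l' x.
Proof. by move=> h; elim=> [|c w z /h lw _ IH]; [exact: Gr0|exact: GrD]. Qed.
Lemma gr_le k d l l' x : (l <= l')%N -> gr k d l x -> gr k d l' x.
Proof. by move=> ll; apply: grS => w; rewrite /lower; lia. Qed.
Lemma gr_lt k d l d' l' x : (d < d')%N -> gr k d l x -> gr k d' l' x.
Proof. by move=> ll; apply: grS => w; rewrite /lower; lia. Qed.
Lemma gr_shift m k d l x : gr (m + k) (m + d) l x <-> gr k d l x.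
Proof. by split; apply: grS => w; rewrite /lower; lia. Qed.
(** Degrees are nonnegative, so an element of filtration degree d has no coefficient at z^k for k >
    d: its image under [redD] is a polynomial in z. *)
Lemma gr_empty k d l x : (d < k)%N -> gr k d l x -> x = 0.
Proof. by move=> dk; elim=> // c w z; rewrite /lower; lia. Qed.

Lemma tword_cat v w : tword (v ++ w) = tword v * tword w.
Proof. exact: big_cat. Qed.
Lemma deg_cat v w : deg (v ++ w) = (deg v + deg w)%N.
Proof. exact: big_cat. Qed.
Lemma deg_cons g w : deg (g :: w) = (g.2 + deg w)%N.
Proof. exact: big_cons. Qed.
Lemma tword_cons g w : tword (g :: w) = tletter g * tword w.
Proof. exact: big_cons. Qed.
Lemma deg_nil : deg [::] = 0%N. Proof. exact: big_nil. Qed.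
Lemma tword_nil : tword [::] = 1. Proof. exact: big_nil. Qed.

(** As length bounds are strict, that of a product is the sum of the two bounds minus one. *)
Lemma grM k d l k' d' l' x y : gr k d l.+1 x -> gr k' d' l' y ->
  gr (k + k') (d + d') (l + l') (x * y).
Proof.
move=> hx hy; elim: hx => [|c v z lv _ IH]; first by rewrite mul0r; exact: Gr0.
rewrite mulrDl; apply: grD IH; rewrite -scalerAl; apply: grZ.
elim: hy => [|e w t lw _ IH]; first by rewrite mulr0; exact: Gr0.
rewrite mulrDr -scalerAr -tword_cat; apply: GrD IH.
by move: lv lw; rewrite /lower deg_cat size_cat; lia.
Qed.
Lemma grMr k d l k' d' l' x y : gr k d l x -> gr k' d' l'.+1 y ->
  gr (k + k') (d + d') (l + l') (x * y).
Proof.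
move=> hx hy; elim: hx => [|c v z lv _ IH]; first by rewrite mul0r; exact: Gr0.
rewrite mulrDl; apply: grD IH; rewrite -scalerAl; apply: grZ.
elim: hy => [|e w t lw _ IH]; first by rewrite mulr0; exact: Gr0.
rewrite mulrDr -scalerAr -tword_cat; apply: GrD IH.
by move: lv lw; rewrite /lower deg_cat size_cat; lia.
Qed.

Definition wpar (w : seq letter) : bool := \big[addb/false]_(g <- w) par g.1.1 g.1.2.
Lemma yhomog_tletter g : yhomog (par g.1.1 g.1.2) (tletter g). Proof. exact: yhomogT. Qed.
Lemma yhomog_tword w : yhomog (wpar w) (tword w).
Proof.
elim: w => [|g w IH]; first by rewrite /wpar /tword !big_nil; exact: yhomog1.
rewrite /wpar big_cons tword_cons; apply: yhomogM => //; exact: yhomog_tletter.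
Qed.
Lemma gr_theta k d l b x : gr k d l x -> gr k d l (theta b x).
Proof.
elim=> [|c w z lw _ IH]; first by rewrite raddf0; exact: Gr0.
rewrite raddfD /= thetaZ (theta_homog _ (yhomog_tword w)); apply: grD IH.
by apply/grZ/gr_sg/gr_word.
Qed.

Lemma gr_T k i j s l : (0 < l)%N -> gr k (s + k) l.+1 (T i j s.+1).
Proof.
move=> l0; rewrite -[T i j _]/(tletter (i, j, s)) -[tletter _]mulr1 -tword_nil -tword_cons.
by apply: gr_word; rewrite /lower deg_cons deg_nil /=; lia.
Qed.
Lemma gr_1 k l : (0 < l)%N -> gr k k l 1.
Proof. by move=> l0; rewrite -tword_nil; apply: gr_word; rewrite /lower deg_nil /=; lia. Qed.

(** The variable z has degree one: the coefficient of z^k must lie k degrees lower. The image of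
    T_ij^(s+1) under rho, a constant times z^s, then has the degree s of T_ij^(s+1). *)
Definition grC (d l : nat) (F : C) : Prop := forall k p q, gr k d l (F k p q).

Lemma grCD d l F F' : grC d l F -> grC d l F' -> grC d l (F + F').
Proof. by move=> h h' k p q; exact: grD. Qed.
Lemma grC0 d l : grC d l 0. Proof. by move=> k p q; exact: Gr0. Qed.
Lemma grCN d l F : grC d l F -> grC d l (- F).
Proof. by move=> h k p q; exact: grN. Qed.
Lemma grC_sg d l b F : grC d l F -> grC d l (sg C b * F).
Proof. by case: b; rewrite ?sgT ?sgF ?mulN1r ?mul1r //; exact: grCN. Qed.
Lemma grC_sum d l I (r : seq I) (P : pred I) (f : I -> C) :
  (forall i, P i -> grC d l (f i)) -> grC d l (\sum_(i <- r | P i) f i).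
Proof. by move=> h; elim/big_ind: _ => //; [exact: grC0|exact: grCD]. Qed.
Lemma grC_kappa d l c F : grC d l F -> grC d l (kappa D c * F).
Proof. by move=> h k p q; rewrite kappaE; exact: grZ. Qed.
Lemma grC_le d l l' F : (l <= l')%N -> grC d l F -> grC d l' F.
Proof. by move=> ll h k p q; exact: gr_le (h k p q). Qed.
Lemma grC_lt d l d' l' F : (d < d')%N -> grC d l F -> grC d' l' F.
Proof. by move=> ll h k p q; exact: gr_lt (h k p q). Qed.
Lemma grC_iota d l x : gr 0 d l x -> grC d l (iota x).
Proof.
move=> h [|k] p q; last exact: Gr0.
by rewrite /iota /= /iota_mx; case: eqP => _; [exact: gr_theta|exact: Gr0].
Qed.

Lemma grCM d l d' l' F F' : grC d l.+1 F -> grC d' l' F' ->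
  grC (d + d') (l + l') (F * F').
Proof.
move=> h h' k p q; rewrite serM smx_sum; apply: gr_sum => a _.
rewrite smxM; apply: gr_sum => r _.
have ak : (a <= k)%N by rewrite -ltnS.
by move: (nat_of_ord a) ak => b bk; rewrite -[X in gr X](subnKC bk); exact: grM.
Qed.
Lemma grCMr d l d' l' F F' : grC d l F -> grC d' l'.+1 F' ->
  grC (d + d') (l + l') (F * F').
Proof.
move=> h h' k p q; rewrite serM smx_sum; apply: gr_sum => a _.
rewrite smxM; apply: gr_sum => r _.
have ak : (a <= k)%N by rewrite -ltnS.
by move: (nat_of_ord a) ak => b bk; rewrite -[X in gr X](subnKC bk); exact: grMr.
Qed.

Lemma gr_nat k l (b : bool) : (0 < l)%N -> gr k k l b%:R.
Proof. by case: b => h; [exact: gr_1|exact: Gr0]. Qed.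

Lemma grC_base i j s l : (0 < l)%N -> grC s l (baseR Y i j s.+1).
Proof.
move=> l0 k p q; rewrite /baseR; case: eqP => [->|_]; last exact: Gr0.
rewrite smxN smx_sg smxD smx_sg; apply/grN/gr_sg/grD; last apply/gr_sg; exact: gr_nat.
Qed.

(* What is left of T(u) (x) rho(T(u)) has smaller total degree. *)
Definition deltaR (i j : idx) (s : nat) : C :=
  \sum_(a : idx) sg C (par i a && par a j) *
    \sum_(k < s) iota (T i a k.+1) * baseR Y a j (s - k)%N.

Lemma baseR0 i j : baseR Y i j 0 = (i == j)%:R :> C.
Proof.
rewrite /baseR; case: (i == j); apply/funext => r; last by rewrite andbF.
by rewrite andbT.
Qed.

(** The extreme terms of the convolution contain a T^(0), which is a Kronecker delta: the first one
    is rho(T_ij^(s+1)) and the last one T_ij^(s+1) (x) 1. *)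
Lemma DeltaTE i j s :
  Delta D (T i j s.+1) = iota (T i j s.+1) + baseR Y i j s.+1 + deltaR i j s.
Proof.
rewrite DeltaT /deltaT /cop ser_sum /deltaR.
under eq_bigr => a _ do rewrite ser_sg serM big_ord_recl big_ord_recr /= subnn subn0
  !mulrDr.
rewrite !big_split /= (addrC (iota _)) -addrA; congr (_ + _).
  rewrite (bigD1 i) //= big1 ?addr0 => [|a /negPf ia].
    by rewrite {1}/par addbb sgF mul1r /iotaT yg0 eqxx rmorph1 mul1r.
  by rewrite /iotaT yg0 eq_sym ia rmorph0 mul0r mulr0.
rewrite addrC; congr (_ + _).
rewrite (bigD1 j) //= big1 ?addr0 => [|a /negPf aj].
  by rewrite [par j j]/par addbb andbF sgF mul1r baseR0 eqxx mulr1.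
by rewrite baseR0 aj mulr0 mulr0.
Qed.

(** Degree is the superscript minus one, so distributing the superscript s+1 over two factors loses
    one degree. *)
Lemma grC_deltaR i j s : grC s 0 (deltaR i j s).
Proof.
apply: grC_sum => a _; apply/grC_sg/grC_sum => k _.
have [m Em] : exists m, (s - k)%N = m.+1 by exists (s - k).-1; have := ltn_ord k; lia.
rewrite Em; apply: (@grC_lt (k + m) (1 + 1)); first by have := ltn_ord k; lia.
apply: grCM; last exact: grC_base.
by apply: grC_iota; rewrite -[X in gr 0 X]addn0; exact: gr_T.
Qed.

Lemma redDT i j s : grC s 0 (redD (T i j s.+1) - baseR Y i j s.+1).
Proof.
rewrite /redD DeltaTE -(addrA (iota _)) [iota _ + _]addrC addrK.
by rewrite [_ + deltaR _ _ _]addrC addrK; exact: grC_deltaR.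
Qed.

Lemma grC_redDT i j s : grC s 1 (redD (T i j s.+1)).
Proof.
rewrite -[redD _](subrK (baseR Y i j s.+1)); apply: grCD; last exact: grC_base.
exact: grC_le (redDT i j s).
Qed.

(** [redD] keeps the total degree and lowers the length by one, the bound [size w] being strict. *)
Lemma grC_redD_word w : grC (deg w) (size w) (redD (tword w)).
Proof.
elim: w => [|g w IH]; first by rewrite tword_nil /redD !rmorph1 subrr; exact: grC0.
rewrite tword_cons deg_cons redDM /=; apply: grCD; first apply: grCD.
- rewrite -[(size w).+1]/(1 + size w)%N; apply: grCM => //; apply: grC_iota.
  by rewrite -[X in gr 0 X]addn0; exact: gr_T.
- rewrite -[(size w).+1]/(0 + (size w).+1)%N; apply: grCM; first exact: grC_redDT.
  by apply/grC_iota/gr_word; rewrite /lower; lia.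
- apply: (@grC_le _ (0 + size w)) => //; apply: grCM IH; exact: grC_redDT.
Qed.

Lemma grC_redD d l x : gr 0 d l.+1 x -> grC d l (redD x).
Proof.
elim=> [|c w z lw _ IH]; first by rewrite raddf0; exact: grC0.
rewrite raddfD /= redDZ; apply: grCD IH; apply: grC_kappa.
move: lw (grC_redD_word w); rewrite /lower addn0 => /orP[h|/andP[/eqP <- h]].
  exact: grC_lt.
by apply: grC_le; rewrite -ltnS.
Qed.

(* Modulo lower terms, redD is a derivation along iota. *)
Lemma redD_deriv s d l x y : gr 0 s 2 x -> gr 0 d l.+1 y ->
  grC (s + d) l (redD (x * y) - (iota x * redD y + redD x * iota y)).
Proof.
move=> /grC_redD hx /grC_redD hy; rewrite redDM addrC addKr.
exact: (grCM hx hy).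
Qed.
End Filtration.

(** * Linear independence of ordered monomials *)

Lemma subrBB (V : zmodType) (a b c d : V) : a - b - (c - d) = a - c - (b - d).
Proof. by rewrite !opprB !addrA [LHS](ACl (1*4*3*2)). Qed.

Section Letters.
Variables (K : fieldType) (n : nat) (D : yalg K n).
Local Notation Y := (ycar D).
Local Notation idx := (idx n.+1).
Local Notation letter := (letter n.+1).
Local Notation T := (@yg K n D).
Local Notation M := (smx n Y).
Local Notation C := (ser M).

Implicit Types (g h : letter) (w v : seq letter).

Hypothesis charK : forall m, m.+1%:R != 0 :> K.
Variables (Zf : nat -> Y) (cz : nat -> K).
Hypothesis cz_neq0 : forall k, cz k != 0.
Hypothesis Zf_even : forall k, yhomog false (Zf k).
Hypothesis Zf_lead : forall k, gr (D := D) 0 k.*2 0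
  (Zf k - cz k *: \sum_(i < n.+1) T (i, false) (i, false) k.*2.+1).

Definition i0 : idx := (ord0, false).
(** The letters of T_11^(2k+1): an odd superscript is an even degree, here g.2 = 2k. *)
Definition special (g : letter) : bool := (g.1 == (i0, i0)) && ~~ odd g.2.
Definition reduced (g : letter) : bool := ~~ bar g.1.1.
Definition gpar (g : letter) : bool := par g.1.1 g.1.2.

(* The PBW generators: Z^(2k+2) replaces T_11^(2k+1). *)
Definition val (g : letter) : Y := if special g then Zf g.2./2 else tletter D g.
Definition valw (w : seq letter) : Y := \prod_(g <- w) val g.

Lemma yhomog_val g : yhomog (gpar g) (val g).
Proof.
rewrite /val; case: ifP => [/andP[/eqP e _]|_]; last exact: yhomogT.
by rewrite /gpar e; exact: Zf_even.
Qed.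

Lemma half_special g : special g -> g.2./2.*2 = g.2.
Proof. by case/andP => _; lia. Qed.

Lemma gr_val g : gr 0 g.2 2 (val g).
Proof.
rewrite /val; case: ifP => [sp|_]; last by rewrite -[X in gr 0 X]addn0; exact: gr_T.
rewrite -[Zf _](subrK (cz g.2./2 *: \sum_(i < n.+1) T (i, false) (i, false) g.2./2.*2.+1)).
rewrite -{1}(half_special sp); apply: grD; first exact: gr_le (Zf_lead _).
by apply/grZ/gr_sum => i _; rewrite -[X in gr 0 X]addn0; exact: gr_T.
Qed.

(* The leading part of redD (val g), by redD_val. *)
Definition cst (g : letter) : C :=
  if special g then fun r => if r == g.2 then smxC ((- cz g.2./2)%:A : Y) else 0
  else baseR Y g.1.1 g.1.2 g.2.+1.

Lemma redD_val g : grC g.2 0 (redD (val g) - cst g).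
Proof.
rewrite /val /cst; case: ifP => [sp|_]; last exact: redDT.
pose S := \sum_(i < n.+1) T (i, false) (i, false) g.2./2.*2.+1.
have -> : redD (Zf g.2./2) = redD (Zf g.2./2 - cz g.2./2 *: S) + kappa D (cz g.2./2) * redD S.
  by rewrite -redDZ -raddfD subrK.
rewrite -addrA; apply: grCD.
  by rewrite -{1}(half_special sp); apply/grC_redD/(gr_le _ (Zf_lead _)).
(* In even degree rho(T_ii) is -(E_ii + E_(-i,-i)) times a power of z, and summing over i > 0 gives
   minus the identity matrix. *)
have -> : (fun r => if r == g.2 then smxC ((- cz g.2./2)%:A : Y) else 0) =
    kappa D (cz g.2./2) * \sum_(i < n.+1) baseR Y (i, false) (i, false) g.2.+1 :> C.
  apply/funext => r; apply/smxP => p q; rewrite kappaE ser_sum smx_sum.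
  rewrite /baseR; case: eqP => [->|_]; last by rewrite smx0 big1 ?scaler0.
  rewrite (negPf (andP sp).2) /smxC.
  under eq_bigr => i _ do rewrite /= !sgF !mul1r smxN smxD /smxE.
  rewrite sumrN big_split /=; case: p => p bp; case: q => q bq.
  have hs (b : bool) : \sum_(i < n.+1) (((p, bp) == (i, b)) && ((q, bq) == (i, b)))%:R
      = ((p == q) && (bp == b) && (bq == b))%:R :> Y.
    rewrite (bigD1 p) //= big1 ?addr0 => [|i /negPf ip].
      by rewrite !xpair_eqE eqxx (eq_sym q) /=; congr (_%:R); case: (p == q); case: (bp == b); case: (bq == b).
    by rewrite xpair_eqE eq_sym ip.
  rewrite (hs false) (hs true) {hs} xpair_eqE.
  case: (p == q) => /=; last by rewrite addr0 oppr0 scaler0.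
  by case: bp; case: bq => /=; rewrite ?addr0 ?add0r ?oppr0 ?scaler0 ?scalerN ?scaleNr.
rewrite -mulrBr; apply: grC_kappa; rewrite raddf_sum -sumrB; apply: grC_sum => i _.
by rewrite (half_special sp); exact: redDT.
Qed.

(* The coordinate of the leading part of redD that detects the generator val g: it is
   dual to cst by mu_cst. *)
Definition mu (g : letter) (F : C) : Y :=
  let: (i, j, s) := g in
  if i != j then F s j i
  else if odd s then F s i i - theta true (F s (negi i) (negi i))
  else if i == i0 then F s i i
  else F s i i - F s i0 i0.

Fact mu_additive g : additive (mu g).
Proof.
case: g => [[i j] s] F F'; rewrite /mu /= !serB !smxB.
case: ifP => // _; case: ifP => _; first rewrite raddfB /=.
  exact: subrBB.
by case: ifP => // _; exact: subrBB.
Qed.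
HB.instance Definition _ g := GRing.isAdditive.Build C Y (mu g) (mu_additive g).

Lemma mu_kappa g c F : mu g (kappa D c * F) = c *: mu g F.
Proof.
case: g => [[i j] s]; rewrite /mu !kappaE thetaZ -!scalerBr.
by case: ifP => // _; case: ifP => // _; case: ifP.
Qed.

Lemma gr_mu g d l F : grC d l F -> gr g.2 d l (mu g F).
Proof.
case: g => [[i j] s] h; rewrite /mu /=; case: ifP => _; first exact: h.
case: ifP => _; first by apply: grB; [exact: h|exact/gr_theta/h].
by case: ifP => _; [exact: h|apply: grB; exact: h].
Qed.

Lemma iotaCM x (F : C) r p q : (iota x * F) r p q = theta (bar p) x * F r p q.
Proof. by rewrite /iota serCM iotaM. Qed.
Lemma iotaCMr x (F : C) r p q : (F * iota x) r p q = F r p q * theta (bar q) x.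
Proof. by rewrite /iota serMC iotaMr. Qed.

Lemma mu_iota g x F : reduced g -> mu g (iota x * F) = theta (gpar g) x * mu g F.
Proof.
case: g => [[[i bi] j] s]; rewrite /reduced /bar /= => /negPf ->.
rewrite /mu /gpar /par !iotaCM /bar /=; case: eqP => [<-|_] //=.
by rewrite !thetaF rmorphM /= thetaK -!mulrBr; case: ifP => // _; case: ifP.
Qed.

Definition pair (g : letter) : K :=
  if special g then - cz g.2./2 else
  if g.1.1 != g.1.2 then -1 else if odd g.2 then - 2 else -1.

Lemma pair_neq0 g : pair g != 0.
Proof.
rewrite /pair; case: ifP => _; first by rewrite oppr_eq0.
case: ifP => _; first by rewrite oppr_eq0 oner_eq0.
by case: ifP => _; rewrite oppr_eq0 ?oner_eq0 //; exact: (charK 1).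
Qed.

(** In even degree, F_ii - F_11 kills the scalar matrix of a special letter, and no generator has
    leading part rho(T_11). In odd degree, rho(T_ii) has opposite entries at i and -i, so their
    difference yields the factor -2; an entry alone would do for duality, but the difference is
    needed in [mu_central]. *)
Lemma mu_cst g h y : reduced g -> reduced h ->
  mu g (cst h * iota y) = if g == h then pair g *: y else 0.
Proof.
case: g => [[[i bi] j] s]; case: h => [[[k bk] l] t].
case: bi => //; case: bk => // _ _; set h := (((k, false), l), t).
have mu0 : cst h s = 0 -> mu (i, false, j, s) (cst h * iota y) = 0.
  move=> e0; have z p q : (cst h * iota y) s p q = 0 by rewrite iotaCMr e0 mul0r.
  by rewrite /mu !z raddf0 subrr; case: ifP => // _; case: ifP => // _; case: ifP.
have [st|/negPf st] := eqVneq s t; last first.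
  rewrite mu0; last by rewrite /cst /baseR; case: ifP => _; rewrite /= st.
  by rewrite /h !xpair_eqE st andbF.
rewrite {mu0} /h -st; clear st; set h := (((k, false), l), s).
have sc (c : K) : c%:A * y = c *: y by rewrite mulr_algl.
have E p q : special h = false -> (cst h * iota y) s p q =
    - (smxE Y l (k, false) p q + sg Y (odd s) * smxE Y (negi l) (negi (k, false)) p q)
    * theta (bar q) y.
  by move=> sp; rewrite iotaCMr /cst sp /baseR /= eqxx smxN smx_sg smxD smx_sg /bar /= sgF mul1r.
have ES p q : special h -> (cst h * iota y) s p q =
    (if p == q then - cz s./2 else 0) *: theta (bar q) y.
  move=> sp; rewrite iotaCMr /cst sp /= eqxx /smxC.
  by case: ifP => _; rewrite ?mulr_algl ?mul0r ?scale0r.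
case sp: (special h).
  have [hk os] : ((k, false), l) = (i0, i0) /\ ~~ odd s.
    by move: sp => /andP[/eqP].
  rewrite /mu !(ES _ _ sp) (negPf os) !thetaF /pair /=.
  have [ij|/negPf ij] /= := eqVneq ((i, false) : idx) j; last first.
    rewrite scale0r /h; case: eqP => // -[gi gj].
    by move: ij; rewrite gi gj; case: hk => -> ->; rewrite eqxx.
  rewrite eqxx -ij; have [i00|/negPf i00] := eqVneq ((i, false) : idx) i0.
    have -> : (i, false, (i, false), s) = h by rewrite i00 /h; case: hk => -> ->.
    by rewrite eqxx sp.
  rewrite scaleNr opprK addNr /h; case: eqP => // -[gi _].
  by move: i00; rewrite gi; case: hk => ->; rewrite eqxx.
have hE : ((i, false, j, s) == h) = (j == l) && (i == k).
  by rewrite /h !xpair_eqE !eqxx /= !andbT andbC.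
rewrite hE /mu /pair !(E _ _ sp) /smxE.
have n1 (a b : 'I_n.+1) : ((a, false) == (b, true) :> idx) = false by rewrite xpair_eqE andbF.
have n2 (a b : 'I_n.+1) : ((a, true) == (b, false) :> idx) = false by rewrite xpair_eqE andbF.
have F0 : (nat_of_bool false)%:R = 0 :> Y by [].
rewrite /negi /= !n1 !n2 !xpair_eqE /= !eqxx !andbT !andbF F0 !mulr0 !addr0 !add0r.
have sb (b : bool) c : (- b%:R : Y) * c = if b then - c else 0.
  by case: b; rewrite ?mulN1r // oppr0 mul0r.
have [ij|/negPf ij] /= := eqVneq ((i, false) : idx) j; last first.
  rewrite thetaF sb /special xpair_eqE; case: (_ && (i == k)) => //.
  have -> : ((i, false) == i0) && (j == i0) = false.
    by apply/negP => /andP[/eqP a /eqP b]; move: ij; rewrite a b eqxx.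
  by rewrite scaleN1r.
have nsp : ~~ odd s -> ((ord0, false) == l) && (ord0 == k) = false.
  move=> os; apply/negP => /andP[/eqP l0 /eqP k0].
  by move: sp; rewrite /special /h -l0 -k0 eqxx /= os.
rewrite -ij; case: l @h E ES sp hE nsp => l1 bl h E ES sp hE nsp.
have -> : (i == l1) && (true == ~~ bl) = ((i, false) == (l1, bl)) by rewrite xpair_eqE; case: bl {h E ES sp hE nsp}.
case: ifP => [os|/negbT os]; last first.
  rewrite !thetaF !sb; case: ifP => [/eqP ->|i0f].
    by rewrite nsp.
  rewrite [(i0 == _) && _]nsp // subr0; case: ifP => // _.
  by rewrite /special /= xpair_eqE /i0 xpair_eqE i0f scaleN1r.
rewrite os sgT mulN1r opprK thetaF sb.
have -> : special (i, false, (i, false), s) = false by rewrite /special os andbF.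
case: (_ && (i == k)); last by rewrite mul0r raddf0 subrr.
by rewrite mul1r thetaK -opprD scaleNr scalerDl scale1r.
Qed.

(** Any total order on the letters serves; countability provides one. *)
Definition leL : rel letter := fun g h => (choice.pickle g <= choice.pickle h)%N.
Lemma leL_total : total leL. Proof. by move=> g h; exact: leq_total. Qed.
Lemma leL_trans : transitive leL. Proof. by move=> g h k; exact: leq_trans. Qed.
Lemma leL_anti : antisymmetric leL.
Proof. by move=> g h; rewrite -eqn_leq => /eqP/(pcan_inj (@choice.pickleK _)). Qed.

(* The exponents of a PBW monomial, as a sorted word. *)
Definition adm (w : seq letter) : bool :=
  [&& sorted leL w, all reduced w & all (fun g => gpar g ==> (count_mem g w <= 1)%N) w].

Lemma adm_subseq v w : subseq v w -> adm w -> adm v.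
Proof.
move=> vw /and3P[so /allP re /allP co]; apply/and3P; split.
- exact: (subseq_sorted leL_trans vw).
- by apply/allP => g /(mem_subseq vw)/re.
- apply/allP => g gv; have := co _ (mem_subseq vw gv); case: (gpar g) => //=.
  by apply: leq_trans; exact: leq_count_subseq.
Qed.

Lemma valw_cons g w : valw (g :: w) = val g * valw w. Proof. exact: big_cons. Qed.

Lemma gr_valw w l : (size w < l)%N -> gr 0 (deg w) l (valw w).
Proof.
elim: w l => [|g w IH] l /= h; first by rewrite /valw big_nil deg_nil; exact: gr_1.
rewrite valw_cons deg_cons; apply: (@gr_le _ _ _ _ _ (1 + (size w).+1)) => //.
by rewrite -[X in gr X]addn0; apply: grM; [exact: gr_val|exact: IH].
Qed.

(** The Leibniz rule modulo lower terms: either [redD] passes over the first letter, at the cost of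
    a parity sign, or it acts on that letter and contributes only when it is g. *)
Lemma mu_redD_cons g h w : reduced g -> reduced h ->
  gr g.2 (h.2 + deg w) (size w)
    (mu g (redD (valw (h :: w))) - (theta (gpar g) (val h) * mu g (redD (valw w))
       + if g == h then pair g *: valw w else 0)).
Proof.
move=> rg rh; rewrite valw_cons -mu_iota // -(mu_cst (valw w) rg rh).
have E : forall A B B' X : C, X - (A + B') = (X - (A + B)) + (B - B').
  by move=> A B B' X; rewrite !opprD !addrA subrK.
rewrite -!raddfD -raddfB (E _ (redD (val h) * iota (valw w))) raddfD.
apply: grD; apply: gr_mu.
  by apply: redD_deriv; [exact: gr_val|exact: gr_valw].
rewrite -mulrBl -[X in grC _ X]add0n; apply: grCMr; first exact: redD_val.
by apply/grC_iota/gr_valw.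
Qed.

(* redD strips one letter off a PBW monomial, and mu g selects the letter g. *)
Lemma mu_redD g w : reduced g -> adm w -> exists2 c : K, (c != 0) = (g \in w) &
  gr g.2 (deg w) (size w).-1 (mu g (redD (valw w)) - c *: valw (rem g w)).
Proof.
move=> rg aw.
(* A sign can occur only for odd g, which appears at most once in w. For even g all occurrences
   contribute with the same sign, so the coefficient is [pair g] times the multiplicity and is
   nonzero in characteristic 0. *)
suff [b hb H] : exists2 b : bool, (b ==> gpar g) & gr g.2 (deg w) (size w).-1
    (mu g (redD (valw w)) - sg Y b * (pair g * (count_mem g w)%:R *: valw (rem g w))).
  exists ((-1) ^+ b * (pair g * (count_mem g w)%:R)).
    rewrite !mulf_eq0 signr_eq0 (negPf (pair_neq0 g)) /= -has_pred1 has_count.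
    by case: (count_mem g w) => [|m]; rewrite ?eqxx // charK.
  move: H; congr (gr _ _ _ (_ - _)).
  by rewrite mulr_sign; case: b {hb}; rewrite ?sgT ?sgF ?mulN1r ?mul1r // scaleNr.
elim: w aw => [|h w IH] aw.
  exists false => //; rewrite /= mulr0 scale0r mulr0 subr0 /valw big_nil.
  by rewrite /redD !rmorph1 subrr raddf0; exact: Gr0.
have aw' : adm w by apply: adm_subseq aw; exact: subseq_cons.
have rh : reduced h by case/and3P: aw => _ /= /andP[].
have [b hb H] := IH aw'.
have := mu_redD_cons w rg rh; rewrite deg_cons -[(size (h :: w)).-1]/(size w).
set X := mu g (redD (valw (h :: w))) => HX.
have HT : gr g.2 (h.2 + deg w) (size w)
  (theta (gpar g) (val h) * (mu g (redD (valw w)) -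
     sg Y b * (pair g * (count_mem g w)%:R *: valw (rem g w)))).
  case: w {aw IH X HX} aw' H => [|k w] aw' H.
    rewrite /= mulr0 scale0r mulr0 subr0 /valw big_nil /redD !rmorph1 subrr raddf0 mulr0.
    exact: Gr0.
  rewrite -[g.2]add0n -[size (k :: w)]/(1 + (size (k :: w)).-1)%N.
  by apply: grM => //; apply/gr_theta/gr_val.
have HS := grD HX HT.
rewrite (theta_homog _ (yhomog_val h)) in HS.
set S := sg Y _ * val h in HS; set R := valw (rem g w) in HS.
set I := if _ then _ else _ in HS; set c := pair g * _ in HS.
have {}HS : gr g.2 (h.2 + deg w) (size w) (X - (I + S * (sg Y b * (c *: R)))).
  by move: HS; congr (gr _ _ _ _); rewrite mulrBr !opprD !addrA [LHS](ACl (1*3*5*2*4)) /= addrNK.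
have [gh|gh] := eqVneq g h; last first.
  exists ((gpar g && gpar h) (+) b).
    by move: hb; case: (gpar g); case: (gpar h); case: b {H HT HS}.
  move: HS; congr (gr _ _ _ (_ - _)); rewrite /I (negPf gh) add0r /S /= eq_sym (negPf gh).
  by rewrite add0n -/c sgMM valw_cons -scalerAr.
have [gw|gw] := boolP (g \in w); last first.
  exists false => //; move: HS; congr (gr _ _ _ (_ - _)).
  rewrite /I gh /= eqxx -gh /c (count_memPn gw) addn0 mulr1 mulr0 scale0r !mulr0 addr0.
  by rewrite mul1r.
have gF : gpar g = false.
  apply/negbTE/negP => pg; have /and3P[_ _ /allP/(_ g)] := aw.
  rewrite gh mem_head -gh pg /= eqxx add1n => /(_ isT).
  by rewrite ltnS leqNgt -has_count has_pred1 gw.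
exists false => //; move: HS; congr (gr _ _ _ (_ - _)).
have -> : b = false by move: hb; rewrite gF; case: b {H HT}.
rewrite /I /S gF gh /= eqxx sgF !mul1r -gh -scalerAr.
(* The sorted word begins with g and contains it again in w, so the first letter of w is g as
   well. *)
have -> : val g * R = valw w.
  rewrite /R -valw_cons; congr (valw _).
  case: w gw aw {IH aw' H X HX HT I S R c} => [|k w] // gw.
  rewrite -gh => /and3P[/= /andP[gk kw] _ _].
  suff -> : k = g by rewrite eqxx.
  apply: leL_anti; rewrite gk andbT.
  move: gw; rewrite inE => /orP[/eqP -> //|gw]; first by rewrite /leL leqnn.
  exact: (allP (order_path_min leL_trans kw)).
by rewrite -scalerDl /c natrD mulrDr mulr1.
Qed.

Lemma adm_sorted w : adm w -> sorted leL w. Proof. by case/and3P. Qed.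

(** It makes removal of g injective on the admissible words that contain g, so distinct monomials
    stay distinct. *)
Lemma sort_rem g w : adm w -> g \in w -> sort leL (g :: rem g w) = w.
Proof.
move=> /adm_sorted sw gw; apply: (sorted_eq leL_trans leL_anti) => //.
  exact: sort_sorted leL_total _.
by rewrite perm_sort perm_sym; exact: perm_to_rem.
Qed.

Lemma deg_rem g w : g \in w -> deg w = (g.2 + deg (rem g w))%N.
Proof. by move=> gw; rewrite /deg (perm_big _ (perm_to_rem gw)) big_cons. Qed.

(** Independence of leading terms: the combination is only assumed to vanish modulo smaller words,
    which is what the induction on length can use. *)
Definition independent (l : nat) : Prop :=
  forall d (s : seq (seq letter)) (c : seq letter -> K), uniq s ->
    (forall w, w \in s -> [/\ adm w, deg w = d & size w = l]) ->
    gr 0 d l (\sum_(w <- s) c w *: valw w) -> forall w, w \in s -> c w = 0.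

(** The lower correction y lets one lemma serve twice: the full element is zero in [independence]
    and supercentral in [scentral_pbw]. In both cases [mu g] of its image is lower than expected,
    which gives a relation between words of length l. *)
Lemma mu_redD_sum l d (s : seq (seq letter)) (c : seq letter -> K) y g :
  independent l -> uniq s ->
  (forall w, w \in s -> [/\ adm w, deg w = d & size w = l.+1]) ->
  gr 0 d l.+1 y -> reduced g ->
  gr g.2 d l (mu g (redD (\sum_(w <- s) c w *: valw w + y))) ->
  forall w, w \in s -> g \in w -> c w = 0.
Proof.
move=> IH us hs hy rg H w ws gw.
have /choice[e he] : forall w : seq letter, exists e : K, adm w ->
    (e != 0) = (g \in w) /\
    gr g.2 (deg w) (size w).-1 (mu g (redD (valw w)) - e *: valw (rem g w)).
  move=> v; case av: (adm v); last by exists 0.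
  by have [e e1 e2] := mu_redD rg av; exists e.
pose s' := [seq v <- s | g \in v].
(* The induction hypothesis wants coefficients indexed by the stripped words; sorting g back in
   recovers the original word. *)
pose c' v := let v' := sort leL (g :: v) in c v' * e v'.
have cE v : v \in s' -> c' (rem g v) = c v * e v.
  rewrite mem_filter => /andP[gv /hs[av _ _]]; by rewrite /c' sort_rem.
have ws' : w \in s' by rewrite mem_filter gw.
have K0 := IH (d - g.2)%N (map (rem g) s') c'.
have [aw dw sw] := hs w ws.
have gd : (g.2 <= d)%N by rewrite -dw (deg_rem gw) leq_addr.
have : c w * e w = 0.
  rewrite -(cE w ws'); apply: K0; last exact: map_f.
  - rewrite map_inj_in_uniq ?filter_uniq // => v v'.
    rewrite !mem_filter => /andP[gv /hs[av _ _]] /andP[gv' /hs[av' _ _]] ev.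
    by rewrite -(sort_rem av gv) ev sort_rem.
  - move=> u /mapP[v]; rewrite mem_filter => /andP[gv /hs[av dv sv]] ->.
    split; first exact: adm_subseq (rem_subseq _ _) av.
      by rewrite -dv (deg_rem gv) addKn.
    by rewrite size_rem // sv.
  (* Reading the coefficient of z^(g.2) lowers the degree by g.2, which is the degree of the removed
     letter. *)
  apply/(gr_shift g.2); rewrite addn0 subnKC // big_map.
  rewrite (eq_big_seq (fun v => (c v * e v) *: valw (rem g v))); last first.
    by move=> v vs; rewrite cE.
  rewrite big_filter.
  have -> : \sum_(v <- s | g \in v) (c v * e v) *: valw (rem g v)
     = \sum_(v <- s) (c v * e v) *: valw (rem g v).
    rewrite big_mkcond; apply: eq_big_seq => v /hs[av _ _].
    case: ifP => // gv; have [] := he v av; rewrite gv => /negbFE/eqP -> _.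
    by rewrite mulr0 scale0r.
  have -> : \sum_(v <- s) (c v * e v) *: valw (rem g v) =
     mu g (redD (\sum_(v <- s) c v *: valw v + y)) - mu g (redD y)
     - \sum_(v <- s) c v *: (mu g (redD (valw v)) - e v *: valw (rem g v)).
    rewrite (raddfD (@redD K n D)) (raddfD (mu g)) /= addrK.
    rewrite (raddf_sum (@redD K n D)) (raddf_sum (mu g)) -sumrB.
    apply: eq_bigr => v _.
    by rewrite /= redDZ mu_kappa scalerBr scalerA opprB addrC subrK.
  apply: grB; first apply: grB => //; first by apply/gr_mu/grC_redD.
  rewrite big_seq_cond; apply: gr_sum => v; rewrite andbT => /hs[av dv sv].
  by apply: grZ; have [_] := he v av; rewrite dv sv.
by move/eqP; rewrite mulf_eq0 => /orP[/eqP //|/negPn]; rewrite (he w aw).1 gw.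
Qed.

Lemma independence l : independent l.
Proof.
elim: l => [|l IH] d s c us hs H w ws.
  have w0 v : v \in s -> v = [::] by move=> /hs[_ _] /size0nil.
  have sE : s = [:: [::]].
    case: s us w0 ws {hs H} => [|a [|b s]] //= us w0 _.
      by rewrite (w0 a) ?mem_head.
    have a0 : a = [::] by apply: w0; rewrite mem_head.
    have b0 : b = [::] by apply: w0; rewrite !inE eqxx orbT.
    by rewrite a0 b0 mem_head in us.
  have [_ d0 _] := hs w ws; move: H; rewrite sE big_seq1 -d0 (w0 w ws) deg_nil.
  rewrite /valw big_nil => H; have : c [::] *: (1 : Y) = 0.
    by elim: H => // e v x; rewrite /lower ltn0 andbF.
  by move/eqP; rewrite scaler_eq0 oner_eq0 orbF => /eqP.
have [_ _] := hs w ws; case: w ws => [|g w] // ws _.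
have [/and3P[_ /= /andP[rg _] _] _ _] := hs _ ws.
(* By assumption the sum is itself made of lower words, so its negative is an admissible correction
   and the total is 0. *)
pose y := - \sum_(w <- s) c w *: valw w.
apply: (mu_redD_sum (y := y) IH us hs _ rg _ ws (mem_head _ _)).
  exact: grN.
by rewrite /y subrr !raddf0; exact: Gr0.
Qed.
End Letters.

(** * Leading terms of supercentral elements *)

Lemma subr_add3 (V : zmodType) (a1 b1 c1 a2 b2 c2 : V) :
  a1 + b1 + c1 = a2 + b2 + c2 -> b1 - b2 = (a2 - a1) + (c2 - c1).
Proof.
move=> E; apply/subr0_eq; rewrite !opprD !opprK !addrA [LHS](ACl (4*1*6*3*2*5)) /=.
by rewrite E [LHS](ACl (1*4*(2*5)*(3*6))) /= !subrr !addr0.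
Qed.

Local Arguments baseR : simpl never.

Section Central.
Variables (K : fieldType) (n : nat) (D : yalg K n).
Local Notation Y := (ycar D).
Local Notation idx := (idx n.+1).
Local Notation letter := (letter n.+1).
Local Notation T := (@yg K n D).
Local Notation M := (smx n Y).
Local Notation C := (ser M).

Implicit Types (x : Y) (p q r i j : idx).

(** Supercentrality without splitting x into homogeneous parts, by [scentral_supercomm]: the
    automorphism carries the sign. *)
Definition scentral (x : Y) : Prop := forall b y, yhomog b y -> x * y = y * theta b x.

Lemma supercomm_theta b (x y : Y) : yhomog b y ->
  supercomm (@ypr K n D) x y = x * y - y * theta b x.
Proof.
move=> hy; have xE : x * y = ypr false x * y + ypr true x * y by rewrite -mulrDl -ypr_sum.
rewrite supercommE !(yhomog_part _ hy) xE /theta.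
case: b {hy} => /=; rewrite !(mulr0n, mulr1n) !(mulr0, mul0r, oppr0, subr0, addr0, add0r).
  by rewrite sgT mulN1r mulrBr opprB !addrA [LHS](ACl (3*1*2*4)).
by rewrite sgF mul1r mulrDr opprD !addrA [LHS](ACl (3*1*4*2)).
Qed.

Lemma scentral_supercomm x : scentral x <-> (forall y, supercomm (@ypr K n D) x y = 0).
Proof.
split=> [h y|h b y hy]; last by apply/subr0_eq; rewrite -(supercomm_theta x hy).
have hp d : yhomog d (ypr d y) by rewrite /yhomog yprK eqxx.
have sD z t : supercomm (@ypr K n D) x (z + t) =
    supercomm (@ypr K n D) x z + supercomm (@ypr K n D) x t.
  rewrite /supercomm -big_split; apply: eq_bigr => a _ /=; rewrite -big_split.
  apply: eq_bigr => b _ /=; rewrite !raddfD /= mulrDr mulrDl mulrDr opprD.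
  by rewrite addrACA.
by rewrite (ypr_sum y) sD !(supercomm_theta x (hp _)) !(h _ _ (hp _)) !subrr addr0.
Qed.

(** The parity automorphism of the graded tensor product, with which the coaction commutes. *)
Definition thetaC (F : C) : C := fun k p q => sg Y (par p q) * theta true (F k p q).

Fact thetaC_additive : additive thetaC.
Proof.
move=> F G; apply/funext => k; apply/smxP => p q.
by rewrite serB smxB /thetaC serB smxB raddfB mulrBr.
Qed.
Fact thetaC_multiplicative : multiplicative thetaC.
Proof.
split=> [F G|]; apply/funext => k; apply/smxP => p q.
  rewrite serM smx_sum /thetaC serM smx_sum rmorph_sum mulr_sumr.
  apply: eq_bigr => a _; rewrite !smxM rmorph_sum mulr_sumr; apply: eq_bigr => r _.
  rewrite rmorphM sgMM; congr (sg _ _ * _).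
  by rewrite /par; case: (bar p); case: (bar q); case: (bar r).
have E : (1 : C) k p q = ((k == 0%N) && (p == q))%:R.
  by case: k => [|k]; first exact: smx1.
rewrite /thetaC E rmorph_nat; case: (k == 0%N); last by rewrite mulr0.
by case: (p =P q) => [->|_]; rewrite ?mulr0 // /par addbb mul1r.
Qed.
HB.instance Definition _ := GRing.isAdditive.Build C C thetaC thetaC_additive.
HB.instance Definition _ := GRing.isMultiplicative.Build C C thetaC thetaC_multiplicative.

Lemma thetaC_iota x : thetaC (iota x) = iota (theta true x).
Proof.
apply/funext => k; apply/smxP => p q; rewrite /thetaC /iota /=.
case: k => [|k]; last by rewrite raddf0 mulr0.
rewrite /= /iota_mx; case: (p =P q) => [->|_]; last by rewrite raddf0 mulr0.
by rewrite /par addbb sgF mul1r !theta_theta addbC.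
Qed.

Lemma thetaC_base i j m : thetaC (baseR Y i j m) = sg C (par i j) * baseR Y i j m.
Proof.
apply/funext => k; apply/smxP => p q; rewrite ser_sg smx_sg /thetaC.
pose P (a : Y) := sg Y (par p q) * theta true a = sg Y (par i j) * a.
have PD a b : P a -> P b -> P (a + b).
  by move=> ha hb; rewrite /P raddfD /= [LHS]mulrDr ha hb -mulrDr.
have PN a : P a -> P (- a) by rewrite /P raddfN !mulrN => ->.
have Ps b a : P a -> P (sg Y b * a).
  by case: b; rewrite ?sgT ?sgF ?mulN1r ?mul1r // => /PN.
have PE (b : bool) : (b -> par p q = par i j) -> P b%:R.
  by case: b => [/(_ isT) h|_]; rewrite /P rmorph_nat ?h ?mulr0.
rewrite -/(P _) /baseR; case: m => [|m] /=.
  case: ((k == 0%N) && (i == j)) / andP => [[_ /eqP ij]|_]; last exact: (PE false).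
  rewrite -[(true%:R : M) p q]/((1 : M) p q) smx1; apply: PE => /eqP ->.
  by rewrite ij /par !addbb.
case: ifP => _; last exact: (PE false).
rewrite smxN smx_sg smxD smx_sg; apply/PN/Ps/PD; last apply/Ps; apply: PE.
  by case/andP => /eqP -> /eqP ->; rewrite /par addbC.
by case/andP => /eqP -> /eqP ->; rewrite /par /bar /=; case: (i.2); case: (j.2).
Qed.

Lemma Delta_theta x : Delta D (theta true x) = thetaC (Delta D x).
Proof.
have E i j s : Delta D (theta true (T i j s)) = thetaC (Delta D (T i j s)).
  rewrite (theta_homog _ (yhomogT D i j s)) rmorphM sgm DeltaT /deltaT /cop !ser_sum.
  rewrite rmorph_sum mulr_sumr; apply: eq_bigr => a _ /=.
  rewrite ser_sg rmorphM sgm sgCA; congr (_ * _).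
  rewrite serM rmorph_sum mulr_sumr; apply: eq_bigr => k _ /=.
  rewrite rmorphM /= thetaC_base thetaC_iota (theta_homog _ (yhomogT D i a k)).
  rewrite /iotaT rmorphM sgm sgMM; congr (sg _ _ * _).
  by rewrite /par; case: (bar i); case: (bar j); case: (bar a).
elim/(@yg_span K n D): x => [|c w x IH]; first by rewrite !raddf0.
rewrite (raddfD (@theta K n D true)) /= thetaZ (raddfD (Delta D)) /= DeltaZ IH.
rewrite [in RHS](raddfD (Delta D)) /= (rmorphD thetaC); congr (_ + _).
rewrite /= DeltaZ (rmorphM thetaC); congr (_ * _).
  apply/funext => k; apply/smxP => p q; rewrite -[RHS]/(sg Y (par p q) * theta true (kappa D c k p q)).
  rewrite /kappa; case: k => [|k]; last by rewrite /= !smx0 raddf0 mulr0.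
  rewrite /= /smxC; case: (p =P q) => [->|_]; last by rewrite raddf0 mulr0.
  by rewrite /par addbb sgF mul1r thetaZ rmorph1.
elim: w => [|g w IHw]; first by rewrite big_nil !rmorph1.
by rewrite !big_cons (rmorphM (@theta K n D true)) !(rmorphM (Delta D)) (rmorphM thetaC) /= IHw E.
Qed.

Lemma redD_theta_diag x k p : redD (theta true x) k p p = theta true (redD x k p p).
Proof.
rewrite /redD Delta_theta -thetaC_iota !serB !smxB raddfB /thetaC.
by rewrite /par addbb sgF !mul1r.
Qed.

Lemma iota_base i j m x : iota x * baseR Y i j m = baseR Y i j m * iota (theta (par i j) x).
Proof.
apply/funext => r; rewrite serCM serMC baseR_theta theta_theta addbb thetaF.
by [].
Qed.

Lemma iota_Delta_central x i j s : scentral x ->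
  iota x * Delta D (T i j s) = Delta D (T i j s) * iota (theta (par i j) x).
Proof.
move=> hx; rewrite DeltaT /deltaT /cop !ser_sum mulr_sumr mulr_suml.
apply: eq_bigr => a _; rewrite ser_sg sgMl sgCA; congr (_ * _).
rewrite serM mulr_sumr mulr_suml; apply: eq_bigr => k _.
rewrite /iotaT mulrA -rmorphM (hx _ _ (yhomogT D i a k)) rmorphM -!mulrA iota_base.
rewrite theta_theta; congr (_ * (_ * iota (theta _ x))).
by rewrite /par; case: (bar i); case: (bar j); case: (bar a).
Qed.

(** Both parts of [redD x] supercommute with the image of T_ij^(s): [Delta D x] because the coaction
    is multiplicative, and x (x) 1 because x supercommutes with the first tensor factor and, in the
    graded sense, with every rho(T_ab). *)
Lemma redD_central x i j s : scentral x ->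
  redD x * Delta D (T i j s) = Delta D (T i j s) * redD (theta (par i j) x).
Proof.
move=> hx; rewrite mulrBl mulrBr iota_Delta_central //; congr (_ - _).
by rewrite -!rmorphM (hx _ _ (yhomogT D i j s)).
Qed.

(* For s > d the coefficient of z^(s + k) in redD x vanishes, so that at this coefficient
   redD_central involves, up to lower terms, only the leading part of T_ij^(s+1). *)
Lemma central_coef x d l i j k s p : gr 0 d l.+2 x -> scentral x -> (d < s)%N ->
  gr k d l (\sum_(r : idx) redD x k p r * baseR Y i j s.+1 s r i
     - \sum_(r : idx) baseR Y i j s.+1 s p r * redD (theta (par i j) x) k r i).
Proof.
move=> gx hx ds; pose F := redD x; pose F' := redD (theta (par i j) x).
have gF : grC d l.+1 F by apply: grC_redD.
have gF' : grC d l.+1 F' by apply/grC_redD/gr_theta.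
have E : F * (iota (T i j s.+1) + baseR Y i j s.+1 + deltaR D i j s) =
   (iota (T i j s.+1) + baseR Y i j s.+1 + deltaR D i j s) * F'.
  by rewrite -DeltaTE redD_central.
have {}E : F * baseR Y i j s.+1 - baseR Y i j s.+1 * F' =
    (iota (T i j s.+1) * F' - F * iota (T i j s.+1))
    + (deltaR D i j s * F' - F * deltaR D i j s).
  by apply: subr_add3; rewrite -!mulrDr -!mulrDl.
have base_s (r : nat) : r != s -> baseR Y i j s.+1 r = 0.
  by move=> /negPf rs; rewrite /baseR rs.
have sks : (s < (s + k).+1)%N by rewrite ltnS leq_addr.
have := congr1 (fun G : C => G (s + k)%N p i) E.
rewrite !serB !smxB serD smxD !serB !smxB.
have -> : (F * baseR Y i j s.+1) (s + k)%N p i = \sum_r F k p r * baseR Y i j s.+1 s r i.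
  have ks : (k < (s + k).+1)%N by rewrite ltnS leq_addl.
  rewrite serM (bigD1 (Ordinal ks)) //= addnK big1 ?addr0 // => a ak.
  rewrite base_s ?mulr0 //; apply: contra ak => /eqP e; apply/eqP/val_inj => /=.
  by have := ltn_ord a; lia.
have -> : (baseR Y i j s.+1 * F') (s + k)%N p i = \sum_r baseR Y i j s.+1 s p r * F' k r i.
  rewrite serM (bigD1 (Ordinal sks)) //= addKn big1 ?addr0 // => a ak.
  by rewrite base_s ?mul0r //; apply: contra ak => /eqP e; apply/eqP/val_inj.
have z (G : C) r q : grC d l.+1 G -> G (s + k)%N r q = 0.
  by move=> gG; apply: gr_empty (gG _ _ _); lia.
rewrite iotaCM iotaCMr (z _ _ _ gF) (z _ _ _ gF') mulr0 mul0r subrr add0r => ->.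
apply/(gr_shift s); apply: grB.
  exact: (grCMr (@grC_deltaR K n D i j s) gF').
by have := grCM gF (@grC_deltaR K n D i j s) (s + k)%N p i; rewrite addn0 (addnC d).
Qed.

Hypothesis char2 : 2 != 0 :> K.

Lemma gr_half k d l (x : Y) : gr k d l (x + x) -> gr k d l x.
Proof.
move=> h; have -> : x = 2^-1 *: (x + x) by rewrite -mulr2n -scaler_nat scalerA mulVf // scale1r.
exact: grZ.
Qed.

(** Supercommuting with E_ji + (-1)^s E_(-j,-i) for both parities of s amounts to supercommuting
    with E_ji, so modulo lower terms off-diagonal entries vanish and diagonal ones agree up to
    parity. *)
Lemma central_entry x d l i j k p : gr 0 d l.+2 x -> scentral x -> bar i = false ->
  gr k d l (redD x k p j - if p == j then redD (theta (par i j) x) k i i else 0).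
Proof.
move=> gx hx bi; pose F := redD x; pose F' := redD (theta (par i j) x).
pose A := F k p j - (if p == j then F' k i i else 0).
pose B := if p == negi j then F' k (negi i) i else 0.
have H s : (d < s)%N -> gr k d l (- A + sg Y (odd s) * B).
  move=> /(central_coef i j k p gx hx); rewrite -/F -/F'; congr gr.
  have bE (r q : idx) : baseR Y i j s.+1 s r q =
     - (((r == j) && (q == i))%:R + sg Y (odd s) * ((r == negi j) && (q == negi i))%:R).
    by rewrite /baseR eqxx bi sgF mul1r smxN smxD smx_sg.
  have ini : (i == negi i) = false by case: (i) => a []; rewrite xpair_eqE andbF.
  rewrite (bigD1 j) //= big1 ?addr0 => [|r /negPf rj]; last first.
    by rewrite bE rj ini andbF mulr0 addr0 oppr0 mulr0.
  rewrite bE !eqxx ini andbF mulr0 addr0 mulrN mulr1.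
  rewrite (bigD1 i) //= (bigD1 (negi i)) /=; last by rewrite eq_sym ini.
  rewrite big1 ?addr0 => [|r /andP[/negPf ri /negPf rni]]; last first.
    by rewrite bE ri rni !andbF mulr0 addr0 oppr0 mul0r.
  rewrite !bE !eqxx [negi i == i]eq_sym ini !andbT !andbF mulr0 addr0 add0r.
  have sb (b : bool) (c : Y) : b%:R * c = if b then c else 0.
    by case: b; rewrite ?mul1r ?mul0r.
  rewrite !mulNr -mulrA !sb /A /B.
  move: (if _ then F' k i i else _) (F k p j) => b a.
  by rewrite opprD !opprK opprB addrA [- _ + _]addrC.
(* The two smallest values of s above d have opposite parities: adding them cancels B and doubles
   A. *)
have := grD (H d.+1 (ltnSn d)) (H d.+2 (ltnW (ltnSn d.+1))).
have e : sg Y (odd d.+1) + sg Y (odd d.+2) = 0 by rewrite /= !sgN opprK addNr.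
by rewrite addrACA -mulrDl e mul0r addr0 => /gr_half/grN; rewrite opprK.
Qed.

(** For g not special, [mu g] is an off-diagonal entry or a difference of diagonal ones, and these
    are the combinations that [central_entry] makes lower. *)
Lemma mu_central x d l g : gr 0 d l.+2 x -> scentral x -> reduced g -> ~~ special g ->
  gr g.2 d l (mu g (redD x)).
Proof.
case: g => [[i j] s] gx hx; rewrite /reduced => /negbTE /= bi nsp.
have H p b := central_entry b s p gx hx bi.
have H' p b := central_entry (i := i0 n) b s p gx hx (erefl _).
rewrite /mu; have [ij|ij] /= := eqVneq i j; last first.
  have := H j i; rewrite eq_sym (negPf ij) subr0; exact.
case: ifP => os.
  have := H (negi i) (negi i); rewrite eqxx.
  have -> : par i (negi i) = true by move: bi; rewrite /par /bar /= => ->.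
  rewrite redD_theta_diag => /(gr_theta true); rewrite raddfB /= thetaK => /grN.
  by rewrite opprB; exact.
have := H' i i; rewrite eqxx.
have -> : par (i0 n) i = false by rewrite /par bi.
by rewrite thetaF; case: ifP => [/eqP ii0|_]; [move: nsp; rewrite /special -ij ii0 eqxx os|].
Qed.
End Central.

(** * Ordered monomials span *)

Section Commutators.
Variables (K : fieldType) (n : nat) (D : yalg K n).
Local Notation Y := (ycar D).
Local Notation idx := (idx n.+1).
Local Notation T := (@yg K n D).
Implicit Types (i j k l : idx) (p q : nat).

Definition scomm i j k l p q : Y :=
  T i j p * T k l q - sg Y (par i j && par k l) * (T k l q * T i j p).

Let C i j k l p q : Y := sg Y (sgn3 i k l) * scomm i j k l p q.
Let P i j k l p q : Y := T k j p * T i l q - T k j q * T i l p.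
Let Q i j k l p q : Y := sg Y (par k l)
    * (T (negi k) j p * T (negi i) l q - T k (negi j) q * T i (negi l) p).

Lemma serz_neg (f : ser Y) p : serz f (- p%:Z) = f p.
Proof. by rewrite /serz oppr_le0 lez_nat leq0n abszN. Qed.
Lemma serz_pos (f : ser Y) : serz f 1 = 0. Proof. by []. Qed.

Lemma T_rel i j k l p q : C i j k l p.+2 q - C i j k l p q.+2
  - ((P i j k l p.+1 q + P i j k l p q.+1) - (Q i j k l p.+1 q - Q i j k l p q.+1)) = 0.
Proof.
have /quadrel_eq0/(_ i j k l (- p%:Z) (- q%:Z)) := @yg_rtt K n D.
have h1 (a : nat) : - a%:Z - 1 = - a.+1%:Z by lia.
by rewrite /quadrel !h1 !serz_neg.
Qed.

(** The coefficient at u^1 v^-q, where every term involving v^2 or v is absent; it starts a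
    recursion with step 2 in the superscript. *)
Lemma T_rel1 i j k l q : C i j k l 1 q - (P i j k l 0 q - Q i j k l 0 q) = 0.
Proof.
have /quadrel_eq0/(_ i j k l 1 (- q%:Z)) := @yg_rtt K n D.
have h1 (a : nat) : - a%:Z - 1 = - a.+1%:Z by lia.
have h2 : 1 - 1 = - 0%:Z :> int by [].
rewrite /quadrel !h2 !h1 !serz_neg !serz_pos !mul0r !mulr0 !subr0 !mulr0 !subr0 !addr0.
by [].
Qed.

Lemma scomm0 i j k l q : scomm i j k l 0 q = 0.
Proof.
rewrite /scomm yg0; case: eqP => [->|_]; last by rewrite mul0r mulr0 mulr0 subrr.
by rewrite /par addbb mul1r mulr1 sgF mul1r subrr.
Qed.

(* The Lie bracket of the associated graded algebra, with value in T^(r). *)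
Definition bracket i j k l (p r : nat) : Y :=
  (k == j)%:R * T i l r - (i == l)%:R * T k j r
  + sg Y (odd p) * (sg Y (par k l)
     * ((negi k == j)%:R * T (negi i) l r - (i == negi l)%:R * T k (negi j) r)).

Lemma P0 i j k l p r : P i j k l 0 r - sg Y (odd p) * - Q i j k l 0 r = bracket i j k l p r.
Proof.
rewrite /P /Q /bracket !yg0 mulrN opprK.
have c (b : bool) (x : Y) : x * b%:R = b%:R * x by rewrite mulr_natr mulr_natl.
by rewrite !c.
Qed.

Lemma gr_TT i j k l p q : gr 0 (p + q).+1 0 (T i j p.+1 * T k l q.+1).
Proof.
apply: (@gr_lt _ _ _ _ (p + q) (1 + 2)) => //; rewrite -[X in gr X]addn0.
by apply: grM; rewrite -[X in gr 0 X]addn0; apply: gr_T.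
Qed.
Lemma gr_P i j k l p q : gr 0 (p + q).+1 0 (P i j k l p.+1 q.+1).
Proof. by apply: grB; [exact: gr_TT|rewrite addnC; exact: gr_TT]. Qed.
Lemma gr_Q i j k l p q : gr 0 (p + q).+1 0 (Q i j k l p.+1 q.+1).
Proof. by apply/gr_sg/grB; [exact: gr_TT|rewrite addnC; exact: gr_TT]. Qed.

(** The relation trades two units of superscript between the factors, keeping p + q and the parity
    of p, at the cost of products whose degree is smaller. At superscripts 1 and 2 the products
    containing a T^(0) are linear and form the bracket. *)
Lemma scomm_lead i j k l p q :
  gr 0 (p + q) 0 (sg Y (sgn3 i k l) * scomm i j k l p.+1 q.+1
                  - bracket i j k l p.+1 (p + q).+1).
Proof.
elim/ltn_ind: p q => -[|[|p]] IH q.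
- have /subr0_eq := T_rel1 i j k l q.+1; rewrite /C => ->.
  by rewrite -P0 sgT mulN1r opprK subrr; exact: Gr0.
- have := T_rel i j k l 0 q.+1; rewrite {2}/C scomm0 mulr0 subr0 => /subr0_eq.
  rewrite /C => ->; rewrite -P0 sgF mul1r opprK.
  set a := P _ _ _ _ 1 _; set b := P _ _ _ _ 0 _; set c := Q _ _ _ _ 1 _; set d := Q _ _ _ _ 0 _.
  have -> : a + b - (c - d) - (b + d) = a - c.
    clearbody a b c d; rewrite !(opprB, opprD) !addrA.
    by rewrite [LHS](ACl (1*4*(2*5)*(3*6))) /= subrr addr0 subrr addr0.
  apply: grB; [exact: (gr_P i j k l 0 q)|exact: (gr_Q i j k l 0 q)].
have := T_rel i j k l p.+1 q.+1; rewrite /C.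
set x := _ * scomm _ _ _ _ p.+3 _; set y := _ * scomm _ _ _ _ _ q.+3.
set a := P _ _ _ _ _ _; set b := P _ _ _ _ _ _; set c := Q _ _ _ _ _ _; set d := Q _ _ _ _ _ _.
move/subr0_eq => E.
have -> : x - bracket i j k l p.+3 (p.+2 + q).+1 =
    (y - bracket i j k l p.+1 (p + q.+2).+1) + ((a + b) - (c - d)).
  rewrite -E [RHS]addrC [RHS]addrA subrK; congr (x - _).
  by rewrite /bracket !addSn !addnS /= negbK.
have e : (p.+2 + q = p + q.+2)%N by lia.
apply: grD; first by rewrite e; exact: (IH p (ltnW (ltnSn _)) q.+2).
apply: grB; first apply: grD; last apply: grB.
- exact: (gr_P i j k l p.+1 q).
- by rewrite (_ : (p.+2 + q = (p + q.+1).+1)%N); [exact: (gr_P i j k l p q.+1)|lia].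
- exact: (gr_Q i j k l p.+1 q).
- by rewrite (_ : (p.+2 + q = (p + q.+1).+1)%N); [exact: (gr_Q i j k l p q.+1)|lia].
Qed.

Lemma gr_bracket i j k l p r : gr 0 r 2 (bracket i j k l p r.+1).
Proof.
have h (b : bool) a c : gr 0 r 2 (b%:R * T a c r.+1).
  case: b; last by rewrite mul0r; exact: Gr0.
  by rewrite mul1r -[X in gr 0 X]addn0; exact: gr_T.
apply: grD; first by apply: grB.
by apply/gr_sg/gr_sg/grB.
Qed.

Lemma gr_scomm i j k l p q : gr 0 (p + q) 2 (scomm i j k l p.+1 q.+1).
Proof.
rewrite -(sgK (sgn3 i k l) (scomm _ _ _ _ _ _)); apply: gr_sg.
rewrite -(subrK (bracket i j k l p.+1 (p + q).+1) (_ * scomm _ _ _ _ _ _)).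
by apply: grD; [apply: gr_le (scomm_lead _ _ _ _ _ _)|exact: gr_bracket].
Qed.
End Commutators.

(** * Reordering words and expanding in PBW monomials *)

Section Spanning.
Variables (K : fieldType) (n : nat) (D : yalg K n).
Local Notation Y := (ycar D).
Local Notation idx := (idx n.+1).
Local Notation letter := (letter n.+1).
Local Notation T := (@yg K n D).
Implicit Types (g h : letter) (u v w : seq letter) (x y z : Y).

Hypothesis charK : forall m, m.+1%:R != 0 :> K.
Variables (Zf : nat -> Y) (cz : nat -> K).
Hypothesis cz_neq0 : forall k, cz k != 0.
Hypothesis Zf_even : forall k, yhomog false (Zf k).
Hypothesis Zf_lead : forall k, gr (D := D) 0 k.*2 0
  (Zf k - cz k *: \sum_(i < n.+1) T (i, false) (i, false) k.*2.+1).
Hypothesis Zf_central : forall k y, Zf k * y = y * Zf k.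
Local Notation leL := (@leL n).
Local Notation reduced := (@reduced n).
Local Notation special := (@special n).
Local Notation adm := (@adm n).
Local Notation leL_trans := (@leL_trans n).
Local Notation leL_total := (@leL_total n).
Local Notation leL_anti := (@leL_anti n).
Local Notation val := (val Zf).
Local Notation valw := (valw Zf).

(** Supercommutators keep the degree but have length one modulo smaller degree; those with a special
    letter vanish outright. *)
Lemma gr_comm_val g h : gr 0 (g.2 + h.2) 2
  (val g * val h - sg Y (gpar g && gpar h) * (val h * val g)).
Proof.
rewrite /val; case: ifP => [/andP[/eqP sp _]|_].
  by rewrite /gpar sp /= sgF mul1r Zf_central subrr; exact: Gr0.
case: ifP => [/andP[/eqP sp _]|_]; last exact: gr_scomm.
by rewrite /gpar sp /= andbF sgF mul1r Zf_central subrr; exact: Gr0.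
Qed.

Lemma gr_val_swap g h v : gr 0 (deg (g :: h :: v)) (size v).+2
  (valw (g :: h :: v) - sg Y (gpar g && gpar h) * (val h * (val g * valw v))).
Proof.
rewrite !valw_cons !deg_cons addnA -(add2n (size v)) !mulrA -!mulrA mulrA [val h * (_ * _)]mulrA mulrA -mulrBl.
rewrite -[X in gr X]addn0; apply: grMr; first exact: gr_comm_val.
exact: (gr_valw Zf_lead).
Qed.

Lemma gr_val_mul g d l x : gr 0 d l x -> gr 0 (g.2 + d) l.+1 (val g * x).
Proof. by move=> h; rewrite -[X in gr X]addn0 -(add1n l); apply: grM h; exact: (gr_val Zf_lead). Qed.

Lemma deg_perm v w : perm_eq v w -> deg v = deg w.
Proof. exact: perm_big. Qed.

Lemma val_insert g v : sorted leL v -> exists b w,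
  [/\ sorted leL w, perm_eq w (g :: v) &
   gr 0 (deg (g :: v)) (size v).+1 (valw (g :: v) - sg Y b * valw w)].
Proof.
elim: v => [_|h v IH] /=.
  exists false, [:: g]; split=> //.
  by rewrite sgF mul1r subrr; exact: Gr0.
move=> hv; case: (boolP (leL g h)) => gh.
  exists false, (g :: h :: v); rewrite /= gh; split=> //.
  by rewrite sgF mul1r subrr; exact: Gr0.
have hg : leL h g by have := leL_total g h; rewrite (negPf gh).
have [b [w [sw pw H]]] := IH (path_sorted hv).
exists ((gpar g && gpar h) (+) b), (h :: w); split.
- rewrite /= path_min_sorted // (perm_all _ pw) /= hg /=.
  exact: order_path_min leL_trans hv.
- apply: (@perm_trans _ (h :: g :: v)); first by rewrite perm_cons.
  exact: (permEl (perm_catCA [:: h] [:: g] v)).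
have E := gr_val_swap g h v; set c := gpar g && gpar h in E *.
have {}H := gr_val_mul h H.
have d1 : (h.2 + deg (g :: v) = deg (g :: h :: v))%N by rewrite !deg_cons; lia.
rewrite d1 in H; have := grD E (gr_sg c H); congr (gr _ _ _ _).
rewrite !valw_cons mulrBr mulrBr addrA subrK; congr (_ - _).
by rewrite [val h * (sg _ _ * _)]sgCA sgsg.
Qed.

Lemma val_sort w : exists b v, [/\ sorted leL v, perm_eq v w &
  gr 0 (deg w) (size w) (valw w - sg Y b * valw v)].
Proof.
elim: w => [|g w [b [v [sv pv H]]]].
  by exists false, [::]; split=> //; rewrite sgF mul1r subrr; exact: Gr0.
have [c [u [su pu E]]] := val_insert g sv.
exists (b (+) c), u; split=> //; first by apply: perm_trans pu _; rewrite perm_cons.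
have {}H := gr_val_mul g H; rewrite -deg_cons in H.
rewrite deg_cons (deg_perm pv) -deg_cons (perm_size pv) in E.
have := grD H (gr_sg b E); congr (gr _ _ _ _).
by rewrite !valw_cons !mulrBr sgCA addrA subrK sgsg.
Qed.

(** The square of an odd generator is half its supercommutator with itself, hence lower. *)
Lemma val_odd_square u g v : gpar g ->
  gr 0 (deg (u ++ g :: g :: v)) (size (u ++ g :: g :: v)) (valw (u ++ g :: g :: v)).
Proof.
move=> pg; elim: u => [|h u IH]; last first.
  by rewrite /= valw_cons deg_cons; exact: gr_val_mul.
have := gr_val_swap g g v; rewrite pg sgT mulN1r opprK -!valw_cons.
by apply: gr_half; exact: (charK 1).
Qed.

Lemma sorted_not_adm w : sorted leL w -> all reduced w -> ~~ adm w ->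
  exists u g v, gpar g /\ w = u ++ g :: g :: v.
Proof.
move=> sw rw; rewrite /adm sw rw /= => /allPn[g gw]; rewrite negb_imply => /andP[pg].
rewrite -ltnNge => cg; case/splitPr: gw sw cg {rw} => u v sw.
elim: u sw => [|h u IH] /=.
  case: v => [|k v] /=; first by rewrite eqxx.
  rewrite eqxx => /andP[gk kv] cg; exists [::], g, v; split=> //=; congr (_ :: _ :: _).
  apply: leL_anti; rewrite gk andbT.
  have gkv : g \in k :: v by rewrite -has_pred1 has_count.
  move: gkv; rewrite inE => /orP[/eqP <-|gv]; first by rewrite /leL leqnn.
  exact: (allP (order_path_min leL_trans kv)).
move=> hs cg; case: (eqVneq h g) => [hg|hg]; last first.
  have [||u' [k [v' [pk ->]]]] := IH; first exact: path_sorted hs.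
    by move: cg; rewrite (negPf hg).
  by exists (h :: u'), k, v'.
rewrite hg in hs *.
case: u hs {IH cg} => [|k u] /= /andP[gk ku].
  by exists [::], g, v.
exists [::], g, (u ++ g :: v); split=> //=; congr (_ :: _ :: _).
apply: leL_anti; rewrite gk andbT.
by apply: (allP (order_path_min leL_trans ku)); rewrite mem_cat mem_head orbT.
Qed.

(** A halfway stage between words in the T_ij^(s) and ordered monomials: modulo lower words, all
    letters are reduced and T_11^(2k+1) is already replaced by Z^(2k+2), but nothing is sorted. *)
Inductive vspan (d l : nat) : Y -> Prop :=
| VS0 x of gr 0 d l x : vspan d l x
| VSD c w x of all reduced w & deg w = d & size w = l & vspan d l x :
    vspan d l (c *: valw w + x).

Lemma vspanD d l x y : vspan d l x -> vspan d l y -> vspan d l (x + y).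
Proof.
elim=> [z hz|c w z rw dw sw _ IH] hy; last by rewrite -addrA; apply: VSD => //; exact: IH.
elim: hy => [t ht|c w t rw dw sw _ IH]; first by apply/VS0/grD.
by rewrite addrCA; apply: VSD.
Qed.
Lemma vspanZ d l c x : vspan d l x -> vspan d l (c *: x).
Proof.
elim=> [z hz|e w z rw dw sw _ IH]; first by apply/VS0/grZ.
by rewrite scalerDr scalerA; apply: VSD.
Qed.
Lemma vspan_valw w : all reduced w -> vspan (deg w) (size w) (valw w).
Proof.
move=> rw; rewrite -[valw w]addr0 -[valw w]scale1r.
by apply: VSD => //; apply: VS0; exact: Gr0.
Qed.
Lemma vspan_sum d l I (r : seq I) (P : pred I) (f : I -> Y) :
  (forall i, P i -> vspan d l (f i)) -> vspan d l (\sum_(i <- r | P i) f i).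
Proof. by move=> h; elim/big_ind: _ => //; [apply: VS0; exact: Gr0|exact: vspanD]. Qed.

Lemma vspanM s d l x y : vspan s 1 x -> vspan d l y -> vspan (s + d) l.+1 (x * y).
Proof.
have gv d' l' y' : vspan d' l' y' -> gr 0 d' l'.+1 y'.
  elim=> [z hz|c w z rw dw sw _ IH]; first exact: gr_le hz.
  by apply: grD IH; apply: grZ; rewrite -dw; apply: (gr_valw Zf_lead); rewrite sw.
elim=> [z hz|c w z rw dw sw _ IH] hy.
  apply: VS0; rewrite -[X in gr X]addn0 -(add1n l); apply: grMr => //; exact: gv.
rewrite mulrDl; apply: vspanD (IH hy); rewrite -scalerAl; apply: vspanZ.
elim: hy => [t ht|e v t rv dv sv _ IHt].
  apply: VS0; rewrite -[X in gr X]addn0 -(add1n l); apply: grM ht.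
  by rewrite -dw; apply: (gr_valw Zf_lead); rewrite sw.
rewrite mulrDr; apply: vspanD IHt; rewrite -scalerAr; apply: vspanZ.
rewrite /valw -big_cat /= -/(valw _) -dw -dv -deg_cat.
have -> : l.+1 = size (w ++ v) by rewrite size_cat sw sv.
by apply: vspan_valw; rewrite all_cat rw rv.
Qed.

Lemma vspan_tletter g : vspan g.2 1 (tletter D g).
Proof.
have H h : reduced h -> vspan h.2 1 (tletter D h).
  have nsp h' : reduced h' -> ~~ special h' -> vspan h'.2 1 (tletter D h').
    move=> rh sp; have := @vspan_valw [:: h']; rewrite /= rh deg_cons deg_nil addn0.
    by rewrite valw_cons /valw big_nil mulr1 /val (negPf sp); exact.
  move=> rh; case: (boolP (special h)) => [sp|]; last exact: nsp.
  have hk := half_special sp; set k := h.2./2 in hk.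
  have [/eqP h1 _] := andP sp.
  pose S := \sum_(i < n.+1 | i != ord0) T (i, false) (i, false) k.*2.+1.
  pose L := Zf k - cz k *: \sum_(i < n.+1) T (i, false) (i, false) k.*2.+1.
  (* [Zf_lead] solved for T_11^(2k+1), with S the remaining diagonal generators and L the lower
     terms. *)
  have -> : tletter D h = (cz k)^-1 *: (Zf k - L) - S.
    have -> : Zf k - L = cz k *: \sum_(i < n.+1) T (i, false) (i, false) k.*2.+1.
      by rewrite /L opprB addrCA subrr addr0.
    rewrite scalerA mulVf // scale1r.
    by rewrite (bigD1 ord0) //= addrK /tletter h1 hk.
  apply: vspanD; last first.
    rewrite -scaleN1r; apply/vspanZ/vspan_sum => i /negPf i0.
    have := nsp (((i, false), (i, false)), k.*2) isT; rewrite /special /= xpair_eqE.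
    by rewrite xpair_eqE i0 /= hk; exact.
  apply/vspanZ/vspanD; last by apply: VS0; rewrite -hk; exact/grN/gr_le/Zf_lead.
  have := @vspan_valw [:: h]; rewrite /= rh deg_cons deg_nil addn0.
  by rewrite valw_cons /valw big_nil mulr1 /val sp; exact.
case: g => [[i j] s]; case: (boolP (reduced (i, j, s))) => [|ri]; first exact: H.
have -> : tletter D (i, j, s) = (-1) ^+ s.+1 *: tletter D (negi i, negi j, s).
  rewrite /tletter /= -ygN sgnat; case: (odd s.+1); rewrite ?sgF ?scale1r ?mul1r //.
  by rewrite !sgT mulN1r scaleN1r opprK.
apply: vspanZ; apply: (H (negi i, negi j, s)).
by move: ri; rewrite /reduced /bar /= negbK => ->.
Qed.

Lemma vspan_tword w : vspan (deg w) (size w) (tword D w).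
Proof.
elim: w => [|g w IH].
  by rewrite tword_nil -[1](big_nil 1 *%R xpredT val); exact: (@vspan_valw [::]).
by rewrite tword_cons deg_cons; apply: vspanM IH; exact: vspan_tletter.
Qed.

Inductive pbw : Y -> Prop :=
| Pbw0 : pbw 0
| PbwD c w x of adm w & pbw x : pbw (c *: valw w + x).

Lemma pbwD x y : pbw x -> pbw y -> pbw (x + y).
Proof.
by move=> hx hy; elim: hx => [|c w z aw _ IH]; rewrite ?add0r // -addrA; apply: PbwD.
Qed.
Lemma pbwZ c x : pbw x -> pbw (c *: x).
Proof.
elim=> [|e w z aw _ IH]; first by rewrite scaler0; exact: Pbw0.
by rewrite scalerDr scalerA; exact: PbwD.
Qed.

Lemma pbw_vspan d l x : (forall y, gr 0 d l y -> pbw y) -> vspan d l x -> pbw x.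
Proof.
move=> H; elim=> [y /H //|c w y rw dw sw _ IH]; apply: pbwD IH; apply: pbwZ.
have [b [v [sv pv E]]] := val_sort w.
rewrite -[valw w](subrK (sg Y b * valw v)); apply: pbwD.
  by apply: H; rewrite -dw -sw.
have -> : sg Y b * valw v = (-1) ^+ b *: valw v.
  by case: b {E}; rewrite ?sgT ?sgF ?mulN1r ?mul1r /= ?scale1r // scaleN1r.
apply: pbwZ; case: (boolP (adm v)) => [av|nav].
  by rewrite -[valw v]addr0 -[valw v]scale1r; apply: PbwD av Pbw0.
have rv : all reduced v by rewrite (perm_all _ pv).
have [u [g [t [pg ev]]]] := sorted_not_adm sv rv nav.
apply: H; rewrite -dw -sw -(deg_perm pv) -(perm_size pv) ev.
exact: val_odd_square.
Qed.

(** A word of smaller degree may be arbitrarily long, so the outer induction on d must cover every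
    l; the inner one on l handles the words of degree d. *)
Lemma pbw_gr d l x : gr 0 d l x -> pbw x.
Proof.
elim/ltn_ind: d l x => d IHd; elim=> [|l IHl] x.
  elim=> [|c w y lw _ IH]; first exact: Pbw0.
  apply: pbwD IH; apply: pbwZ; move: lw; rewrite /lower addn0 ltn0 andbF orbF => lw.
  by apply: (IHd _ lw (size w).+1); apply: gr_word; rewrite /lower addn0 eqxx ltnSn orbT.
elim=> [|c w y lw _ IH]; first exact: Pbw0.
apply: pbwD IH; apply: pbwZ; move: lw; rewrite /lower addn0 => lw.
have [lw'|nlw] := boolP (lower 0 d l w); first by apply/IHl/gr_word.
have [dw sw] : deg w = d /\ size w = l.
  by move: lw nlw; rewrite /lower addn0; lia.
by apply: (pbw_vspan IHl); rewrite -dw -sw; exact: vspan_tword.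
Qed.

Lemma pbw_all x : pbw x.
Proof.
elim/(@yg_span K n D): x => [|c w x IH]; first exact: Pbw0.
apply: pbwD IH; apply: pbwZ; apply: (@pbw_gr (deg w) (size w).+1).
by apply: gr_word; rewrite /lower addn0 eqxx ltnSn orbT.
Qed.

Lemma pbw_comb x : exists s (c : seq letter -> K),
  [/\ uniq s, all adm s & x = \sum_(w <- s) c w *: valw w].
Proof.
elim: (pbw_all x) => [|e w y aw _ [s [c [us as_ ->]]]].
  by exists [::], (fun => 0); split=> //; rewrite big_nil.
case: (boolP (w \in s)) => ws.
  exists s, (fun v => c v + (if v == w then e else 0)); split=> //.
  under [RHS]eq_bigr do rewrite scalerDl.
  rewrite big_split /= addrC; congr (_ + _).
  rewrite (bigD1_seq w) //= eqxx big1 ?addr0 // => v /negPf vw.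
  by rewrite vw scale0r.
exists (w :: s), (fun v => if v == w then e else c v); split=> /=.
- by rewrite ws.
- by rewrite aw.
rewrite big_cons eqxx; congr (_ + _); apply: eq_big_seq => v vs.
by case: eqP vs => // ->; rewrite (negPf ws).
Qed.
End Spanning.

(** * Centrality of Z(u) *)

Section SeriesCentral.
Variables (N : nat) (B : nzRingType) (d p q : B).
Local Notation idx := (idx N).
Variables (t s w : idx -> idx -> B) (z : B).
Implicit Types (i j k l a b c : idx).
(* The case of interest is t = T(u), s = T(v), w = T(v)^-1, z = Z(v), with d, p, q the
   coefficients of the quadratic relation. *)
Hypotheses (dC : forall a : B, a * d = d * a) (pC : forall a : B, a * p = p * a)
  (qC : forall a : B, a * q = q * a).
Hypothesis dreg : forall f, d * f = 0 -> f = 0.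
Hypothesis ts_comm : forall i j k l,
  d * (sg B (sgn3 i k l) * (t i j * s k l - sg B (par i j && par k l) * (s k l * t i j)))
  = p * (t k j * s i l - s k j * t i l)
    - q * (sg B (par k l) * (t (negi k) j * s (negi i) l - s k (negi j) * t i (negi l))).
Hypothesis st_comm : forall i j k l,
  d * (sg B (sgn3 i k l) * (s i j * t k l - sg B (par i j && par k l) * (t k l * s i j)))
  = - (p * (s k j * t i l - t k j * s i l))
    - q * (sg B (par k l) * (s (negi k) j * t (negi i) l - t k (negi j) * s i (negi l))).
Hypothesis sw1 : forall k b, \sum_l sg B (par k l && par l b) * (s k l * w l b) = (k == b)%:R.
Hypothesis ws1 : forall a l, \sum_k sg B (par a k && par k l) * (w a k * s k l) = (a == l)%:R.
Hypothesis swz : forall j k, \sum_b s b j * w k b = (j == k)%:R * z.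

(** Entries of T(v)^-1 T(u), and for [tw] of T(u) T(v)^-1; the primed versions insert the index
    change k |-> -k between the factors, as the last terms of the quadratic relation do. *)
Definition wt a j : B := \sum_k sg B (par a k && par k j) * (w a k * t k j).
Definition tw i b : B := \sum_l sg B (par i l && par l b) * (t i l * w l b).
Definition wt' a j : B := \sum_k sg B (par a j && bar k) * (w a k * t (negi k) j).
Definition tw' i b : B := \sum_l sg B (par i b && bar l) * (t i (negi l) * w l b).

Lemma sum_factor (f g : idx -> bool) (u v : idx -> B) :
  \sum_k \sum_l sg B (f k (+) g l) * (u k * v l)
  = (\sum_k sg B (f k) * u k) * (\sum_l sg B (g l) * v l).
Proof.
rewrite mulr_suml; apply: eq_bigr => k _; rewrite mulr_sumr; apply: eq_bigr => l _.
by rewrite sgMM.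
Qed.

Lemma sum_delta a (f : idx -> B) : \sum_k (a == k)%:R * f k = f a.
Proof.
rewrite (bigD1 a) //= eqxx mul1r big1 ?addr0 // => k /negPf ka.
by rewrite eq_sym ka mul0r.
Qed.

Lemma natC (b : bool) (f : B) : f * b%:R = b%:R * f.
Proof. by rewrite mulr_natl mulr_natr. Qed.

Let cA e : (forall f : B, f * e = e * f) -> forall f g : B, f * (e * g) = e * (f * g).
Proof. by move=> h f g; rewrite mulrA h mulrA. Qed.

Lemma pq_shuffle e f (a c X1 X2 Y1 Y2 : B) :
  sg B e * (a * (p * (X1 - X2) - q * (sg B f * (Y1 - Y2))) * c)
  = p * (sg B e * (a * X1 * c) - sg B e * (a * X2 * c))
    - q * (sg B (e (+) f) * (a * Y1 * c) - sg B (e (+) f) * (a * Y2 * c)).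
Proof.
rewrite -!mulrBr -!mulrBl -!mulrBr; move: (X1 - X2) (Y1 - Y2) => X Y.
rewrite [a * (_ - _)]mulrBr (cA pC) (cA qC) [a * (sg _ _ * _)]sgCA.
move: (a * X) (a * Y) => {}X {}Y.
by rewrite mulrBl -!mulrA [sg _ _ * (_ - _)]mulrBr (cA pC) (cA qC) sgsg.
Qed.

(* The relation between t i j and s k l, multiplied by w on both sides. *)
Lemma tw_comm i j a b :
  d * (sg B (bar b && (bar a (+) par i j))
       * (w a b * t i j - sg B (par i j && par a b) * (t i j * w a b)))
  = p * ((i == b)%:R * (sg B (bar b (+) bar a && bar j) * wt a j)
         - (a == j)%:R * (sg B (bar a (+) bar i && bar b) * tw i b))
    + q * ((a == negi j)%:R * (sg B (bar a) * tw' i b)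
           - (negi i == b)%:R * (sg B (bar b) * wt' a j)).
Proof.
pose S k l := (par k l && par l b) (+) (bar k && (bar a (+) bar b (+) par i j (+) true)).
(* The supercommutator of t and s between two factors w. It is evaluated twice: once by cancelling s
   against w, once by the quadratic relation. *)
pose L := \sum_k \sum_l sg B (S k l) * (w a k * (d * (t i j * s k l -
  sg B (par i j && par k l) * (s k l * t i j))) * w l b).
transitivity L; rewrite /L.
  transitivity (d * (\sum_k \sum_l sg B (S k l) * (w a k * t i j * (s k l * w l b))
     - \sum_k \sum_l sg B (S k l (+) (par i j && par k l)) * (w a k * s k l * (t i j * w l b)))).
    congr (d * _); rewrite mulrBr; congr (_ - _).
      transitivity (\sum_k (b == k)%:R *
          (sg B (bar k && (bar a (+) bar b (+) par i j (+) true)) * (w a k * t i j))).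
        rewrite sum_delta; congr (sg _ _ * _).
        by case: (bar b); case: (bar a); case: (par i j).
      apply: eq_bigr => k _.
      transitivity (sg B (bar k && (bar a (+) bar b (+) par i j (+) true)) * (w a k * t i j) *
        \sum_l sg B (par k l && par l b) * (s k l * w l b)).
        by rewrite sw1 natC eq_sym.
      by rewrite mulr_sumr; apply: eq_bigr => l _; rewrite sgMM /S addbC.
    rewrite exchange_big /=.
    transitivity (\sum_l (a == l)%:R *
        (sg B (bar l && (true (+) bar b (+) par i j (+) bar a)) * (t i j * w l b))).
      rewrite sum_delta sgsg; congr (sg _ _ * _); rewrite /par.
      by case: (bar b); case: (bar a); case: (bar i); case: (bar j).
    apply: eq_bigr => l _; rewrite -ws1 mulr_suml; apply: eq_bigr => k _.
    rewrite sgMM; congr (sg _ _ * _); rewrite /S /par.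
    by case: (bar b); case: (bar a); case: (bar i); case: (bar j); case: (bar k); case: (bar l).
  rewrite -sumrB mulr_sumr; apply: eq_bigr => k _; rewrite -sumrB mulr_sumr.
  apply: eq_bigr => l _; rewrite -sgsg -mulrBr (cA dC) -!mulrA sgCA; congr (_ * (_ * _)).
  by rewrite mulrBl mulrBr sgMl sgCA -!mulrA.
(* After the quadratic relation is inserted, the total sign is a function of k plus a function of l,
   so every double sum factors. *)
pose e1 k := bar a && bar k (+) bar k (+) bar j && bar k.
pose g1 l := bar l (+) bar l && bar b (+) bar i && bar l.
pose e2 k := bar a && bar k (+) bar j && bar k.
pose g2 l := bar l && bar b (+) bar i && bar l.
transitivity (p * (\sum_k \sum_l sg B (e1 k (+) g1 l) * (w a k * t k j * (s i l * w l b))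
   - \sum_k \sum_l sg B (e1 k (+) g1 l) * (w a k * s k j * (t i l * w l b)))
  - q * (\sum_k \sum_l sg B (e2 k (+) g2 l) * (w a k * t (negi k) j * (s (negi i) l * w l b))
   - \sum_k \sum_l sg B (e2 k (+) g2 l) * (w a k * s k (negi j) * (t i (negi l) * w l b)))).
  rewrite -!sumrB !mulr_sumr -sumrB; apply: eq_bigr => k _.
  rewrite -!sumrB !mulr_sumr -sumrB; apply: eq_bigr => l _.
  have E : d * (t i j * s k l - sg B (par i j && par k l) * (s k l * t i j)) =
    sg B (sgn3 i k l) * (p * (t k j * s i l - s k j * t i l)
    - q * (sg B (par k l) * (t (negi k) j * s (negi i) l - s k (negi j) * t i (negi l)))).
    by rewrite -ts_comm sgCA sgK.
  rewrite E -!mulrBr [w a k * (sg _ _ * _)]sgCA sgMl sgsg.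
  have -> : S k l (+) sgn3 i k l = e1 k (+) g1 l.
    rewrite /S /e1 /g1 /sgn3 /par.
    by case: (bar b); case: (bar a); case: (bar i); case: (bar j); case: (bar k); case: (bar l).
  have -> : e2 k (+) g2 l = (e1 k (+) g1 l) (+) par k l.
    rewrite /e1 /e2 /g1 /g2 /par.
    by case: (bar b); case: (bar a); case: (bar i); case: (bar j); case: (bar k); case: (bar l).
  by rewrite pq_shuffle !mulrBr -!mulrA.
rewrite !sum_factor.
have EX : \sum_k sg B (e1 k) * (w a k * t k j) = sg B (bar a && bar j) * wt a j.
  rewrite /wt mulr_sumr; apply: eq_bigr => k _; rewrite sgsg; congr (sg _ _ * _).
  by rewrite /e1 /par; case: (bar a); case: (bar j); case: (bar k).
have EY : \sum_l sg B (g1 l) * (t i l * w l b) = sg B (bar i && bar b) * tw i b.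
  rewrite /tw mulr_sumr; apply: eq_bigr => l _; rewrite sgsg; congr (sg _ _ * _).
  by rewrite /g1 /par; case: (bar i); case: (bar b); case: (bar l).
have EX' : \sum_k sg B (e2 k) * (w a k * t (negi k) j) = wt' a j.
  apply: eq_bigr => k _; congr (sg _ _ * _).
  by rewrite /e2 /par; case: (bar a); case: (bar j); case: (bar k).
have EY' : \sum_l sg B (g2 l) * (t i (negi l) * w l b) = tw' i b.
  apply: eq_bigr => l _; congr (sg _ _ * _).
  by rewrite /g2 /par; case: (bar i); case: (bar b); case: (bar l).
have Es1 : \sum_l sg B (g1 l) * (s i l * w l b) = (i == b)%:R * sg B (bar b).
  transitivity (sg B (bar i && bar b) * (i == b)%:R).
    rewrite -sw1 mulr_sumr; apply: eq_bigr => l _; rewrite sgsg; congr (sg _ _ * _).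
    by rewrite /g1 /par; case: (bar i); case: (bar b); case: (bar l).
  by rewrite natC; case: eqP => [->|_]; rewrite ?mul0r // andbb.
have Ew1 : \sum_k sg B (e1 k) * (w a k * s k j) = (a == j)%:R * sg B (bar a).
  transitivity (sg B (bar a && bar j) * (a == j)%:R).
    rewrite -ws1 mulr_sumr; apply: eq_bigr => k _; rewrite sgsg; congr (sg _ _ * _).
    by rewrite /e1 /par; case: (bar a); case: (bar j); case: (bar k).
  by rewrite natC; case: eqP => [->|_]; rewrite ?mul0r // andbb.
have Es2 : \sum_l sg B (g2 l) * (s (negi i) l * w l b) = (negi i == b)%:R * sg B (bar b).
  transitivity (sg B (bar i && bar b (+) bar b) * (negi i == b)%:R).
    rewrite -sw1 mulr_sumr; apply: eq_bigr => l _; rewrite sgsg; congr (sg _ _ * _).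
    rewrite /g2 /par [bar (negi i)]/(~~ bar i).
    by case: (bar i); case: (bar b); case: (bar l).
  rewrite natC; case: eqP => [<-|_]; rewrite ?mul0r // [bar (negi i)]/(~~ bar i).
  by case: (bar i).
have Ew2 : \sum_k sg B (e2 k) * (w a k * s k (negi j)) = (a == negi j)%:R * sg B (bar a).
  transitivity (sg B (bar a && bar j (+) bar a) * (a == negi j)%:R).
    rewrite -ws1 mulr_sumr; apply: eq_bigr => k _; rewrite sgsg; congr (sg _ _ * _).
    rewrite /e2 /par [bar (negi j)]/(~~ bar j).
    by case: (bar a); case: (bar j); case: (bar k).
  rewrite natC; case: eqP => [->|_]; rewrite ?mul0r // [bar (negi j)]/(~~ bar j).
  by case: (bar j).
rewrite EX EY EX' EY' Es1 Ew1 Es2 Ew2 -[- (q * _)]mulrN opprB.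
congr (p * (_ - _) + q * (_ - _)).
- by rewrite mulrA natC -mulrA; congr (_ * _); rewrite sgC sgsg.
- by rewrite -mulrA; congr (_ * _); rewrite sgsg.
- by rewrite mulrA.
- by rewrite mulrA natC -mulrA; congr (_ * _); rewrite sgC.
Qed.

Lemma negi_neq i : (negi i == i) = false.
Proof. by rewrite /negi; case: i => a []; rewrite /= /eq_op /= andbF. Qed.

(** The supertrace of the identity on C^(N|N). Its vanishing removes the unwanted terms of
    [wt_diag], [wt_diag'] and [vsumE]. *)
Lemma sum_bar : \sum_(b : idx) sg B (bar b) = 0.
Proof.
rewrite -(pair_bigA _ (fun (_ : 'I_N) (e : bool) => sg B e)) /= big1 // => i _.
by rewrite big_bool /= sgT sgF addNr.
Qed.

(** The supertrace of T(u) T(v)^-1, then its analogue twisted by b |-> -b. The sums [wsum] and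
    [wsum'] are the diagonal entries [wt l l] and [wt' l l] with t and w in the other order. *)
Definition om : B := \sum_b sg B (bar b) * tw b b.
Definition om' : B := \sum_b tw (negi b) b.
Definition wsum l : B := \sum_b t b l * w l b.
Definition wsum' l : B := \sum_b t (negi b) l * w l b.

Lemma sign_flip e f (U V X : B) : d * (sg B e * (U - sg B f * V)) = X ->
  d * (V - sg B f * U) = - (sg B (e (+) f) * X).
Proof.
move=> <-; rewrite [d * (sg _ _ * _)]sgCA sgsg addbAC addbb addFb.
rewrite -(sgCA f d) -[RHS]mulrN; congr (d * _).
by rewrite mulrBr sgK opprB.
Qed.

Lemma wt_diag l : d * (wsum l - wt l l) = p * om.
Proof.
have E b : d * (t b l * w l b - sg B (par l b && par b l) * (w l b * t b l))
   = p * (sg B (bar b) * tw b b) - p * (sg B (bar b) * wt l l).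
  have := tw_comm b l l b.
  rewrite !eqxx [l == negi l]eq_sym !negi_neq !mul0r !mul1r subr0 mulr0 addr0.
  rewrite [par l b]addbC -/(par b l) => /sign_flip ->.
  rewrite (cA pC) mulrBr !sgsg -mulrN opprB mulrBr.
  congr (p * (sg _ _ * _) - p * (sg _ _ * _)); rewrite /par;
  by case: (bar b); case: (bar l).
rewrite /wsum /wt -sumrB mulr_sumr (eq_bigr _ (fun b _ => E b)) sumrB -!mulr_sumr.
by rewrite -mulr_suml sum_bar mul0r mulr0 subr0.
Qed.

Lemma wt_diag' l : d * (wsum' l - wt' l l) = p * (sg B (bar l) * om').
Proof.
have E b : d * (t (negi b) l * w l b - sg B (par l l && bar b) * (w l b * t (negi b) l))
   = p * (sg B (bar l) * tw (negi b) b) + q * (sg B (bar b) * wt' l l).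
  have := tw_comm (negi b) l l b.
  rewrite !eqxx [l == negi l]eq_sym !negi_neq negiK eqxx !mul0r !mul1r !sub0r.
  have -> : par (negi b) l && par l b = par l l && bar b.
    by rewrite /par [bar (negi b)]/(~~ bar b); case: (bar b); case: (bar l).
  move=> /sign_flip ->.
  rewrite [X in p * X](_ : _ = - (sg B (bar l) * tw (negi b) b)); last first.
    by rewrite [bar (negi b)]/(~~ bar b); case: (bar b); case: (bar l).
  rewrite !mulrN -opprD mulrN opprK.
  have -> : bar b && (bar l (+) par (negi b) l) (+) par l l && bar b = false.
    by rewrite /par [bar (negi b)]/(~~ bar b); case: (bar b); case: (bar l).
  by rewrite sgF mul1r.
rewrite /wsum' /wt' -sumrB mulr_sumr (eq_bigr _ (fun b _ => E b)) big_split /=.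
by rewrite -!mulr_sumr -mulr_suml sum_bar mul0r mulr0 addr0.
Qed.

Definition vsum k l : B := \sum_b s b l * tw k b.

Lemma swz0 j k : j != k -> \sum_b s b j * w k b = 0.
Proof. by move=> /negPf jk; rewrite swz jk mul0r. Qed.

Lemma sum5 (F1 F2 F3 F4 F5 : idx -> idx -> B) :
  \sum_c \sum_b (F1 c b - F2 c b + F3 c b - F4 c b + F5 c b)
  = \sum_c \sum_b F1 c b - \sum_c \sum_b F2 c b + \sum_c \sum_b F3 c b
    - \sum_c \sum_b F4 c b + \sum_c \sum_b F5 c b.
Proof.
rewrite -!sumrB -!big_split -sumrB -big_split /=; apply: eq_bigr => c _.
by rewrite big_split sumrB big_split sumrB.
Qed.

Lemma st_expand b k c l e :
  d * (sg B e * (s b l * (t k c * w c b)))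
  = d * (sg B (e (+) (par b l && par k c)) * (t k c * (s b l * w c b)))
    - p * (sg B (e (+) sgn3 b k c) * (s k l * (t b c * w c b)))
    + p * (sg B (e (+) sgn3 b k c) * (t k l * (s b c * w c b)))
    - q * (sg B (e (+) sgn3 b k c (+) par k c) * (s (negi k) l * (t (negi b) c * w c b)))
    + q * (sg B (e (+) sgn3 b k c (+) par k c) * (t k (negi l) * (s b (negi c) * w c b))).
Proof.
have E : d * (s b l * t k c) = d * (sg B (par b l && par k c) * (t k c * s b l))
   + sg B (sgn3 b k c) * (- (p * (s k l * t b c - t k l * s b c))
    - q * (sg B (par k c) * (s (negi k) l * t (negi b) c - t k (negi l) * s b (negi c)))).
  by rewrite -st_comm (sgCA (sgn3 b k c) d) sgK -mulrDr addrC subrK.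
rewrite (sgCA e d) [s b l * (_ * _)]mulrA [d * (_ * _)]mulrA E mulrDl.
move: (s b l) (s k l) (s b c) (s (negi k) l) (s b (negi c)) => s1 s2 s3 s4 s5.
move: (t k c) (t b c) (t k l) (t (negi b) c) (t k (negi l)) (w c b) => t1 t2 t3 t4 t5 u.
rewrite [LHS]mulrDr -!addrA; congr (_ + _).
  by rewrite -mulrA sgMl (cA dC) sgsg -!mulrA.
rewrite sgMl mulrDl ![in LHS]mulNr !mulrBr !mulrBl !mulrBr !opprB.
move: (sgn3 b k c) (par k c) => f g.
have P X Y : sg B e * (sg B f * (p * (X * Y) * u)) = p * (sg B (e (+) f) * (X * (Y * u))).
  by rewrite sgsg -!mulrA (cA pC).
have Q X Y : sg B e * (sg B f * (q * (sg B g * (X * Y)) * u))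
    = q * (sg B (e (+) f (+) g) * (X * (Y * u))).
  by rewrite sgsg -mulrA sgMl (cA qC) sgsg -!mulrA.
by rewrite !mulrBr !P !Q [RHS]addrA; congr (_ + _); rewrite addrC.
Qed.

(** Moving s past t produces five sums. [S3] vanishes because the supertrace of the identity is
    zero, and [S5] because it contains only off-diagonal sums of [swz]. *)
Lemma vsumE k l : d * vsum k l = d * (t k l * z) - p * (s k l * om)
   - q * (sg B (bar k) * (s (negi k) l * om')).
Proof.
pose e c b := par k c && par c b.
have -> : d * vsum k l = \sum_c \sum_b d * (sg B (e c b) * (s b l * (t k c * w c b))).
  rewrite /vsum mulr_sumr exchange_big /=; apply: eq_bigr => b _.
  by rewrite !mulr_sumr; apply: eq_bigr => c _; rewrite sgCA.
have S1 : \sum_c \sum_b d * (sg B (e c b (+) (par b l && par k c)) * (t k c * (s b l * w c b)))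
    = d * (t k l * z).
  transitivity (d * \sum_c (l == c)%:R * (sg B (par k c && par c l) * (t k c * z))).
    rewrite mulr_sumr; apply: eq_bigr => c _; rewrite -mulr_sumr; congr (d * _).
    rewrite [RHS]sgCA -natC -!mulrA natC -swz !mulr_sumr; apply: eq_bigr => b _.
    by congr (sg _ _ * _); rewrite /e /par; case: (bar k); case: (bar c); case: (bar b); case: (bar l).
  by rewrite sum_delta /par addbb andbF sgF mul1r.
have es b c : e c b (+) sgn3 b k c = bar c.
  by rewrite /e /sgn3 /par; case: (bar k); case: (bar c); case: (bar b).
have S2 : \sum_c \sum_b p * (sg B (bar c) * (s k l * (t b c * w c b))) = p * (s k l * om).
  rewrite exchange_big /om !mulr_sumr /=; apply: eq_bigr => b _.
  rewrite -mulr_sumr; congr (p * _); rewrite /tw !mulr_sumr; apply: eq_bigr => c _.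
  rewrite sgsg [RHS]sgCA; congr (sg _ _ * _).
  by rewrite /par; case: (bar b); case: (bar c).
have S3 : \sum_c \sum_b p * (sg B (bar c) * (t k l * (s b c * w c b))) = 0.
  transitivity (p * \sum_(c : idx) (sg B (bar c) * (t k l * z))).
    rewrite mulr_sumr; apply: eq_bigr => c _; rewrite -!mulr_sumr swz eqxx mul1r.
    by [].
  by rewrite -mulr_suml sum_bar mul0r mulr0.
have S4 : \sum_c \sum_b q * (sg B (bar c (+) par k c) * (s (negi k) l * (t (negi b) c * w c b)))
   = q * (sg B (bar k) * (s (negi k) l * om')).
  rewrite exchange_big /om' !mulr_sumr /=; apply: eq_bigr => b _.
  rewrite -mulr_sumr; congr (q * _); rewrite /tw !mulr_sumr; apply: eq_bigr => c _.
  rewrite [in RHS]sgCA sgsg; congr (sg _ _ * _).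
  by rewrite /par [bar (negi b)]/(~~ bar b); case: (bar k); case: (bar b); case: (bar c).
have S5 : \sum_c \sum_b q * (sg B (bar c (+) par k c) * (t k (negi l) * (s b (negi c) * w c b))) = 0.
  by rewrite big1 // => c _; rewrite -!mulr_sumr swz0 ?mulr0 // negi_neq.
transitivity (\sum_c \sum_b
    (d * (sg B (e c b (+) (par b l && par k c)) * (t k c * (s b l * w c b)))
    - p * (sg B (bar c) * (s k l * (t b c * w c b)))
    + p * (sg B (bar c) * (t k l * (s b c * w c b)))
    - q * (sg B (bar c (+) par k c) * (s (negi k) l * (t (negi b) c * w c b)))
    + q * (sg B (bar c (+) par k c) * (t k (negi l) * (s b (negi c) * w c b))))).
  by apply: eq_bigr => c _; apply: eq_bigr => b _; rewrite st_expand es.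
by rewrite sum5 S1 S2 S3 S4 S5 !addr0.
Qed.

Lemma wt_expand k l b : d * (w l b * t k l - sg B (par k l && par l b) * (t k l * w l b))
  = (k == b)%:R * (p * (sg B (bar l) * wt l l)) - p * (sg B (bar l) * tw k b)
    + (negi k == b)%:R * (q * (sg B (bar k) * wt' l l)).
Proof.
have sgI e X Y : d * (sg B e * X) = Y -> d * X = sg B e * Y.
  by move=> <-; rewrite (sgCA e d) sgK.
have := tw_comm k l l b.
rewrite eqxx [l == negi l]eq_sym negi_neq mul0r mul1r sub0r => /sgI ->.
have [->|nkb] := eqVneq k b.
  rewrite negi_neq !mul0r !mul1r oppr0 mulr0 !addr0 -[RHS]mulrBr (cA pC) [sg _ _ * (_ - _)]mulrBr !sgsg.
  by congr (p * (sg _ _ * _ - sg _ _ * _)); rewrite /par; case: (bar b); case: (bar l).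
rewrite !mul0r !sub0r mulrDr !mulrN (cA pC) sgsg; congr (- (p * (sg _ _ * _)) + _).
  by rewrite /par; case: (bar b); case: (bar k); case: (bar l).
have [<-|nkb'] := eqVneq (negi k) b; last first.
  by rewrite !mul0r !mulr0 oppr0.
rewrite !mul1r (cA qC) sgsg -mulrN -mulNr -sgN; congr (q * (sg _ _ * _)).
by rewrite /par [bar (negi k)]/(~~ bar k); case: (bar k); case: (bar l).
Qed.

(** With z written as the sum of s b l * w l b, the entry t k l is moved leftwards, first past w and
    then past s; the leftovers are the differences estimated by [wt_diag], [wt_diag'] and
    [vsumE]. *)
Lemma series_comm1 k l :
  d * (t k l * z - z * t k l)
  = p * (sg B (bar l) * (s k l * (wsum l - wt l l) + (vsum k l - t k l * z)))
    + q * (sg B (bar k) * (s (negi k) l * (wsum' l - wt' l l))).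
Proof.
pose e b := par k l && par l b.
have zE : z = \sum_b s b l * w l b by rewrite swz eqxx mul1r.
have A : d * (z * t k l) - d * (\sum_b sg B (e b) * (s b l * (t k l * w l b)))
   = p * (sg B (bar l) * (s k l * wt l l - vsum k l))
     + q * (sg B (bar k) * (s (negi k) l * wt' l l)).
  transitivity (\sum_b ((k == b)%:R * (p * (sg B (bar l) * (s b l * wt l l)))
     - p * (sg B (bar l) * (s b l * tw k b))
     + (negi k == b)%:R * (q * (sg B (bar k) * (s b l * wt' l l))))).
    rewrite -mulrBr {1}zE mulr_suml -sumrB mulr_sumr; apply: eq_bigr => b _.
    rewrite -mulrA -[X in d * (_ - X)]sgCA -mulrBr -(cA dC) wt_expand.
    rewrite mulrDr mulrBr !(cA (natC _)) !(cA pC) !(cA qC).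
    by rewrite !(sgCA _ (s b l)).
  rewrite big_split sumrB /= !sum_delta mulrBr mulrBr; congr (_ - _ + _).
  by rewrite -!mulr_sumr.
have C : d * (\sum_b sg B (e b) * (s b l * (t k l * w l b)))
   = d * (t k l * z) - p * (sg B (bar l) * (s k l * wsum l - t k l * z))
     - q * (sg B (bar k) * (s (negi k) l * wsum' l)).
  transitivity (\sum_b (d * (t k l * (s b l * w l b))
    - p * (sg B (bar l) * (s k l * (t b l * w l b)))
    + p * (sg B (bar l) * (t k l * (s b l * w l b)))
    - q * (sg B (bar k) * (s (negi k) l * (t (negi b) l * w l b)))
    + q * (sg B (bar k) * (t k (negi l) * (s b (negi l) * w l b))))).
    rewrite mulr_sumr; apply: eq_bigr => b _; rewrite st_expand.
    have -> : e b (+) (par b l && par k l) = false.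
      by rewrite /e /par; case: (bar k); case: (bar l); case: (bar b).
    have -> : e b (+) sgn3 b k l = bar l.
      by rewrite /e /par /sgn3; case: (bar k); case: (bar l); case: (bar b).
    have -> : bar l (+) par k l = bar k.
      by rewrite /par; case: (bar k); case: (bar l).
    by rewrite sgF mul1r.
  have nl : negi l != l by rewrite negi_neq.
  rewrite big_split sumrB big_split sumrB /= -!mulr_sumr (swz0 nl) -zE.
  by rewrite !mulr0 addr0 mulrBr mulrBr opprB addrA addrAC.
rewrite mulrBr -[d * (z * _)](subrK (d * (\sum_b sg B (e b) * (s b l * (t k l * w l b))))).
rewrite A C !(mulrBr, mulrDr) !(opprB, opprD, opprK) !addrA.
by rewrite [LHS](ACl (1*8*6*3*2*7*5*4)) /= subrr add0r.
Qed.

(* Multiplied by d once more, the two terms of series_comm1 cancel. *)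
Lemma series_comm k l : t k l * z = z * t k l.
Proof.
apply/eqP; rewrite -subr_eq0; apply/eqP/dreg/dreg.
rewrite series_comm1 mulrDr (cA pC) (cA qC) !(sgCA _ d) mulrDr -!(cA dC).
have -> : s k l * (d * (wsum l - wt l l)) + d * (vsum k l - t k l * z)
    = - (q * (sg B (bar k) * (s (negi k) l * om'))).
  rewrite wt_diag (cA pC) mulrBr vsumE.
  by rewrite addrC [LHS](ACl (1*4*(2*5)*3)) /= subrr addNr !add0r.
rewrite wt_diag' !(mulrN, mulNr) (cA qC) (cA pC) (cA qC p) addrC.
rewrite (cA pC (sg B (bar k))) (sgCA (bar l) (s (negi k) l)) !sgsg.
by rewrite [bar k (+) _]addbC subrr.
Qed.
End SeriesCentral.

(** The relation is a family of identities for all pairs of exponents, so u and v may be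
    interchanged. *)
Lemma rtt_swap N (A : nzRingType) (t : idx N -> idx N -> ser A) :
  rtt (varx A) (vary A) (fun i j => seru (t i j)) (fun i j => serv (t i j)) ->
  rtt (vary A) (varx A) (fun i j => serv (t i j)) (fun i j => seru (t i j)).
Proof.
move=> /quadrel_eq0 h i j k l; apply/coefz_eq0 => m n.
have := h i j k l (n + 2) (m + 2); rewrite /quadrel /rttexp.
rewrite !(coefzB, coefzD, coefz_varx, coefz_vary, coefz_sg, coefz_uv, coefz_vu).
have h2 (c : int) : c + 2 - 1 = c + 1 by lia.
have h1 (c : int) : c + 2 - 1 - 1 = c by lia.
have h3 (c : int) : c + 1 + 1 = c + 2 by lia.
by rewrite !h1 !h2 !h3.
Qed.

Section CentralSeries.
Variables (N : nat) (A : nzRingType).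
Local Notation idx := (idx N).
Variables (t w : idx -> idx -> ser A) (z : ser A).
Hypothesis t_rtt :
  rtt (varx A) (vary A) (fun i j => seru (t i j)) (fun i j => serv (t i j)).
Hypothesis tw1 : forall k b, \sum_l sg _ (par k l && par l b) * (t k l * w l b) = (k == b)%:R.
Hypothesis wt1 : forall a l, \sum_k sg _ (par a k && par k l) * (w a k * t k l) = (a == l)%:R.
Hypothesis twz : forall j k, \sum_b t b j * w k b = (j == k)%:R * z.

Lemma rtt_expand (x y : ser (ser A)) (f g : idx -> idx -> ser (ser A)) i j k l : rtt x y f g ->
  (y * y - x * x) * (sg _ (sgn3 i k l)
     * (f i j * g k l - sg _ (par i j && par k l) * (g k l * f i j)))
  = (x * (y * y) + x * (x * y)) * (f k j * g i l - g k j * f i l)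
    - (x * (y * y) - x * (x * y)) * (sg _ (par k l)
       * (f (negi k) j * g (negi i) l - g k (negi j) * f i (negi l))).
Proof.
move=> /(_ i j k l); rewrite /rttexp => /subr0_eq.
set X := sg _ (sgn3 _ _ _) * _; set P := _ - g k j * _; set Q := sg _ (par k l) * _.
move: X P Q => X P Q h.
by rewrite !mulrBl !mulrDl -!mulrA h.
Qed.

Lemma rtt_central k l m n : t k l m * z n = z n * t k l m.
Proof.
have xC := @varx_comm A; have yC := @vary_comm A.
have xyC : varx A * vary A = vary A * varx A by exact: xC.
pose d := vary A * vary A - varx A * varx A.
pose p := varx A * (vary A * vary A) + varx A * (varx A * vary A).
pose q := varx A * (vary A * vary A) - varx A * (varx A * vary A).
have := @series_comm N (ser (ser A)) d p q (fun i j => seru (t i j)) (fun i j => serv (t i j))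
  (fun i j => serv (w i j)) (serv z).
have cen (a : ser (ser A)) : [/\ a * d = d * a, a * p = p * a & a * q = q * a].
  by split; do ?[apply: centralD|apply: centralN|apply: centralM] => // b.
have Z m' n' : (seru (t k l) * serv z - serv z * seru (t k l)) m' n'
   = t k l m' * z n' - z n' * t k l m' by rewrite !serB coef_uv coef_vu.
move=> H; apply: subr0_eq; rewrite -Z [_ * serv z]H ?subrr //.
- by move=> a; have [] := cen a.
- by move=> a; have [] := cen a.
- by move=> a; have [] := cen a.
- exact: regular_yx.
- by move=> i j k' l'; exact: (rtt_expand i j k' l' t_rtt).
(* Interchanging u and v changes the signs of d and q and preserves p. *)
- move=> i j k' l'; have E := rtt_expand i j k' l' (rtt_swap t_rtt).
  have e1 : vary A * (varx A * varx A) = varx A * (varx A * vary A).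
    by rewrite yC -mulrA.
  have e2 : vary A * (vary A * varx A) = varx A * (vary A * vary A).
    by rewrite -xyC yC -mulrA.
  rewrite e1 e2 -[X in X * _ = _]opprB mulNr in E.
  rewrite -[LHS]opprK E [X in - (X * _ - _)]addrC -/p -[X in - (_ - X * _)]opprB -/q.
  by rewrite mulNr opprK opprD.
- move=> k' b; rewrite -[RHS](rmorph_nat serv) -tw1 rmorph_sum; apply: eq_bigr => l' _.
  by rewrite !rmorphM /= sgm.
- move=> a l'; rewrite -[RHS](rmorph_nat serv) -wt1 rmorph_sum; apply: eq_bigr => k' _.
  by rewrite !rmorphM /= sgm.
- move=> j k'; rewrite -[X in X * _](rmorph_nat serv) -rmorphM -twz rmorph_sum.
  by apply: eq_bigr => b _; rewrite rmorphM.
Qed.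
End CentralSeries.

(** * The leading terms of Z(u) *)

Section InverseSeries.
Variables (K : fieldType) (n : nat) (D : yalg K n).
Local Notation Y := (ycar D).
Local Notation idx := (idx n.+1).
Local Notation T := (@yg K n D).
Implicit Types (i j k l : idx) (x y : Y).

Lemma grM0 (k d l k' d' : nat) x y : gr k d l x -> gr k' d' 0 y -> gr (k + k') (d + d') 0 (x * y).
Proof.
move=> hx hy; elim: hx => [|c v z lv _ IH]; first by rewrite mul0r; exact: Gr0.
rewrite mulrDl; apply: grD IH; rewrite -scalerAl; apply: grZ.
elim: hy => [|e w t lw _ IH]; first by rewrite mulr0; exact: Gr0.
rewrite mulrDr -scalerAr -tword_cat; apply: GrD IH.
by move: lv lw; rewrite /lower deg_cat; lia.
Qed.
Lemma gr0M (k d l k' d' : nat) x y : gr k' d' 0 y -> gr k d l x -> gr (k' + k) (d' + d) 0 (y * x).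
Proof.
move=> hy hx; elim: hy => [|c v z lv _ IH]; first by rewrite mul0r; exact: Gr0.
rewrite mulrDl; apply: grD IH; rewrite -scalerAl; apply: grZ.
elim: hx => [|e w t lw _ IH]; first by rewrite mulr0; exact: Gr0.
rewrite mulrDr -scalerAr -tword_cat; apply: GrD IH.
by move: lv lw; rewrite /lower deg_cat; lia.
Qed.

Variables (W : idx -> idx -> ser Y) (Zs : ser Y).
Hypothesis TW : forall i l, \sum_j sg _ (par i j && par j l) * (T i j * W j l) = (i == l)%:R.

Lemma parT i j l : par i j (+) par j l = par i l.
Proof. by rewrite /par; case: (bar i); case: (bar j); case: (bar l). Qed.

Lemma pari i : par i i = false. Proof. exact: addbb. Qed.

Lemma ser_nat (b : bool) m : (b%:R : ser Y) m = (b && (m == 0%N))%:R.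
Proof. by case: b. Qed.

Lemma W_rec i l m : W i l m = ((i == l) && (m == 0%N))%:R
  - \sum_j sg Y (par i j && par j l) * \sum_(a < m) T i j a.+1 * W j l (m - a.+1)%N.
Proof.
have /(congr1 (fun f => f m)) := TW i l; rewrite ser_sum ser_nat => <-.
under eq_bigr => j _ do rewrite ser_sg serM big_ord_recl subn0 yg0 mulrDr.
rewrite big_split /= addrK (bigD1 i) //= big1 ?addr0 => [|j /negPf ij].
  by rewrite pari eqxx !mul1r.
by rewrite eq_sym ij mul0r mulr0.
Qed.

Lemma W0 i l : W i l 0%N = (i == l)%:R.
Proof.
by rewrite W_rec eqxx andbT big1 ?subr0 // => j _; rewrite big_ord0 mulr0.
Qed.

Lemma yhomogW i l m : yhomog (par i l) (W i l m).
Proof.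
elim/ltn_ind: m i l => m IH i l; rewrite W_rec; apply: yhomogD.
  case: eqP => [->|_]; last exact: yhomog0.
  rewrite pari; case: (m == 0%N); [exact: yhomog1|exact: yhomog0].
apply/yhomogN/yhomog_sum => j _; apply/yhomog_sg/yhomog_sum => a _.
rewrite -(parT i j l); apply: yhomogM; first exact: yhomogT.
by apply: IH; have := ltn_ord a; lia.
Qed.

(** The inverse of 1 + X begins with 1 - X, and each further factor costs one degree, the degree
    being the superscript minus one. *)
Lemma W_lead i l m : gr 0 m 0 (W i l m.+1 + T i l m.+1).
Proof.
elim/ltn_ind: m i l => m IH i l.
have E : \sum_j sg Y (par i j && par j l) * (T i j m.+1 * (j == l)%:R) = T i l m.+1.
  rewrite (bigD1 l) //= big1 ?addr0 => [|j /negPf jl]; last by rewrite jl !mulr0.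
  by rewrite pari andbF eqxx mulr1 mul1r.
rewrite W_rec andbF sub0r.
under eq_bigr => j _ do rewrite big_ord_recr subnn W0 /= mulrDr.
rewrite big_split /= E opprD subrK.
apply/grN/gr_sum => j _; apply/gr_sg/gr_sum => a _.
have am := ltn_ord a; have e : (m.+1 - a.+1 = (m - a.+1).+1)%N by lia.
rewrite e; apply: (@gr_lt _ _ _ _ (a + (m - a.+1)) (1 + 2)); first lia.
apply: (@grM _ _ _ 0 _ _ 0); first by rewrite -[X in gr 0 X]addn0; exact: gr_T.
rewrite -[W _ _ _](addrK (T j l (m - a.+1).+1)); apply: grB.
  by apply: gr_le (IH _ _ _ _) => //; lia.
by rewrite -[X in gr 0 X]addn0; exact: gr_T.
Qed.

Hypothesis WT : forall i l, \sum_j sg _ (par i j && par j l) * (W i j * T j l) = (i == l)%:R.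
Hypothesis ZW : forall j k, \sum_i T i j * W k i = (j == k)%:R * Zs.

Lemma Zs_even m : yhomog false (Zs m).
Proof.
have /(congr1 (fun f => f m)) := ZW (i0 n) (i0 n); rewrite eqxx mul1r => <-.
rewrite ser_sum; apply: yhomog_sum => i _; rewrite serM; apply: yhomog_sum => a _.
have <- : par i (i0 n) (+) par (i0 n) i = false by rewrite parT pari.
by apply: yhomogM; [exact: yhomogT|exact: yhomogW].
Qed.

Lemma Zs_central m y : Zs m * y = y * Zs m.
Proof.
elim/(@yg_span K n D): y => [|c w x IH]; first by rewrite mulr0 mul0r.
rewrite mulrDr mulrDl IH -scalerAr -scalerAl; congr (_ *: _ + _).
elim: w => [|g w IHw]; first by rewrite !big_nil mulr1 mul1r.
by rewrite !big_cons mulrA -(rtt_central (@yg_rtt K n D) TW WT ZW) -!mulrA IHw.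
Qed.

(** The same factors in the other order form a diagonal entry of T(u)^-1 T(u), which has no
    coefficient at u^-(m+2). Subtracting it makes the coefficient of Z(u) a sum of supercommutators,
    and the terms with superscript 0 cancel. *)
Lemma Zs_scomm m : Zs m.+2 = \sum_i \sum_(a < m.+1)
  (T i (i0 n) a.+1 * W (i0 n) i (m - a).+1
   - sg Y (bar i) * (W (i0 n) i (m - a).+1 * T i (i0 n) a.+1)).
Proof.
set o := i0 n.
have E1 := congr1 (fun f => f m.+2) (ZW o o).
have E2 := congr1 (fun f => f m.+2) (WT o o).
rewrite eqxx mul1r ser_sum in E1; rewrite ser_nat andbF ser_sum in E2.
have sgE i : par o i && par i o = bar i by rewrite /par /o /i0 /bar /=; case: i.2.
rewrite -E1 -[LHS]subr0 -[X in _ - X]E2 -sumrB; apply: eq_bigr => i _.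
rewrite ser_sg sgE !serM.
have -> : \sum_(a < m.+3) W o i a * T i o (m.+2 - a)%N
    = \sum_(a < m.+3) W o i (m.+2 - a)%N * T i o a.
  rewrite (reindex_inj rev_ord_inj) /=; apply: eq_bigr => a _.
  by rewrite subSS subKn // -ltnS.
rewrite mulr_sumr -sumrB big_ord_recl big_ord_recr /= /bump /= !add1n subn0 subnn yg0 W0.
have natC (b : bool) (f : Y) : f * b%:R = b%:R * f by rewrite mulr_natl mulr_natr.
have d0 (f : Y) : (i == o)%:R * f - sg Y (bar i) * ((i == o)%:R * f) = 0.
  by case: eqP => [->|_]; rewrite ?mul0r ?mulr0 ?subrr // !mul1r subrr.
rewrite !natC (eq_sym o) !d0 add0r addr0; apply: eq_bigr => a _.
by rewrite add1n; have -> : (m.+2 - a.+1 = (m - a).+1)%N by have := ltn_ord a; lia.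
Qed.

(** To leading order each supercommutator is -(T_ii - T_11)^(2k+1), whatever a is, which gives the
    factor 2k+1; the minus sign is that of [W_lead]. Since T_(-i,-i)^(2k+1) = -T_ii^(2k+1), the
    indices i and -i together give 2 T_ii and their T_11 terms cancel. *)
Lemma Zs_lead (k : nat) : gr 0 k.*2 0
  (Zs k.*2.+2 - (- (2 * k.*2.+1)%:R) *: \sum_(i < n.+1) T (i, false) (i, false) k.*2.+1).
Proof.
set o := i0 n; set m := k.*2.
have -> : (- (2 * m.+1)%:R) *: \sum_(i < n.+1) T (i, false) (i, false) m.+1
    = - \sum_i \sum_(a < m.+1) sg Y (bar i) * (T i i m.+1 - T o o m.+1).
  rewrite scaleNr scaler_sumr; congr (- _).
  transitivity (\sum_(i < n.+1) \sum_(b : bool) \sum_(a < m.+1)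
      sg Y b * (T (i, b) (i, b) m.+1 - T o o m.+1)); last first.
    by rewrite pair_bigA; apply: eq_bigr => -[i b] _.
  apply: eq_bigr => i _; rewrite big_bool /= !sumr_const !card_ord sgT sgF mulN1r mul1r opprB.
  rewrite -[T (i, true) _ _]/(T (negi (i, false)) (negi (i, false)) m.+1) -ygN /=.
  rewrite /m odd_double sgT mulN1r opprK -mulrnDl.
  rewrite [X in _ = X *+ _](AC (2*2) (2*3*(1*4))) /= subrr addr0 -mulr2n -mulrnA.
  by rewrite scaler_nat.
rewrite opprK Zs_scomm -big_split; apply: gr_sum => i _ /=.
rewrite -big_split; apply: gr_sum => a _ /=.
have am : (a + (m - a) = m)%N by have := ltn_ord a; lia.
pose L := W o i (m - a).+1 + T o i (m - a).+1.
have -> : W o i (m - a).+1 = L - T o i (m - a).+1 by rewrite addrK.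
have hL : gr 0 (m - a) 0 L by exact: W_lead.
have hT : gr 0 a 2 (T i o a.+1) by rewrite -[X in gr 0 X]addn0; exact: gr_T.
have := scomm_lead D i o o i a (m - a)%N; rewrite am => /(gr_sg (bar i)).
have -> : sgn3 i o i = bar i by rewrite /sgn3 /o /i0 /bar /= andbF andbb; case: i.2.
have -> : bracket D i o o i a.+1 m.+1 = T i i m.+1 - T o o m.+1.
  have ni (j : idx) : (negi j == j) = false by rewrite negi_neq.
  by rewrite /bracket !eqxx ni eq_sym ni !mul0r subrr !mulr0 addr0 !mul1r.
rewrite mulrBr sgK /scomm [par o i]addbC -/(par i o) andbb.
have -> : par i o = bar i by rewrite /par /o /i0 /bar /= addbF.
clearbody L; move: (T i o a.+1) (T o i _) (T i i _ - T o o _) hT => t t' e hT hS.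
have hL' : gr 0 m 0 (t * L - sg Y (bar i) * (L * t)).
  have h1 := grM0 hT hL; have h2 := gr0M hL hT.
  by rewrite am in h1; rewrite addnC am in h2; apply: grB => //; exact: gr_sg.
have := grB hL' hS; congr (gr _ _ _ _).
rewrite !(mulrBr, mulrBl) !(opprB, opprD) !addrA.
by rewrite [LHS](ACl (1*5*4*2*3)).
Qed.
End InverseSeries.

(** * The centre *)

Section Center.
Variables (K : fieldType) (n : nat) (D : yalg K n).
Local Notation Y := (ycar D).
Local Notation idx := (idx n.+1).
Local Notation letter := (letter n.+1).
Local Notation T := (@yg K n D).
Implicit Types (g h : letter) (u v w : seq letter) (x y z : Y).

Hypothesis charK : forall m, m.+1%:R != 0 :> K.
Variables (Zf : nat -> Y) (cz : nat -> K).
Hypothesis cz_neq0 : forall k, cz k != 0.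
Hypothesis Zf_even : forall k, yhomog false (Zf k).
Hypothesis Zf_lead : forall k, gr (D := D) 0 k.*2 0
  (Zf k - cz k *: \sum_(i < n.+1) T (i, false) (i, false) k.*2.+1).
Hypothesis Zf_central : forall k y, Zf k * y = y * Zf k.
Local Notation special := (@special n).
Local Notation adm := (@adm n).
Local Notation val := (val Zf).
Local Notation valw := (valw Zf).

Lemma max_word (s : seq (seq letter)) : s != [::] -> exists2 w0, w0 \in s &
  forall w, w \in s -> (deg w < deg w0)%N \/ deg w = deg w0 /\ (size w <= size w0)%N.
Proof.
elim: s => [//|a [|b s] IH] _.
  by exists a; rewrite ?mem_head // => w; rewrite inE => /eqP ->; right.
have [w0 ws0 h0] := IH isT.
have [a0|a0] := boolP ((deg a < deg w0)%N || (deg a == deg w0) && (size a <= size w0)%N).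
  exists w0; first by rewrite inE ws0 orbT.
  move=> w; rewrite inE => /orP[/eqP ->|/h0 //].
  by case/orP: a0 => [|/andP[/eqP]]; [left|right].
exists a; first exact: mem_head.
move=> w; rewrite inE => /orP[/eqP ->|/h0 hw]; first by right.
move: a0; rewrite negb_or negb_and -!leqNgt -!ltnNge => /andP[ga gs].
move: (deg a) (deg w0) (deg w) (size a) (size w0) (size w) ga gs hw => p q r p' q' r' ga gs hw.
have [rp|pr] := ltnP r p; [by left|right].
by case: hw => [|[rq r'q']]; move: gs; case: eqP => /=; lia.
Qed.

Lemma split_top (s : seq (seq letter)) (c : seq letter -> K) : s != [::] ->
  exists2 w0, w0 \in s & gr 0 (deg w0) (size w0) (\sum_(w <- s) c w *: valw w
   - \sum_(w <- [seq w <- s | (deg w == deg w0) && (size w == size w0)]) c w *: valw w).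
Proof.
move=> /max_word[w0 ws0 h0]; exists w0 => //.
rewrite big_filter (bigID (fun w => (deg w == deg w0) && (size w == size w0))) /= addrAC subrr add0r.
rewrite big_seq_cond; apply: gr_sum => w /andP[/h0 hw nw]; apply: grZ.
have [lt|[e sz]] := hw.
  by apply: gr_lt lt _; exact: (gr_valw Zf_lead (ltnSn (size w))).
by rewrite -e; apply: (gr_valw Zf_lead); move: nw; rewrite e eqxx /= ltn_neqAle sz andbT.
Qed.

(** After discarding zero coefficients, the words of top degree and length contradict independence
    of leading terms. *)
Lemma valw_free (s : seq (seq letter)) (c : seq letter -> K) : uniq s -> all adm s ->
  \sum_(w <- s) c w *: valw w = 0 -> forall w, w \in s -> c w = 0.
Proof.
move=> us as_ E w ws; apply/eqP/negPn/negP => cw.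
pose s' := [seq v <- s | c v != 0].
have [|w0 ws0] := @split_top s' c.
  by rewrite -has_filter; apply/hasP; exists w.
have -> : \sum_(v <- s') c v *: valw v = 0.
  rewrite big_filter -[RHS]E [RHS](bigID (fun v => c v != 0)) /= [X in _ = _ + X]big1 ?addr0 //.
  by move=> v /negPn/eqP ->; rewrite scale0r.
rewrite sub0r => /grN; rewrite opprK.
set s1 := filter _ s' => G.
move: ws0; rewrite mem_filter => /andP[cw0 w0s]; move/eqP: (cw0); apply.
apply: (independence charK cz_neq0 Zf_even Zf_lead _ _ G).
- by rewrite !filter_uniq.
- move=> v; rewrite !mem_filter => /andP[/andP[/eqP dv /eqP sv] /andP[_ vs]]; split=> //.
  exact: (allP as_).
  by rewrite !mem_filter !eqxx cw0.
Qed.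

Lemma scentralD x y : scentral x -> scentral y -> scentral (x + y).
Proof. by move=> hx hy b z hz; rewrite mulrDl raddfD /= mulrDr (hx b) ?(hy b). Qed.
Lemma scentralZ c x : scentral x -> scentral (c *: x).
Proof. by move=> hx b z hz; rewrite thetaZ -scalerAl -scalerAr (hx b). Qed.
Lemma scentral1 : @scentral K n D 1.
Proof. by move=> b z _; rewrite rmorph1 mul1r mulr1. Qed.
Lemma scentralM x y : scentral x -> scentral y -> scentral (x * y).
Proof.
by move=> hx hy b z hz; rewrite -mulrA (hy b) // mulrA (hx b) // -mulrA rmorphM.
Qed.
Lemma scentral_sum I (r : seq I) (P : pred I) (f : I -> Y) :
  (forall i, P i -> scentral (f i)) -> scentral (\sum_(i <- r | P i) f i).
Proof.
move=> h; elim/big_ind: _ => //; last exact: scentralD.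
by rewrite -(scale0r 1); apply/scentralZ/scentral1.
Qed.
Lemma scentral_Zf k : scentral (Zf k).
Proof. by move=> b z _; rewrite (theta_homog _ (Zf_even k)) andbF sgF mul1r Zf_central. Qed.

Lemma valw_special w : all special w -> valw w = \prod_(g <- w) Zf g.2./2.
Proof.
move=> /allP sw; rewrite /valw; apply: eq_big_seq => g /sw.
by rewrite /val => ->.
Qed.

Lemma scentral_special w : all special w -> scentral (valw w).
Proof.
move=> /valw_special ->; elim/big_ind: _ => //; first exact: scentral1.
  exact: scentralM.
by move=> g _; exact: scentral_Zf.
Qed.

(* The part of a supercentral element made of the other monomials is supercentral too; by
   mu_central, mu g annihilates its leading part for every letter g that is not special. *)
Lemma scentral_pbw x : scentral x -> exists s (c : seq letter -> K),
  all (all special) s /\ x = \sum_(w <- s) c w *: valw w.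
Proof.
have [s [c [us as_ ->]]] := pbw_comb charK cz_neq0 Zf_lead Zf_central x.
rewrite (bigID (all special)) /=; set P := \sum_(i <- s | all special i) _ => hx.
pose s' := [seq w <- s | ~~ all special w && (c w != 0)].
suff s0 : s' = [::].
  exists [seq w <- s | all special w], c; split; first exact: filter_all.
  rewrite big_filter -/P big1_seq ?addr0 // => w /andP[nw ws].
  have : w \notin s' by rewrite s0.
  by rewrite mem_filter nw ws /= andbT negbK => /eqP ->; rewrite scale0r.
have {}hx : scentral (\sum_(w <- s') c w *: valw w).
  have -> : \sum_(w <- s') c w *: valw w =
      - 1 *: P + (P + \sum_(w <- s | ~~ all special w) c w *: valw w).
    rewrite scaleN1r addKr big_filter [RHS](bigID (fun w => c w != 0)) /= [X in _ = _ + X]big1 ?addr0 //.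
    by move=> w /andP[_ /negPn/eqP ->]; rewrite scale0r.
  apply: scentralD hx; apply/scentralZ/scentral_sum => w sw.
  by apply/scentralZ/scentral_special.
apply/eqP/negPn/negP => /(split_top c)[w0 w0s' H].
have /andP[/andP[nw0 cw0] w0s] : (~~ all special w0 && (c w0 != 0)) && (w0 \in s).
  by move: w0s'; rewrite mem_filter.
have [g gw ng] := allPn nw0.
have [l sz] : exists l, size w0 = l.+1 by case: (w0) gw => // a v _; exists (size v).
set s1 := filter _ s' in H; rewrite sz in H.
have hs1 v : v \in s1 -> [/\ adm v, deg v = deg w0 & size v = l.+1].
  rewrite mem_filter sz => /andP[/andP[/eqP dv /eqP sv]]; rewrite mem_filter => /andP[_ vs].
  by split=> //; exact: (allP as_).
have w0s1 : w0 \in s1 by rewrite mem_filter !eqxx.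
have rg : reduced g by have [/and3P[_ /allP h _] _ _] := hs1 w0 w0s1; exact: h.
move/eqP: cw0; apply.
set S := \sum_(w <- s') _ in hx H.
have gS : gr 0 (deg w0) l.+2 S.
  rewrite -[S](subrK (\sum_(w <- s1) c w *: valw w)); apply: grD.
    exact: gr_le H.
  rewrite big_seq_cond; apply: gr_sum => v; rewrite andbT => /hs1[_ dv sv].
  by apply: grZ; rewrite -dv; apply: (gr_valw Zf_lead); rewrite sv.
(* Centrality makes this one length shorter than [grC_redD] guarantees, which forces the
   coefficients of top words containing g to vanish. *)
have := mu_central (charK 1) gS hx rg ng.
rewrite -[S](subrK (\sum_(w <- s1) c w *: valw w)) addrC => M.
apply: (mu_redD_sum charK cz_neq0 Zf_even Zf_lead _ _ hs1 H rg M _ gw).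
- exact: (independence charK cz_neq0 Zf_even Zf_lead).
- by rewrite !filter_uniq.
- exact: w0s1.
Qed.

Lemma center_generated x : scentral x <-> forall B : {pred Y}, GRing.subalg_closed B ->
  (forall r, Zf r \in B) -> x \in B.
Proof.
split=> [/scentral_pbw[s [c [/allP hs ->]]] B [B1 BD BM] BZ|].
  have B0 : 0 \in B by rewrite -[0](addNr 1) -scaleN1r; exact: BD.
  rewrite big_seq_cond; elim/big_rec: _ => // w y; rewrite andbT => /hs/valw_special ->.
  apply: BD => //; elim/big_rec: _ => // g z _; exact: BM.
move=> /(_ (fun x => `[< scentral x >])) H; apply/asboolP/H => [|r]; last first.
  exact/asboolP/scentral_Zf.
split=> [|a u v|u v].
- exact/asboolP/scentral1.
- move=> /asboolP hu /asboolP hv; apply/asboolP/scentralD => //; exact: scentralZ.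
- move=> /asboolP hu /asboolP hv; apply/asboolP; exact: scentralM.
Qed.

Lemma perm_valw v w : all special v -> perm_eq v w -> valw v = valw w.
Proof.
elim: w v => [|g w IH] v sv; first by move=> /perm_nilP ->.
move=> pv; have gv : g \in v by rewrite (perm_mem pv) mem_head.
case/splitPr: gv sv pv => v1 v2; rewrite all_cat /= => /and3P[s1 sg s2].
rewrite -[g :: v2]cat1s perm_catCA /= perm_cons => pv.
rewrite valw_cons -(IH (v1 ++ v2)) ?all_cat ?s1 // /valw !big_cat big_cons /=.
by rewrite !mulrA /val sg Zf_central.
Qed.

(** * Algebraic independence *)

Section Monomials.
Variables (m : nat) (E : eqType) (ex : E -> 'I_m -> nat).
Hypothesis ex_inj : forall e f, ex e =1 ex f -> e = f.

Let lt (r : 'I_m) : letter := (i0 n, i0 n, r.*2).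
Let mword (e : E) : seq letter := flatten [seq nseq (ex e r) (lt r) | r <- index_enum 'I_m].
Let sword (e : E) : seq letter := sort (@leL n) (mword e).

Let special_mword e : all special (mword e).
Proof.
apply/allP => g /flatten_mapP[r _]; rewrite mem_nseq => /andP[_ /eqP ->].
by rewrite /special eqxx odd_double.
Qed.

Let count_mword e r : count_mem (lt r) (mword e) = ex e r.
Proof.
rewrite /mword count_flatten -map_comp sumnE big_map (bigD1 r) //=.
rewrite count_nseq /= eqxx mul1n big1 ?addn0 // => r' rr'; rewrite count_nseq /=.
by rewrite !xpair_eqE !eqxx /= (inj_eq double_inj) (inj_eq val_inj) (negPf rr').
Qed.

Let adm_sword e : adm (sword e).
Proof.
have sp : all special (sword e) by rewrite all_sort special_mword.
apply/and3P; split; first exact/sort_sorted/leL_total.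
  by apply/sub_all: sp => g /andP[/eqP h _]; rewrite /reduced h.
by apply/sub_all: sp => g /andP[/eqP h _]; rewrite /gpar h.
Qed.

Let valw_sword e : valw (sword e) = \prod_(r < m) Zf r ^+ ex e r.
Proof.
rewrite -(@perm_valw (mword e)) ?special_mword //; last by rewrite perm_sym perm_sort.
rewrite (valw_special (special_mword e)) /mword big_flatten big_map /=.
apply: eq_bigr => r _; rewrite big_nseq /= doubleK.
by elim: (ex e r) => [|k IH]; rewrite ?expr0 // iterS IH exprS.
Qed.

(** Monomials in the central generators are PBW monomials in special letters, and the multiplicities
    recover the exponents. Exponents are abstract so that multinomials need not be mentioned inside
    the module. *)
Lemma Zf_independent (s : seq E) (c : E -> K) : uniq s ->
  \sum_(e <- s) c e *: \prod_(r < m) Zf r ^+ ex e r = 0 -> forall e, e \in s -> c e = 0.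
Proof.
move=> us H e es.
have inj : injective sword.
  have cs e' r : count_mem (lt r) (sword e') = ex e' r.
    by rewrite -count_mword; apply/permP; rewrite perm_sort.
  by move=> e1 e2 e12; apply: ex_inj => r; rewrite -!cs e12.
(* Coefficients transported along the injection [sword]; the value 0 off its image is never read. *)
pose c' w := if [pick j : 'I_(size s) | sword (tnth (in_tuple s) j) == w] is Some j
  then c (tnth (in_tuple s) j) else 0.
have cE f : f \in s -> c' (sword f) = c f.
  move=> fs; rewrite /c'; case: pickP => [j /eqP/inj -> //|].
  by case/(tnthP (in_tuple s)): fs => j -> /(_ j); rewrite eqxx.
rewrite -(cE e es); apply: (@valw_free (map sword s) c').
- by rewrite map_inj_uniq.
- by apply/allP => w /mapP[f _ ->]; exact: adm_sword.
- rewrite big_map -[RHS]H; apply: eq_big_seq => f fs; by rewrite cE // valw_sword.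
- exact: map_f.
Qed.
End Monomials.
End Center.

(** For homogeneous entries only the summand at their own parity survives, which turns the product
    of [endmul] into signed products of series. *)
Lemma endmul_entry (A : nzRingType) (pr : bool -> A -> A) (f g : nat -> A) (e b c : bool) m :
  (forall d k, pr d (f k) = f k *+ (d == e)) ->
  \sum_(d : bool) (-1) ^+ (d * (b + c))%N * (\sum_(k < m.+1) pr d (f k) * g (m - k)%N)
  = sg A (e && (b (+) c)) * ((f : ser A) * (g : ser A)) m.
Proof.
move=> h; rewrite (bigD1 e) //= [X in _ + X]big1 ?addr0 => [|d /negPf de]; last first.
  by rewrite big1 ?mulr0 // => k _; rewrite h de mulr0n mul0r.
rewrite sgnat oddM oddD !oddb serM; congr (_ * _); apply: eq_bigr => k _.
by rewrite h eqxx mulr1n.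
Qed.

Section YangianCenter.
Variables (K : fieldType) (n : nat) (D : yalg K n).
Local Notation Y := (ycar D).
Local Notation idx := (idx n.+1).
Local Notation T := (@yg K n D).
Hypothesis charK : forall m, m.+1%:R != 0 :> K.
Variables (W : idx -> idx -> nat -> Y) (Zs : nat -> Y).
Hypothesis TW_W : forall i l m, \sum_(j : idx) \sum_(d : bool) (-1) ^+ (d * (bar j + bar l))%N *
  (\sum_(k < m.+1) ypr d (T i j k) * W j l (m - k)%N) = ((i == l) && (m == 0%N))%:R.
Hypothesis WT_W : forall i l m, \sum_(j : idx) \sum_(d : bool) (-1) ^+ (d * (bar j + bar l))%N *
  (\sum_(k < m.+1) ypr d (W i j k) * T j l (m - k)%N) = ((i == l) && (m == 0%N))%:R.
Hypothesis ZW_W : forall j k m, \sum_(i : idx) (\sum_(a < m.+1) T i j a * W k i (m - a)%N)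
  = if j == k then Zs m else 0.

Lemma TW_ser (i l : idx) : \sum_j sg _ (par i j && par j l) * (T i j * (W j l : ser Y)) = (i == l)%:R.
Proof.
apply/funext => m; rewrite ser_sum ser_nat -TW_W; apply: eq_bigr => j _.
by rewrite (@endmul_entry _ _ _ _ (par i j)) ?ser_sg // => d k; exact/yhomog_part/yhomogT.
Qed.

Lemma WT_ser (i l : idx) : \sum_j sg _ (par i j && par j l) * ((W i j : ser Y) * T j l) = (i == l)%:R.
Proof.
apply/funext => m; rewrite ser_sum ser_nat -WT_W; apply: eq_bigr => j _.
rewrite (@endmul_entry _ _ _ _ (par i j)) ?ser_sg // => d k.
exact/yhomog_part/(yhomogW TW_ser).
Qed.

Lemma ZW_ser (j k : idx) : \sum_i T i j * (W k i : ser Y) = (j == k)%:R * (Zs : ser Y).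
Proof.
apply/funext => m; rewrite ser_sum.
transitivity (if j == k then Zs m else 0); last first.
  by case: (j == k); rewrite ?mul1r ?mul0r.
by rewrite -ZW_W; apply: eq_bigr => i _; rewrite serM.
Qed.

Let Zf (k : nat) : Y := Zs k.*2.+2.
Let cz (k : nat) : K := - (2 * k.*2.+1)%:R.
Let cz_neq0 k : cz k != 0.
Proof. by rewrite /cz oppr_eq0 mulnS addSn charK. Qed.
Let Zf_even k : yhomog false (Zf k). Proof. exact: (Zs_even TW_ser ZW_ser). Qed.
Let Zf_central k y : Zf k * y = y * Zf k.
Proof. exact: (Zs_central TW_ser WT_ser ZW_ser). Qed.
Let Zf_lead k := Zs_lead TW_ser WT_ser ZW_ser k.

Lemma yalg_center x : (forall y, supercomm (@ypr K n D) x y = 0) <->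
  forall B : {pred Y}, GRing.subalg_closed B ->
    (forall y, (exists r : nat, y = Zs (2 * r.+1)%N) -> y \in B) -> x \in B.
Proof.
have e r : Zs (2 * r.+1)%N = Zf r by rewrite /Zf; congr Zs; lia.
rewrite -scentral_supercomm (center_generated charK cz_neq0 Zf_even Zf_lead Zf_central).
split=> h B cB hB; apply: h => //.
  by move=> r; apply: hB; exists r; rewrite e.
by move=> y [r ->]; rewrite e.
Qed.

Lemma yalg_independent m (E : eqType) (ex : E -> 'I_m -> nat) (s : seq E) (c : E -> K) :
  (forall e f, ex e =1 ex f -> e = f) -> uniq s ->
  \sum_(e <- s) (c e)%:A * \prod_(r < m) Zs (2 * r.+1)%N ^+ ex e r = 0 ->
  forall e, e \in s -> c e = 0.
Proof.
move=> ex_inj us H.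
apply: (Zf_independent charK cz_neq0 Zf_even Zf_lead Zf_central ex_inj us).
rewrite -[RHS]H; apply: eq_bigr => e _; rewrite mulr_algl; congr (_ *: _).
apply: eq_bigr => r _; congr (_ ^+ _); congr Zs; lia.
Qed.
End YangianCenter.

End CenterOfYangian.
Import CenterOfYangian.

From mathcomp Require Import mpoly.

Theorem theorem3p4 (R : realType) (N : nat) (hN : (1 <= N)%N)
    (Ttilde : idx N -> idx N -> yseries R[i] N) (Z : yseries R[i] N)
    (hT : is_inverse (@yT R[i] N) Ttilde)
    (hZ : forall (j k : idx N) (n : nat),
        \sum_(i : idx N) smul (yT R[i] i j) (Ttilde k i) n
          = if j == k then Z n else 0) :
  (forall (m : nat) (p : {mpoly R[i][m]}),
      mpoly.mmap (fun c : R[i] => c%:A : yangian R[i] N)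
           (fun r : 'I_m => Z (2 * r.+1)%N) p = 0 -> p = 0)
  /\ (forall x : yangian R[i] N,
        supercentral x
        <-> subalg_gen (fun y => exists r : nat, y = Z (2 * r.+1)%N) x).
Proof.
case: N hN Ttilde Z hT hZ => [//|n] _ W Z [TW WT] hZ.
have char0 m : m.+1%:R != 0 :> R[i] by rewrite pnatr_eq0.
(* The hypotheses on [W] and [Z] match those of the interface by unfolding [yangian_yalg]. *)
have center := @yalg_center _ n (yangian_yalg R[i] n) char0 W Z TW WT hZ.
have indep := @yalg_independent _ n (yangian_yalg R[i] n) char0 W Z TW WT hZ.
split; last exact: center.
move=> m p hp; apply/mpolyP => e; rewrite mcoeff0.
have [es|/memN_msupp_eq0 -> //] := boolP (e \in msupp p).
apply: (indep m _ (fun (e : 'X_{1..m}) i => e i) (msupp p) (fun e => p@_e)) es => //.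
by move=> f g fg; apply/mnmP.
Qed.
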